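(* Let $A=\{\mathbf a_1,\dots,\mathbf a_n\}\subset\mathbb Z^d$ with $\mathbb ZA=\mathbb Z^d$, and let $\boldsymbol\alpha,\boldsymbol\beta\in\mathbb C^d$. The following are equivalent: (1) $\boldsymbol\alpha\sim\boldsymbol\beta$; (2) $H_A(\boldsymbol\alpha)\simeq H_A(\boldsymbol\beta)$ as left $D(R)$-modules; (3) ${}^RH_A(\boldsymbol\alpha)\simeq {}^RH_A(\boldsymbol\beta)$ as right $D(R)$-modules; (4) $M(\boldsymbol\alpha)\simeq M(\boldsymbol\beta)$; (5) ${}^RM(\boldsymbol\alpha)\simeq {}^RM(\boldsymbol\beta)$; (6) $L(\boldsymbol\alpha)\simeq L(\boldsymbol\beta)$; (7) ${}^RL(\boldsymbol\alpha)\simeq {}^RL(\boldsymbol\beta)$.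
   Context: $A=\{\mathbf a_1,\dots,\mathbf a_n\}$ is a finite set of column vectors in $\mathbb Z^d$ generating the group $\mathbb Z^d$, also viewed as the $d\times n$ matrix $(a_{ij})$; $\mathbb NA$ is the monoid generated by $A$. $R_A=\mathbb C[\mathbb NA]=\bigoplus_{\mathbf a\in\mathbb NA}\mathbb C t^{\mathbf a}\subseteq\mathbb C[t_1^{\pm1},\dots,t_d^{\pm1}]$, and $D(R_A)=\{P\in\mathbb C[t_1^{\pm1},\dots,t_d^{\pm1}]\langle\partial_1,\dots,\partial_d\rangle: P(R_A)\subseteq R_A\}$ is its ring of differential operators; $s_j=t_j\partial_j\in D(R_A)$. $M(\boldsymbol\alpha)=D(R_A)/\sum_{i}D(R_A)(s_i-\alpha_i)$ and ${}^RM(\boldsymbol\alpha)=D(R_A)/\sum_i(s_i-\alpha_i)D(R_A)$. Let $\mathcal O$ be the category of left $D(R_A)$-modules $M=\bigoplus_{\boldsymbol\lambda\in\mathbb C^d}M_{\boldsymbol\lambda}$ with finite-dimensional $M_{\boldsymbol\lambda}=\{x: f(s)x=f(\boldsymbol\lambda)x\ \forall f\in\mathbb C[s]\}$, and ${}^R\mathcal O$ the analogous category of right modules with $M_{\boldsymbol\lambda}=\{x: xf(s)=f(-\boldsymbol\lambda)x\}$. $M(\boldsymbol\alpha)\in\mathcal O$ has a unique simple quotient $L(\boldsymbol\alpha)$, and ${}^RM(\boldsymbol\alpha)\in{}^R\mathcal O$ has a unique simple quotient ${}^RL(\boldsymbol\alpha)$. $R=\mathbb C[x_1,\dots,x_n]$,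 $D(R)$ is the $n$-th Weyl algebra, $I_A(x)\subseteq\mathbb C[x]$ is the ideal generated by all $x^{\mathbf u}-x^{\mathbf v}$ ($\mathbf u,\mathbf v\in\mathbb N^n$, $A\mathbf u=A\mathbf v$), and $I_A(\partial)$ is the analogous ideal in $\mathbb C[\partial/\partial x_1,\dots,\partial/\partial x_n]$. $H_A(\boldsymbol\alpha)=D(R)/\big(\sum_{i=1}^dD(R)(\sum_j a_{ij}x_j\partial_{x_j}-\alpha_i)+D(R)I_A(\partial)\big)$ and ${}^RH_A(\boldsymbol\alpha)=D(R)/\big(\sum_{i=1}^d(\sum_j a_{ij}x_j\partial_{x_j}-\alpha_i)D(R)+I_A(x)D(R)\big)$. For a face $\tau$ of the cone $\mathbb R_{\ge0}A$, $E_\tau(\boldsymbol\alpha)=\{\boldsymbol\lambda\in\mathbb C(A\cap\tau)/\mathbb Z(A\cap\tau):\boldsymbol\alpha-\boldsymbol\lambda\in\mathbb NA+\mathbb Z(A\cap\tau)\}$. Write $\boldsymbol\alpha\sim\boldsymbol\beta$ iff $E_\tau(\boldsymbol\alpha)=E_\tau(\boldsymbol\beta)$ for all faces $\tau$. *)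

(* Defs.v *)
From Stdlib Require List.
From HB Require Import structures.
From mathcomp Require Import all_boot all_order all_algebra.
From mathcomp Require Import reals complex.
Set Implicit Arguments. Unset Strict Implicit. Unset Printing Implicit Defensive.
Import Order.TTheory GRing.Theory Num.Theory.
Local Open Scope ring_scope.

(* Differential operators, realized faithfully as operators acting on formal *)
(* Laurent series  f = sum_m f(m) t^m  (m : Z^k), represented as functions   *)
(* 'cV[int]_k -> C.  (In characteristic 0 the ring C[t^{+-1}]<d> acts        *)
(* faithfully on C[t^{+-1}] and hence on these series.)                      *)
Section Operators.
Variable C : fieldType.
Variable k : nat.

Definition Ser := 'cV[int]_k -> C.
Definition Op := Ser -> Ser.

Definition opzero : Op := fun f m => 0.
Definition opid : Op := fun f => f.
Definition opadd (P Q : Op) : Op := fun f m => P f m + Q f m.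
Definition opsub (P Q : Op) : Op := fun f m => P f m - Q f m.
Definition opcomp (P Q : Op) : Op := fun f => P (Q f).
Definition opscal (c : C) : Op := fun f m => c * f m.

Definition tmul (u : 'cV[int]_k) : Op := fun f m => f (m - u).
(* the partial derivative d/dt_i : coefficient of t^m in d_i f is (m_i+1) f(m+e_i) *)
Definition tder (i : 'I_k) : Op :=
  fun f m => ((m i 0) + 1)%:~R * f (m + delta_mx i 0).
Definition tderpow (v : 'I_k -> nat) : Op :=
  foldr (fun i P => opcomp (iter (v i) (opcomp (tder i)) opid) P) opid (enum 'I_k).
Definition mono (c : C) (u : 'cV[int]_k) (v : 'I_k -> nat) : Op :=
  opcomp (opscal c) (opcomp (tmul u) (tderpow v)).
Definition opsum (s : seq Op) : Op := foldr opadd opzero s.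

Definition LWwith (cond : 'cV[int]_k -> ('I_k -> nat) -> Prop) (P : Op) : Prop :=
  exists s : seq (C * 'cV[int]_k * ('I_k -> nat)),
    (forall t, List.In t s -> cond t.1.2 t.2) /\
    P = opsum (map (fun t => mono t.1.1 t.1.2 t.2) s).

Definition LaurentWeyl : Op -> Prop := LWwith (fun _ _ => True).
Definition Weyl : Op -> Prop := LWwith (fun u _ => forall i, 0 <= u i 0).
Definition PolyX : Op -> Prop :=
  LWwith (fun u v => (forall i, 0 <= u i 0) /\ forall i, v i = 0%N).
Definition PolyD : Op -> Prop := LWwith (fun u _ => u = 0).

Definition LeftGen (S G : Op -> Prop) (Q : Op) : Prop :=
  exists s : seq (Op * Op), (forall t, List.In t s -> S t.1 /\ G t.2) /\
    Q = opsum (map (fun t => opcomp t.1 t.2) s).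
Definition RightGen (S G : Op -> Prop) (Q : Op) : Prop :=
  exists s : seq (Op * Op), (forall t, List.In t s -> S t.1 /\ G t.2) /\
    Q = opsum (map (fun t => opcomp t.2 t.1) s).
Definition IdSum (I J : Op -> Prop) (Q : Op) : Prop :=
  exists Q1 Q2, I Q1 /\ J Q2 /\ Q = opadd Q1 Q2.

(* S/I ~= S/J as left S-modules (I, J left ideals of S), written on
   representatives: phi : S -> S induces a well-defined bijective S-linear map *)
Definition LeftModIso (S I J : Op -> Prop) : Prop :=
  exists phi : Op -> Op,
    (forall P, S P -> S (phi P)) /\
    (forall P Q, S P -> S Q -> (I (opsub P Q) <-> J (opsub (phi P) (phi Q)))) /\
    (forall Q, S Q -> exists P, S P /\ J (opsub (phi P) Q)) /\
    (forall P Q, S P -> S Q -> J (opsub (phi (opadd P Q)) (opadd (phi P) (phi Q)))) /\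
    (forall X P, S X -> S P -> J (opsub (phi (opcomp X P)) (opcomp X (phi P)))).
Definition RightModIso (S I J : Op -> Prop) : Prop :=
  exists phi : Op -> Op,
    (forall P, S P -> S (phi P)) /\
    (forall P Q, S P -> S Q -> (I (opsub P Q) <-> J (opsub (phi P) (phi Q)))) /\
    (forall Q, S Q -> exists P, S P /\ J (opsub (phi P) Q)) /\
    (forall P Q, S P -> S Q -> J (opsub (phi (opadd P Q)) (opadd (phi P) (phi Q)))) /\
    (forall X P, S X -> S P -> J (opsub (phi (opcomp P X)) (opcomp (phi P) X))).

Definition IsLeftIdeal (S N : Op -> Prop) : Prop :=
  (forall P, N P -> S P) /\ N opzero /\
  (forall P Q, N P -> N Q -> N (opadd P Q)) /\
  (forall X P, S X -> N P -> N (opcomp X P)).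
Definition IsRightIdeal (S N : Op -> Prop) : Prop :=
  (forall P, N P -> S P) /\ N opzero /\
  (forall P Q, N P -> N Q -> N (opadd P Q)) /\
  (forall X P, S X -> N P -> N (opcomp P X)).

(* N is a maximal proper left ideal of S containing I, i.e. S/N is a simple
   quotient of S/I *)
Definition MaxLeftOver (S I N : Op -> Prop) : Prop :=
  IsLeftIdeal S N /\ (forall P, I P -> N P) /\ ~ N opid /\
  (forall N', IsLeftIdeal S N' -> (forall P, N P -> N' P) -> ~ N' opid ->
     forall P, N' P -> N P).
Definition MaxRightOver (S I N : Op -> Prop) : Prop :=
  IsRightIdeal S N /\ (forall P, I P -> N P) /\ ~ N opid /\
  (forall N', IsRightIdeal S N' -> (forall P, N P -> N' P) -> ~ N' opid ->
     forall P, N' P -> N P).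

End Operators.

Section Toric.
Variable R : realType.
Notation C := (complex R).
Variables d n : nat.
Variable A : 'M[int]_(d, n).

Definition inNA (m : 'cV[int]_d) : Prop := exists c : 'I_n -> nat,
  m = \sum_(j < n) (c j)%:Z *: col j A.

(* R_A = C[NA] inside C[t^{+-1}] : finitely supported, support in NA *)
Definition inRA (f : Ser C d) : Prop :=
  (exists s : seq 'cV[int]_d, forall m, f m != 0 -> m \in s) /\
  (forall m, f m != 0 -> inNA m).

Definition DRA (P : Op C d) : Prop :=
  LaurentWeyl P /\ forall f, inRA f -> inRA (P f).

Definition s_op (j : 'I_d) : Op C d := opcomp (tmul (delta_mx j 0)) (tder j).

Definition s_gens (al : 'cV[C]_d) (g : Op C d) : Prop :=
  exists i, g = opsub (s_op i) (opscal (al i 0)).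

Definition M_ideal (al : 'cV[C]_d) := LeftGen DRA (s_gens al).
Definition RM_ideal (al : 'cV[C]_d) := RightGen DRA (s_gens al).

Definition euler (i : 'I_d) : Op C n :=
  opsum [seq opcomp (opscal (A i j)%:~R) (opcomp (tmul (delta_mx j 0)) (tder j))
        | j <- enum 'I_n].
Definition euler_gens (al : 'cV[C]_d) (g : Op C n) : Prop :=
  exists i, g = opsub (euler i) (opscal (al i 0)).
Definition natvec (u : 'I_n -> nat) : 'cV[int]_n := \col_j (u j)%:Z.
Definition sameA (u v : 'I_n -> nat) : Prop := A *m natvec u = A *m natvec v.
Definition IA_del : Op C n -> Prop :=
  LeftGen (@PolyD C n)
    (fun g => exists u v, sameA u v /\ g = opsub (tderpow u) (tderpow v)).
Definition IA_x : Op C n -> Prop :=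
  LeftGen (@PolyX C n)
    (fun g => exists u v, sameA u v /\ g = opsub (tmul (natvec u)) (tmul (natvec v))).

Definition HA_ideal (al : 'cV[C]_d) : Op C n -> Prop :=
  IdSum (LeftGen (@Weyl C n) (euler_gens al)) (LeftGen (@Weyl C n) IA_del).
Definition RHA_ideal (al : 'cV[C]_d) : Op C n -> Prop :=
  IdSum (RightGen (@Weyl C n) (euler_gens al)) (RightGen (@Weyl C n) IA_x).

Definition colR (j : 'I_n) : 'cV[R]_d := map_mx (fun z : int => z%:~R) (col j A).
Definition colC (j : 'I_n) : 'cV[C]_d := map_mx (fun z : int => z%:~R) (col j A).
Definition inCone (x : 'cV[R]_d) : Prop :=
  exists r : 'I_n -> R, (forall j, 0 <= r j) /\ x = \sum_j r j *: colR j.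
Definition isFace (tau : 'cV[R]_d -> Prop) : Prop :=
  exists l : 'rV[R]_d,
    (forall x, inCone x -> 0 <= (l *m x) 0 0) /\
    (forall x, tau x <-> inCone x /\ (l *m x) 0 0 = 0).

Definition inCspan (tau : 'cV[R]_d -> Prop) (x : 'cV[C]_d) : Prop :=
  exists c : 'I_n -> C, (forall j, ~ tau (colR j) -> c j = 0) /\
    x = \sum_j c j *: colC j.
Definition inZspan (tau : 'cV[R]_d -> Prop) (x : 'cV[C]_d) : Prop :=
  exists z : 'I_n -> int, (forall j, ~ tau (colR j) -> z j = 0) /\
    x = \sum_j (z j)%:~R *: colC j.
Definition inNAZ (tau : 'cV[R]_d -> Prop) (x : 'cV[C]_d) : Prop :=
  exists (c : 'I_n -> nat) (z : 'I_n -> int), (forall j, ~ tau (colR j) -> z j = 0) /\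
    x = \sum_j ((c j)%:R + (z j)%:~R) *: colC j.

(* the class [lam] in C(A cap tau)/Z(A cap tau) belongs to E_tau(al) *)
Definition inE (tau : 'cV[R]_d -> Prop) (al lam : 'cV[C]_d) : Prop :=
  exists lam', inCspan tau lam' /\ inZspan tau (lam' - lam) /\ inNAZ tau (al - lam').

(* E_tau(al) = E_tau(be) as subsets of C(A cap tau)/Z(A cap tau) *)
Definition Eeq (tau : 'cV[R]_d -> Prop) (al be : 'cV[C]_d) : Prop :=
  forall lam, inCspan tau lam -> (inE tau al lam <-> inE tau be lam).

Definition simA (al be : 'cV[C]_d) : Prop :=
  forall tau, isFace tau -> Eeq tau al be.

End Toric.

(* Main.v *)
Require Import Defs.
From HB Require Import structures.
From mathcomp Require Import all_boot all_order all_algebra.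
From mathcomp Require Import reals complex.
From mathcomp Require Import boolp ring zify.
Set Implicit Arguments. Unset Strict Implicit. Unset Printing Implicit Defensive.
Import Order.TTheory GRing.Theory Num.Theory.
Local Open Scope ring_scope.

(* D(R_A) is spanned by the operators t^u p(s) with p vanishing on
   NA \ (NA - u), so weight arguments show that each isomorphism between the
   modules M or L (left or right) is equivalent to: al - be = u is integral, some
   t^u p(s) in D(R_A) has p(be) <> 0, and some t^(-u) q(s) in D(R_A) has
   q(al) <> 0. Decomposing NA \ (NA - u) into translated orthants and passing
   to Zariski closures, p(be) <> 0 for some such p iff E_tau(be) is contained in
   E_tau(be + u) for all faces tau, whence the equivalence with al ~ be.
   Every t^u p(s) in D(R_A) lifts to the Weyl algebra, which turns such a pair
   (p, q) into an isomorphism of the right modules RH_A. Conversely, for every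
   tau, E_tau(al) is an isomorphism invariant of RH_A(al): it records for which
   exponents lam the D(R)-module N spanned by the x^(lam + m), m in Z^n with
   m_j >= 0 for a_j outside tau, satisfies RH_A(al) (x) N <> 0. The
   anti-automorphism x_i <-> d_i of the Weyl algebra exchanges H_A and RH_A. *)

(** * Polynomial functions and falling factorials *)

(** Operators act on series with integral exponents, while the parameters lie in C^d. Each
    homogeneous component acts on t^m through a polynomial in m, so [act] evaluates an operator at
    any complex exponent without introducing functions t^x; the module N above survives only as the
    constraint on exponents in [Weyl_good]. D(R_A) and the Weyl algebra are two instances of the
    operators stabilizing the span of a set of monomials ([stab]), so the subring axioms and the
    membership of polynomials in s are proved once. The Zariski closure of an orthant w + N^F
    involves the columns in F, whereas E_tau involves faces; Farkas' lemma bridges the two.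
    Transposition is a relation, not a function: an operator comes with no chosen expression in
    monomials, and adjointness for a pairing with <x^m, x^m> = m! determines the transpose without
    one. *)

Section PolyFun.
Variable C : numFieldType.

(** Polynomials in several variables, kept as functions: over an infinite field nothing is lost, and
    substituting shifts or linear maps is plain composition. *)
Inductive polyfun k : ('cV[C]_k -> C) -> Prop :=
| polyfun_cst c : polyfun (fun _ => c)
| polyfun_coord i : polyfun (fun x => x i 0)
| polyfun_add f g : polyfun f -> polyfun g -> polyfun (fun x => f x + g x)
| polyfun_mul f g : polyfun f -> polyfun g -> polyfun (fun x => f x * g x).

Lemma polyfun_sub k (f g : 'cV[C]_k -> C) :
  polyfun f -> polyfun g -> polyfun (fun x => f x - g x).
Proof.
move=> hf hg; rewrite (_ : (fun x => _) = fun x => f x + -1 * g x).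
  exact/polyfun_add/polyfun_mul/hg/polyfun_cst.
by apply/funext => x; rewrite mulN1r.
Qed.

Lemma polyfun_sum k (I : Type) (r : seq I) (P : pred I) (F : I -> 'cV[C]_k -> C) :
  (forall i, polyfun (F i)) -> polyfun (fun x => \sum_(i <- r | P i) F i x).
Proof.
move=> hF; elim: r => [|i r IH].
  rewrite (_ : (fun x => _) = fun => 0); first exact: polyfun_cst.
  by apply/funext => x; rewrite big_nil.
rewrite (_ : (fun x => _) = fun x => (if P i then F i x else 0)
  + \sum_(i <- r | P i) F i x); last first.
  by apply/funext => x; rewrite big_cons; case: ifP => // _; rewrite add0r.
by apply: polyfun_add => //; case: (P i) => //; apply: polyfun_cst.
Qed.

Lemma polyfun_prod k (I : Type) (r : seq I) (P : pred I) (F : I -> 'cV[C]_k -> C) :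
  (forall i, polyfun (F i)) -> polyfun (fun x => \prod_(i <- r | P i) F i x).
Proof.
move=> hF; elim: r => [|i r IH].
  rewrite (_ : (fun x => _) = fun => 1); first exact: polyfun_cst.
  by apply/funext => x; rewrite big_nil.
rewrite (_ : (fun x => _) = fun x => (if P i then F i x else 1)
  * \prod_(i <- r | P i) F i x); last first.
  by apply/funext => x; rewrite big_cons; case: ifP => // _; rewrite mul1r.
by apply: polyfun_mul => //; case: (P i) => //; apply: polyfun_cst.
Qed.

Lemma polyfun_comp k l (f : 'cV[C]_k -> C) (h : 'cV[C]_l -> 'cV[C]_k) :
  polyfun f -> (forall i, polyfun (fun x => h x i 0)) ->
  polyfun (fun x => f (h x)).
Proof.
move=> hf hh; elim: hf => [c|i|f' g _ IHf _ IHg|f' g _ IHf _ IHg].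
- exact: polyfun_cst.
- exact: hh.
- exact: polyfun_add.
- exact: polyfun_mul.
Qed.

Lemma polyfun_shift k (f : 'cV[C]_k -> C) v :
  polyfun f -> polyfun (fun x => f (x + v)).
Proof.
move=> hf; apply: (polyfun_comp (h := fun x => x + v)) => // i.
rewrite (_ : (fun x => _) = fun x : 'cV[C]_k => x i 0 + v i 0).
  exact: polyfun_add (polyfun_coord _) (polyfun_cst _ _).
by apply/funext => x; rewrite mxE.
Qed.

Lemma polyfun_mulmx k l (f : 'cV[C]_k -> C) (B : 'M[C]_(k, l)) :
  polyfun f -> polyfun (fun x => f (B *m x)).
Proof.
move=> hf; apply: (polyfun_comp (h := fun x => B *m x)) => // i.
rewrite (_ : (fun x => _) = fun x : 'cV[C]_l => \sum_j B i j * x j 0).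
  by apply: polyfun_sum => j; apply: polyfun_mul (polyfun_cst _ _) (polyfun_coord _).
by apply/funext => x; rewrite mxE.
Qed.

Lemma polyfun_line k (f : 'cV[C]_k -> C) x v :
  polyfun f -> exists q : {poly C}, forall c, f (x + c *: v) = q.[c].
Proof.
elim=> [c|i|f1 f2 _ [q1 h1] _ [q2 h2]|f1 f2 _ [q1 h1] _ [q2 h2]].
- by exists c%:P => a; rewrite hornerC.
- by exists ((x i 0)%:P + v i 0 *: 'X) => a; rewrite !hornerE !mxE mulrC.
- by exists (q1 + q2) => a; rewrite hornerD h1 h2.
- by exists (q1 * q2) => a; rewrite hornerM h1 h2.
Qed.

Lemma poly_eq0_nat (q : {poly C}) : (forall m : nat, q.[m%:R] = 0) -> q = 0.
Proof.
move=> hq; apply: contrapT => /eqP q0.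
have /max_poly_roots : q != 0 by [].
move=> /(_ [seq i%:R | i <- iota 0 (size q)]).
rewrite size_map size_iota ltnn => H; suff : false by [].
apply: H; first by apply/allP => _ /mapP[i _ ->]; rewrite /root hq.
rewrite map_inj_uniq ?iota_uniq // => i j /eqP.
by rewrite eqr_nat => /eqP.
Qed.

(** Zariski density of a translated orthant in its affine span. Coordinates are freed one at a time:
    along a single direction the function is a univariate polynomial with infinitely many roots. *)
Lemma polyfun_vanish k n (f : 'cV[C]_k -> C) x0 (v : 'I_n -> 'cV[C]_k) :
  polyfun f -> (forall m : 'I_n -> nat, f (x0 + \sum_j (m j)%:R *: v j) = 0) ->
  forall c : 'I_n -> C, f (x0 + \sum_j c j *: v j) = 0.
Proof.
move=> hf h0.
suff H (s : seq 'I_n) : forall c : 'I_n -> C,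
   (forall j, j \notin s -> exists m : nat, c j = m%:R) ->
   f (x0 + \sum_j c j *: v j) = 0.
  by move=> c; apply: (H (enum 'I_n)) => j; rewrite mem_enum.
elim: s => [|i s IH] c hc.
  have /choice[m hm] : forall j, exists m : nat, c j = m%:R by move=> j; apply: hc.
  by under eq_bigr => j _ do rewrite hm; exact: h0.
have [q hq] := polyfun_line (x0 + \sum_(j | j != i) c j *: v j) (v i) hf.
have q0 : q = 0.
  apply: poly_eq0_nat => m; rewrite -hq.
  rewrite -[RHS](IH (fun j => if j == i then m%:R else c j)).
    congr f; rewrite [in RHS](bigD1 i) //= eqxx -addrA; congr (_ + _).
    by rewrite addrC; congr (_ + _); apply: eq_bigr => j /negPf ->.
  move=> j js; case: eqVneq => [_|ji]; first by exists m.
  by apply: hc; rewrite inE negb_or ji.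
by rewrite (bigD1 i) //= addrCA addrC hq q0 horner0.
Qed.

(** A product of factors (z_i - y_i) / (x_i - y_i), one for each [y]. It serves to isolate one
    weight among finitely many. *)
Lemma polyfun_separate k (s : seq 'cV[C]_k) (x : 'cV[C]_k) : x \notin s ->
  exists f, [/\ polyfun f, f x = 1 & forall y, y \in s -> f y = 0].
Proof.
elim: s => [_|y s IH]; first by exists (fun=> 1); split=> //; apply: polyfun_cst.
rewrite inE negb_or => /andP[xy /IH[f [pf f1 f0]]].
have [i xyi] : exists i, x i 0 != y i 0.
  apply: contrapT => H; move/eqP: xy; apply; apply/matrixP => a b.
  by rewrite ord1; apply: contrapT => /eqP ?; apply: H; exists a.
exists (fun z => f z * ((z i 0 - y i 0) * (x i 0 - y i 0)^-1)); split.
- apply: polyfun_mul => //; apply: polyfun_mul; last exact: polyfun_cst.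
  exact: polyfun_sub (polyfun_coord _) (polyfun_cst _ _).
- by rewrite f1 mul1r divff // subr_eq0.
- move=> z; rewrite inE => /orP[/eqP ->|zs]; first by rewrite subrr mul0r mulr0.
  by rewrite f0 ?mul0r.
Qed.

(** Used for the congruence of f(s) with f(al) modulo the s_i - al_i. A product is split as (f1 -
    f1(x)) f2 + f1(x) (f2 - f2(x)). *)
Lemma polyfun_taylor1 k (f : 'cV[C]_k -> C) (x : 'cV[C]_k) : polyfun f ->
  exists g : 'I_k -> 'cV[C]_k -> C, (forall i, polyfun (g i)) /\
    forall y, f y - f x = \sum_i g i y * (y i 0 - x i 0).
Proof.
elim=> [c|i|f1 f2 p1 [g1 [pg1 h1]] p2 [g2 [pg2 h2]]|f1 f2 p1 [g1 [pg1 h1]] p2 [g2 [pg2 h2]]].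
- exists (fun _ _ => 0); split=> [_|y]; first exact: polyfun_cst.
  by rewrite subrr big1 // => i _; rewrite mul0r.
- exists (fun j _ => (j == i)%:R); split=> [j|y]; first exact: polyfun_cst.
  by rewrite (bigD1 i) //= eqxx mul1r big1 ?addr0 // => j /negPf ->; rewrite mul0r.
- exists (fun i y => g1 i y + g2 i y); split=> [i|y]; first exact: polyfun_add.
  under eq_bigr do rewrite mulrDl.
  by rewrite big_split /= -h1 -h2; ring.
- exists (fun i y => g1 i y * f2 y + f1 x * g2 i y); split=> [i|y].
    by apply: polyfun_add; apply: polyfun_mul => //; apply: polyfun_cst.
  under eq_bigr do rewrite mulrDl mulrAC -mulrA -[_ * _ * (_ - _)]mulrA.
  rewrite big_split /= -!mulr_sumr -h2.
  under eq_bigr do rewrite mulrA.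
  rewrite -mulr_suml -h1; ring.
Qed.

(** Passage from formal sums, in which a monomial may occur several times, to coefficients: the
    terms are grouped by key. *)
Lemma sum_keyed0 (K : eqType) (s : seq (C * K)) (F : K -> C) (P : pred K) :
  (forall w, P w -> F w = 0 \/ \sum_(t <- s | t.2 == w) t.1 = 0) ->
  \sum_(t <- s | P t.2) t.1 * F t.2 = 0.
Proof.
move=> H; pose U := undup (map snd s).
transitivity (\sum_(t <- s | P t.2) \sum_(w <- U | w == t.2) t.1 * F w).
  rewrite [LHS]big_seq_cond [RHS]big_seq_cond; apply: eq_bigr => t /andP[ts _].
  rewrite (big_rem t.2) ?mem_undup ?map_f //= eqxx big_seq_cond big1 ?addr0 // => w.
  by rewrite mem_rem_uniq ?undup_uniq // inE => /andP[/andP[/negP]].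
under eq_bigr do rewrite big_mkcond.
rewrite exchange_big big1 //= => w _.
transitivity (\sum_(t <- s | P t.2 && (t.2 == w)) t.1 * F w).
  by rewrite big_mkcondr /=; apply: eq_bigr => t _; rewrite eq_sym.
case: (boolP (P w)) => [Pw|nPw]; last first.
  by rewrite big1 // => t /andP[+ /eqP tw]; rewrite tw (negPf nPw).
rewrite -mulr_suml (eq_bigl (fun t => t.2 == w)); last first.
  by move=> t /=; case: eqP => [->|]; rewrite ?Pw ?andbF.
by case: (H _ Pw) => ->; rewrite ?mulr0 ?mul0r.
Qed.

(** * Falling factorials and expansions in them *)

Definition fallfact (x : C) m := \prod_(j < m) (x - j%:R).
(** At the Euler operators s this is t^w d^w, so an expansion in falling factorials is an expansion
    in monomials of the Weyl algebra. *)
Definition fall k (w : {ffun 'I_k -> nat}) (x : 'cV[C]_k) :=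
  \prod_i fallfact (x i 0) (w i).

Lemma fallfactS x m : fallfact x m.+1 = fallfact x m * (x - m%:R).
Proof. by rewrite /fallfact big_ord_recr. Qed.

Lemma fallfact_nat a m : fallfact a%:R m = (a ^_ m)%:R.
Proof.
elim: m => [|m IH]; first by rewrite /fallfact big_ord0 ffactn0.
rewrite fallfactS IH ffactnSr natrM.
case: (leqP m a) => ma; first by rewrite natrB.
by rewrite ffact_small // !mul0r.
Qed.

Lemma polyfun_fall k (w : {ffun 'I_k -> nat}) : polyfun (fall w).
Proof.
apply: polyfun_prod => i; apply: polyfun_prod => j.
exact: polyfun_sub (polyfun_coord _) (polyfun_cst _ _).
Qed.

Definition ncol k (w : {ffun 'I_k -> nat}) : 'cV[C]_k := \col_i (w i)%:R.

Lemma fall_ncol k (w m : {ffun 'I_k -> nat}) :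
  fall w (ncol m) = (\prod_i (m i ^_ w i))%N%:R.
Proof.
rewrite /fall natr_prod; apply: eq_bigr => i _.
by rewrite mxE fallfact_nat.
Qed.

Lemma fall_ncol_neq0 k (w m : {ffun 'I_k -> nat}) :
  fall w (ncol m) != 0 -> forall i, (w i <= m i)%N.
Proof.
rewrite fall_ncol pnatr_eq0 => H i; rewrite leqNgt; apply: contra H => H.
by rewrite (bigD1 i) //= ffact_small.
Qed.

Lemma fall_ncol_diag k (w : {ffun 'I_k -> nat}) : fall w (ncol w) != 0.
Proof.
rewrite fall_ncol pnatr_eq0 -lt0n prodn_gt0 // => i.
by rewrite ffact_gt0.
Qed.

(** The induction multiplies an arbitrary expansion by f, so that a product f1 f2 amounts to two
    successive multiplications. *)
Lemma fall_span k (f : 'cV[C]_k -> C) : polyfun f ->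
  exists s : seq (C * {ffun 'I_k -> nat}),
    f = fun x => \sum_(t <- s) t.1 * fall t.2 x.
Proof.
move=> pf.
suff : forall s : seq (C * {ffun 'I_k -> nat}),
  exists s' : seq (C * {ffun 'I_k -> nat}),
    (fun x => f x * \sum_(t <- s) t.1 * fall t.2 x) =
    fun x => \sum_(t <- s') t.1 * fall t.2 x.
  case/(_ [:: (1, [ffun=> 0%N])]) => s' hs; exists s'; rewrite -hs.
  apply/funext => x; rewrite big_seq1 mul1r /fall big1 ?mulr1 // => i _.
  by rewrite ffunE /fallfact big_ord0.
elim: pf => [c|i|f1 f2 _ IH1 _ IH2|f1 f2 _ IH1 _ IH2] s.
- exists [seq (c * t.1, t.2) | t <- s]; apply/funext => x.
  by rewrite big_map mulr_sumr; apply: eq_bigr => t _; rewrite mulrA.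
(* With [x]_a the falling factorial, x [x]_a = [x]_(a+1) + a [x]_a. *)
- pose up (w : {ffun 'I_k -> nat}) := [ffun j => (w j + (j == i))%N].
  exists ([seq (t.1, up t.2) | t <- s] ++
          [seq (t.1 * (t.2 i)%:R, t.2) | t : C * {ffun 'I_k -> nat} <- s]); apply/funext => x.
  rewrite big_cat /= !big_map -big_split mulr_sumr; apply: eq_bigr => t _ /=.
  have E : \prod_(j < k | j != i) fallfact (x j 0) (up t.2 j) =
           \prod_(j < k | j != i) fallfact (x j 0) (t.2 j).
    by apply: eq_bigr => j /negPf ji; rewrite ffunE ji addn0.
  rewrite /fall !(bigD1 (P := predT) i) //= E ffunE eqxx addn1 fallfactS.
  by ring.
- have [s1 h1] := IH1 s; have [s2 h2] := IH2 s; exists (s1 ++ s2).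
  apply/funext => x; rewrite big_cat /= mulrDl.
  by rewrite -(congr1 (fun g => g x) h1) -(congr1 (fun g => g x) h2).
- have [s2 h2] := IH2 s; have [s1 h1] := IH1 s2; exists s1.
  by rewrite -h1; apply/funext => x; rewrite -(congr1 (fun g => g x) h2) mulrA.
Qed.

(* The falling factorials are triangular with respect to evaluation at the
   points of N^k, so on an order ideal values determine coefficients. *)
Lemma fall_triangular k (s : seq (C * {ffun 'I_k -> nat}))
    (D : {ffun 'I_k -> nat} -> Prop) :
  (forall w w' : {ffun 'I_k -> nat}, (forall i, w' i <= w i)%N -> D w -> D w') ->
  (forall w, D w -> \sum_(t <- s) t.1 * fall t.2 (ncol w) = 0) ->
  forall w, D w -> \sum_(t <- s | t.2 == w) t.1 = 0.
Proof.
move=> Ddown H w; have [N] := ubnP (\sum_i w i)%N; elim: N w => // N IH w wN Dw.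
have /eqP := H w Dw; rewrite (bigID (fun t => t.2 == w)) /=.
rewrite [X in _ + X](sum_keyed0 (F := fun w' => fall w' (ncol w))
  (P := fun w' => w' != w)); last first.
  move=> w' w'w; case: (eqVneq (fall w' (ncol w)) 0) => [|/fall_ncol_neq0 le]; [by left|right].
  apply: IH; last exact: Ddown Dw.
  rewrite -ltnS; apply: leq_trans wN; rewrite ltnS.
  rewrite ltn_neqAle; apply/andP; split; last by apply: leq_sum.
  apply: contra w'w => /eqP E; apply/eqP/ffunP => i.
  have := leqif_sum (I := 'I_k) (P := predT) (C := fun i => w' i == w i)
    (E1 := fun i => w' i) (E2 := fun i => w i).
  case=> [j _|_]; first by split.
  by rewrite E eqxx => /esym/forallP/(_ i)/eqP.
rewrite addr0 (eq_bigr (fun t => t.1 * fall w (ncol w))); last by move=> t /eqP ->.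
by rewrite -mulr_suml mulf_eq0 (negPf (fall_ncol_diag w)) orbF => /eqP.
Qed.

Lemma fall_span_upset k (f : 'cV[C]_k -> C) (D : {ffun 'I_k -> nat} -> Prop) :
  polyfun f ->
  (forall w w' : {ffun 'I_k -> nat}, (forall i, w i <= w' i)%N -> D w -> D w') ->
  (forall w, ~ D w -> f (ncol w) = 0) ->
  exists s : seq (C * {ffun 'I_k -> nat}),
    (forall t, t \in s -> D t.2) /\ f = fun x => \sum_(t <- s) t.1 * fall t.2 x.
Proof.
move=> /fall_span[s ->] Dup f0; exists [seq t <- s | `[< D t.2 >]]; split.
  by move=> t; rewrite mem_filter => /andP[/asboolP].
apply/funext => x; rewrite big_filter (bigID (fun t => `[< D t.2 >])) /=.
rewrite [X in _ + X](sum_keyed0 (F := fun w => fall w x)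
  (P := fun w => ~~ `[< D w >])) ?addr0 // => w /asboolPn nD; right.
apply: (fall_triangular (D := fun w => ~ D w)) nD => // w1 w2 le n1 d2.
by apply: n1; apply: Dup d2.
Qed.

End PolyFun.

Arguments polyfun_cst {C} k c.
Arguments polyfun_coord {C k} i.
Arguments polyfun_fall {C k} w.

(** * Symbols of differential operators *)

Section Symbols.
Variables (C : numFieldType) (k : nat).
Implicit Types (u v m : 'cV[int]_k) (x y : 'cV[C]_k) (F : 'cV[int]_k -> C).
Implicit Types (P Q : Op C k) (f : Ser C k).

Definition zc l (m : 'cV[int]_l) : 'cV[C]_l := map_mx (fun z : int => z%:~R) m.

Lemma zcD l : {morph @zc l : u v / u + v}.
Proof. by move=> u v; apply/matrixP => i j; rewrite !mxE intrD. Qed.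
Lemma zcB l : {morph @zc l : u v / u - v}.
Proof. by move=> u v; apply/matrixP => i j; rewrite !mxE intrB. Qed.
Lemma zc0 l : @zc l 0 = 0.
Proof. by apply/matrixP => i j; rewrite !mxE. Qed.
Lemma zcN l : {morph @zc l : u / - u}.
Proof. by move=> u; rewrite -sub0r zcB zc0 sub0r. Qed.
Lemma zc_inj l : injective (@zc l).
Proof.
move=> u v /matrixP E; apply/matrixP => i j; move: (E i j); rewrite !mxE.
by move/eqP; rewrite eqr_int => /eqP.
Qed.
Lemma zc_natvec (w : {ffun 'I_k -> nat}) : zc (natvec w) = ncol C w.
Proof. by apply/matrixP => i j; rewrite !mxE. Qed.

Lemma polyfun_eq0 (p : 'cV[C]_k -> C) : polyfun p ->
  (forall w : {ffun 'I_k -> nat}, p (ncol C w) = 0) -> p = fun=> 0.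
Proof.
move=> pp p0; apply/funext => x.
have := polyfun_vanish (x0 := 0) (v := fun j => delta_mx j 0) pp.
move=> /(_ _ (fun j => x j 0)) H; rewrite -[RHS]H.
  congr p; apply/matrixP => i j; rewrite ord1 !mxE summxE add0r (bigD1 i) //=.
  rewrite !mxE !eqxx mulr1 big1 ?addr0 // => l /negPf li.
  by rewrite !mxE eq_sym li mulr0.
move=> m; rewrite -[RHS](p0 (finfun m)); congr p.
apply/matrixP => i j; rewrite ord1 !mxE summxE add0r (bigD1 i) //=.
rewrite !mxE !eqxx mulr1 big1 ?addr0 ?ffunE // => l /negPf li.
by rewrite !mxE eq_sym li mulr0.
Qed.

Lemma polyfun_eq (p q : 'cV[C]_k -> C) : polyfun p -> polyfun q ->
  (forall w : {ffun 'I_k -> nat}, p (ncol C w) = q (ncol C w)) -> p = q.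
Proof.
move=> pp pq E; apply/funext => x; apply/eqP; rewrite -subr_eq0; apply/eqP.
rewrite -[LHS]/((fun x => p x - q x) x) (@polyfun_eq0 (fun x => p x - q x)) //.
  exact: polyfun_sub.
by move=> w; rewrite E subrr.
Qed.

Record polynomial_function := PolyFun
  { pfun :> 'cV[C]_k -> C; pfunP : polyfun pfun }.

(* The operator t^u p(s), where s is the vector of Euler operators. *)
Definition homog u (p : 'cV[C]_k -> C) : Op C k :=
  fun f m => p (zc (m - u)) * f (m - u).

Definition opof (L : seq ('cV[int]_k * polynomial_function)) : Op C k :=
  opsum [seq homog t.1 t.2 | t : 'cV[int]_k * polynomial_function <- L].

Lemma opsumE (I : Type) (L : seq I) (G : I -> Op C k) f m :
  opsum [seq G t | t <- L] f m = \sum_(t <- L) G t f m.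
Proof. by elim: L => [|t L IH]; rewrite ?big_nil // big_cons -IH. Qed.

Lemma opofE L f m :
  opof L f m = \sum_(t <- L) t.2 (zc (m - t.1)) * f (m - t.1).
Proof. by rewrite /opof opsumE. Qed.

Definition lact (L : seq ('cV[int]_k * polynomial_function)) F x :=
  \sum_(t <- L) F t.1 * t.2 x.

Lemma polyfun_lact L F : polyfun (lact L F).
Proof.
by apply: polyfun_sum => t; apply: polyfun_mul (polyfun_cst _ _) (pfunP _).
Qed.

Definition delta m : Ser C k := fun m' => (m' == m)%:R.

Lemma opof_delta L m m' :
  opof L (delta m) m' = lact L (fun v => (v == m' - m)%:R) (zc m).
Proof.
rewrite opofE; apply: eq_bigr => t _; rewrite /delta.
have -> : (m' - t.1 == m) = (t.1 == m' - m) by rewrite subr_eq addrC -subr_eq eq_sym.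
case: eqP => [->|]; last by rewrite mulr0 mul0r.
by rewrite subKr mulrC.
Qed.

Lemma lact_group L (S : seq 'cV[int]_k) F x : uniq S ->
  (forall t, List.In t L -> t.1 \in S) ->
  lact L F x = \sum_(u <- S) F u * lact L (fun v => (v == u)%:R) x.
Proof.
move=> US; elim: L => [|t L IH] H.
  by rewrite /lact big_nil big1 // => u _; rewrite big_nil mulr0.
rewrite /lact big_cons -/(lact L F x) IH; last by move=> t' ?; apply: H; right.
under [RHS]eq_bigr => u do rewrite big_cons mulrDr.
rewrite big_split /= -/(lact _ _ _); congr (_ + _).
have tS : t.1 \in S by apply: H; left.
rewrite (big_rem _ tS) /= eqxx mul1r big_seq big1 ?addr0 // => u.
rewrite mem_rem_uniq // inE => /andP[/negPf ut _].
by rewrite eq_sym ut mul0r mulr0.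
Qed.

Lemma lact_support (L : seq ('cV[int]_k * polynomial_function)) :
  exists S', uniq S' /\ forall t, List.In t L -> t.1 \in S'.
Proof.
exists (undup (map fst L)); split; first exact: undup_uniq.
move=> t; rewrite mem_undup; elim: L => //= t' L IH [->|/IH]; rewrite inE ?eqxx //.
by move=> ->; rewrite orbT.
Qed.

(** The operator determines each homogeneous component at the points of N^k, through its action on
    the series [delta], hence as a polynomial by density. *)
Lemma lact_wd L L' F x : opof L = opof L' -> lact L F x = lact L' F x.
Proof.
move=> E; have [S [US HS]] := lact_support (L ++ L').
have HL t : List.In t L -> t.1 \in S.
  by move=> h; apply: HS; apply/List.in_app_iff; left.
have HL' t : List.In t L' -> t.1 \in S.
  by move=> h; apply: HS; apply/List.in_app_iff; right.
rewrite (lact_group _ _ US HL) (lact_group _ _ US HL').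
apply: eq_bigr => u _; congr (_ * _).
rewrite (@polyfun_eq (lact L (fun v => (v == u)%:R)) (lact L' (fun v => (v == u)%:R))) //.
- exact: polyfun_lact.
- exact: polyfun_lact.
move=> w; rewrite -zc_natvec.
rewrite -[u](addrK (natvec w)) -!opof_delta E //.
Qed.

Lemma homog_comp u v (p q : 'cV[C]_k -> C) :
  opcomp (homog u p) (homog v q) = homog (u + v) (fun x => p (x + zc v) * q x).
Proof.
apply/funext => f; apply/funext => m; rewrite /opcomp /homog mulrA.
by rewrite -zcD opprD addrA subrK.
Qed.

Lemma iter_tder i a f m :
  iter a (opcomp (tder i)) (@opid C k) f m =
  fallfact ((m i 0)%:~R + a%:R) a * f (m + a%:Z *: delta_mx i 0).
Proof.
elim: a m => [|a IH] m; first by rewrite /= /fallfact big_ord0 mul1r scale0r addr0.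
rewrite iterS /opcomp /tder -/(opcomp _ _) IH fallfactS !mxE !eqxx mulr1n.
have -> : m + delta_mx i 0 + a%:Z *: delta_mx i 0 = m + a.+1%:Z *: delta_mx i 0.
  by rewrite -addrA -(add1n a) PoszD scalerDl scale1r.
have -> : (m i 0 + 1)%:~R + a%:R = (m i 0)%:~R + a.+1%:R :> C.
  by rewrite intrD -natr1; ring.
by rewrite intrD -natr1; ring.
Qed.

Lemma tderpowE (w : {ffun 'I_k -> nat}) f m :
  tderpow w f m = fall w (zc (m + natvec w)) * f (m + natvec w).
Proof.
pose st (s : seq 'I_k) := \sum_(i <- s) (w i)%:Z *: delta_mx i 0 : 'cV[int]_k.
have H s f' m' : uniq s ->
  foldr (fun i P => opcomp (iter (w i) (opcomp (tder i)) (@opid C k)) P) (@opid C k) s f' m'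
  = (\prod_(i <- s) fallfact ((m' i 0)%:~R + (w i)%:R) (w i)) * f' (m' + st s).
  elim: s f' m' => [|i s IH] f' m' /=.
    by rewrite /st !big_nil mul1r addr0.
  case/andP=> iNs us; rewrite /opcomp iter_tder IH // /st !big_cons -addrA mulrA.
  congr (_ * _ * _); rewrite big_seq [RHS]big_seq; apply: eq_bigr => j js.
  rewrite !mxE; case: (eqVneq j i) => [ji|]; first by rewrite -ji js in iNs.
  by rewrite mulr0 addr0.
have E : st (enum 'I_k) = natvec w.
  apply/matrixP => i j; rewrite ord1 /st big_enum summxE (bigD1 i) //= !mxE !eqxx mulr1.
  by rewrite big1 ?addr0 // => l /negPf li; rewrite !mxE eq_sym li mulr0.
rewrite /tderpow H ?enum_uniq // E; congr (_ * _).
rewrite big_enum; apply: eq_bigr => i _; congr fallfact.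
by rewrite !mxE intrD.
Qed.

Lemma monoE c u (w : {ffun 'I_k -> nat}) :
  mono c u w = homog (u - natvec w) (fun x => c * fall w x).
Proof.
apply/funext => f; apply/funext => m.
rewrite /mono /opcomp /opscal /tmul tderpowE /homog mulrA.
by have -> : m - (u - natvec w) = m - u + natvec w by rewrite opprB addrA addrAC.
Qed.

Lemma mono_finfun c u (w : 'I_k -> nat) : mono (C := C) c u w = mono c u (finfun w).
Proof. by congr mono; apply/funext => i; rewrite ffunE. Qed.

Lemma opsum_cat (s s' : seq (Op C k)) : opsum (s ++ s') = opadd (opsum s) (opsum s').
Proof.
apply/funext => f; apply/funext => m; rewrite /opadd.
elim: s => [|P s IH] /=; first by rewrite add0r.
by rewrite /opadd IH addrA.
Qed.

Lemma LWwith_add cond P Q : LWwith cond P -> LWwith cond Q -> LWwith cond (opadd P Q).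
Proof.
move=> [s [hs ->]] [s' [hs' ->]]; exists (s ++ s'); split.
  by move=> t /List.in_app_iff[/hs|/hs'].
by rewrite map_cat opsum_cat.
Qed.

Lemma LWwith_0 cond : LWwith cond (@opzero C k).
Proof. by exists [::]. Qed.

Lemma LWwith_opsum cond (s : seq (Op C k)) :
  (forall P, List.In P s -> LWwith cond P) -> LWwith cond (opsum s).
Proof.
elim: s => [|P s IH] H /=; first exact: LWwith_0.
by apply: LWwith_add; [apply: H; left | apply: IH => Q hQ; apply: H; right].
Qed.

Lemma LWwith_mono (cond : 'cV[int]_k -> ('I_k -> nat) -> Prop) (c : C) u w :
  cond u w -> LWwith cond (mono c u w).
Proof.
move=> h; exists [:: (c, u, w)]; split=> [t [<-|]|] //=.
by apply/funext => f; apply/funext => m; rewrite /opadd addr0.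
Qed.

Lemma LW_homog u p : polyfun p -> LaurentWeyl (homog u p).
Proof.
case/fall_span => s ->.
have -> : homog u (fun x => \sum_(t <- s) t.1 * fall t.2 x) =
  opsum [seq mono t.1 (u + natvec t.2) t.2 | t : C * {ffun 'I_k -> nat} <- s].
  apply/funext => f; apply/funext => m; rewrite opsumE /homog mulr_suml.
  by apply: eq_bigr => t _; rewrite monoE /homog addrK.
apply: LWwith_opsum => P; rewrite List.in_map_iff => -[t [<- _]].
exact: LWwith_mono.
Qed.

Lemma LaurentWeylP P : LaurentWeyl P <-> exists L, P = opof L.
Proof.
split=> [[s [_ ->]]|[L ->]]; last first.
  apply: LWwith_opsum => P'; rewrite List.in_map_iff => -[t [<- _]].
  exact/LW_homog/pfunP.
have pf c (w : {ffun 'I_k -> nat}) : polyfun (fun x => c * fall w x).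
  exact: polyfun_mul (polyfun_cst _ _) (polyfun_fall _).
exists [seq (t.1.2 - natvec (finfun t.2), PolyFun (pf t.1.1 (finfun t.2))) | t <- s].
rewrite /opof -map_comp; congr opsum; apply: eq_map => t /=.
by rewrite mono_finfun monoE.
Qed.

(** A choice of homogeneous components depending on the operator alone; by [lact_wd] the choice does
    not affect [act]. The list is empty outside the Laurent Weyl algebra. *)
Definition symbol_list P : seq ('cV[int]_k * polynomial_function) :=
  if pselect (exists L, P = opof L) is left h then sval (cid h) else [::].

(* [act P F x] applies the functional t^(x+v) |-> F v to P t^x; it makes sense
   for all complex exponents x, since P acts polynomially in the exponent. *)
Definition act P F x := lact (symbol_list P) F x.

Lemma act_opof L : act (opof L) = lact L.
Proof.
apply/funext => F; apply/funext => x; apply: lact_wd.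
rewrite /symbol_list; case: pselect => [h|[]]; last by exists L.
by case: (cid h).
Qed.

Definition sym P u := act P (fun v => (v == u)%:R).

Lemma polyfun_act P F : polyfun (act P F).
Proof. exact: polyfun_lact. Qed.

Lemma opof_cat L L' : opof (L ++ L') = opadd (opof L) (opof L').
Proof. by rewrite /opof map_cat opsum_cat. Qed.

Lemma act_homog u p F x : polyfun p -> act (homog u p) F x = F u * p x.
Proof.
move=> pp; have -> : homog u p = opof [:: (u, PolyFun pp)].
  by apply/funext => f; apply/funext => m; rewrite opofE big_seq1.
by rewrite act_opof /lact big_seq1.
Qed.

Lemma LW_add P Q : LaurentWeyl P -> LaurentWeyl Q -> LaurentWeyl (opadd P Q).
Proof. exact: LWwith_add. Qed.

Lemma act_add P Q F x : LaurentWeyl P -> LaurentWeyl Q ->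
  act (opadd P Q) F x = act P F x + act Q F x.
Proof.
move=> /LaurentWeylP[L ->] /LaurentWeylP[L' ->].
by rewrite -opof_cat !act_opof /lact big_cat.
Qed.

Lemma opof_comp L L' : exists M, opcomp (opof L) (opof L') = opof M /\
  forall F x, lact M F x =
    lact L' (fun v => lact L (fun u => F (u + v)) (x + zc v)) x.
Proof.
have pf (t t' : 'cV[int]_k * polynomial_function) :
    polyfun (fun x => t.2 (x + zc t'.1) * t'.2 x).
  exact: polyfun_mul (polyfun_shift _ (pfunP _)) (pfunP _).
exists [seq (t.1 + t'.1, PolyFun (pf t t')) | t' <- L', t <- L]; split=> [|F x].
  apply/funext => f; apply/funext => m; rewrite /opcomp !opofE big_allpairs_dep /=.
  under eq_bigr => t do rewrite opofE mulr_sumr.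
  rewrite exchange_big; apply: eq_bigr => t' _; apply: eq_bigr => t _ /=.
  by rewrite mulrA -zcD opprD addrA subrK.
rewrite /lact big_allpairs_dep; apply: eq_bigr => t' _.
by rewrite mulr_suml; apply: eq_bigr => t _ /=; rewrite mulrA.
Qed.

Lemma LW_comp P Q : LaurentWeyl P -> LaurentWeyl Q -> LaurentWeyl (opcomp P Q).
Proof.
move=> /LaurentWeylP[L ->] /LaurentWeylP[L' ->]; apply/LaurentWeylP.
by have [M [-> _]] := opof_comp L L'; exists M.
Qed.

(** Q first moves the exponent x to x + v, and P then acts at that exponent. *)
Lemma act_comp P Q F x : LaurentWeyl P -> LaurentWeyl Q ->
  act (opcomp P Q) F x = act Q (fun v => act P (fun u => F (u + v)) (x + zc v)) x.
Proof.
move=> /LaurentWeylP[L ->] /LaurentWeylP[L' ->].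
by have [M [-> E]] := opof_comp L L'; rewrite !act_opof E.
Qed.

Lemma opid_homog : @opid C k = homog 0 (fun=> 1).
Proof. by apply/funext => f; apply/funext => m; rewrite /homog mul1r subr0. Qed.

Lemma opscal_homog (c : C) : opscal c = homog 0 (fun=> c).
Proof. by apply/funext => f; apply/funext => m; rewrite /homog subr0. Qed.

Lemma LW_scal (c : C) : LaurentWeyl (@opscal C k c).
Proof. by rewrite opscal_homog; apply/LW_homog/polyfun_cst. Qed.

Lemma LW_id : LaurentWeyl (@opid C k).
Proof. by rewrite opid_homog; apply/LW_homog/polyfun_cst. Qed.

Lemma act_id F x : act (@opid C k) F x = F 0.
Proof. by rewrite opid_homog act_homog ?mulr1 //; apply: polyfun_cst. Qed.

Lemma opsubE P Q : opsub P Q = opadd P (opcomp (opscal (-1)) Q).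
Proof.
apply/funext => f; apply/funext => m.
by rewrite /opsub /opadd /opcomp /opscal mulN1r.
Qed.

Lemma LW_sub P Q : LaurentWeyl P -> LaurentWeyl Q -> LaurentWeyl (opsub P Q).
Proof. by move=> lP lQ; rewrite opsubE; apply/LW_add/LW_comp/lQ/LW_scal. Qed.

Lemma lact_scale L (c : C) F x : lact L (fun v => c * F v) x = c * lact L F x.
Proof. by rewrite /lact mulr_sumr; apply: eq_bigr => t _; rewrite mulrA. Qed.

Lemma act_scale P (c : C) F x : act P (fun v => c * F v) x = c * act P F x.
Proof. exact: lact_scale. Qed.

Lemma act_F0 P x : act P (fun=> 0) x = 0.
Proof. by rewrite /act /lact big1 // => t _; rewrite mul0r. Qed.

Lemma act_scal (c : C) P F x : LaurentWeyl P ->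
  act (opcomp (opscal c) P) F x = c * act P F x.
Proof.
move=> lP; rewrite act_comp //; last exact: LW_scal.
rewrite -act_scale; congr act; apply/funext => v.
by rewrite opscal_homog act_homog ?add0r 1?mulrC //; apply: polyfun_cst.
Qed.

Lemma act_sub P Q F x : LaurentWeyl P -> LaurentWeyl Q ->
  act (opsub P Q) F x = act P F x - act Q F x.
Proof.
move=> lP lQ; rewrite opsubE act_add ?act_scal ?mulN1r //.
exact/LW_comp/lQ/LW_scal.
Qed.

Lemma act0 F x : act (@opzero C k) F x = 0.
Proof.
by rewrite -[@opzero C k]/(opof [::]) act_opof /lact big_nil.
Qed.

Lemma act_opsum (I : Type) (s : seq I) (G : I -> Op C k) F x :
  (forall i, List.In i s -> LaurentWeyl (G i)) ->
  act (opsum [seq G i | i <- s]) F x = \sum_(i <- s) act (G i) F x.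
Proof.
elim: s => [|i s IH] H; first by rewrite big_nil act0.
rewrite big_cons /= act_add; first last.
- apply: LWwith_opsum => P; rewrite List.in_map_iff => -[j [<- hj]].
  by apply: H; right.
- by apply: H; left.
by rewrite IH // => j hj; apply: H; right.
Qed.

Lemma LW_support P : LaurentWeyl P -> exists S : seq 'cV[int]_k,
  [/\ uniq S, forall u x, u \notin S -> sym P u x = 0,
      P = opsum [seq homog u (sym P u) | u <- S]
    & forall F x, act P F x = \sum_(u <- S) F u * sym P u x].
Proof.
move=> /LaurentWeylP[L ->]; have [S [US HS]] := lact_support L.
have hact F x : act (opof L) F x = \sum_(u <- S) F u * sym (opof L) u x.
  by rewrite /sym act_opof; apply: lact_group.
exists S; split=> //.
  move=> u x uS; rewrite /sym hact big_seq big1 // => v vS.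
  by case: eqP vS uS => [->->|]//; rewrite mul0r.
apply/funext => f; apply/funext => m; rewrite opofE opsumE /homog.
transitivity (\sum_(t <- L) \sum_(u <- S) (t.1 == u)%:R * t.2 (zc (m - u)) * f (m - u)).
  elim: {hact} L HS => [|t L IH] HS; first by rewrite !big_nil.
  rewrite !big_cons IH; last by move=> ? ?; apply: HS; right.
  congr (_ + _); have tS : t.1 \in S by apply: HS; left.
  rewrite (big_rem _ tS) /= eqxx mul1r big_seq big1 ?addr0 // => u.
  rewrite mem_rem_uniq // inE => /andP[/negPf ut _].
  by rewrite eq_sym ut !mul0r.
rewrite exchange_big; apply: eq_bigr => u _.
by rewrite -mulr_suml /sym act_opof.
Qed.

Lemma LW_supp_apply P : LaurentWeyl P -> exists S : seq 'cV[int]_k, forall f m,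
  P f m = \sum_(u <- S) sym P u (zc (m - u)) * f (m - u).
Proof.
move=> /LW_support[S [_ _ E _]]; exists S => f m.
by rewrite {1}E opsumE.
Qed.

Lemma act_delta P m m' : LaurentWeyl P -> P (delta m) m' = sym P (m' - m) (zc m).
Proof. by move=> /LaurentWeylP[L ->]; rewrite opof_delta /sym act_opof. Qed.

Lemma LW_eq P Q : LaurentWeyl P -> LaurentWeyl Q ->
  (forall u x, sym P u x = sym Q u x) -> P = Q.
Proof.
move=> lP lQ E; have [S [US nS EP aP]] := LW_support lP.
have [S' [US' nS' EQ aQ]] := LW_support lQ.
rewrite EP EQ; apply/funext => f; apply/funext => m; rewrite !opsumE.
have key (p : 'cV[int]_k -> C) (T T' : seq 'cV[int]_k) : uniq T -> uniq T' ->
    (forall u, u \notin T -> p u = 0) -> (forall u, u \notin T' -> p u = 0) ->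
    \sum_(u <- T) p u = \sum_(u <- T') p u.
  move=> UT UT' h h'.
  rewrite (bigID (fun u => p u == 0)) [RHS](bigID (fun u => p u == 0)) /=.
  rewrite big1 ?[X in _ = X + _]big1; try by move=> u /eqP.
  congr (_ + _); rewrite -big_filter -[RHS]big_filter; apply: perm_big.
  apply: uniq_perm; rewrite ?filter_uniq // => u; rewrite !mem_filter.
  case: eqP => //= pu; have -> : u \in T by apply/negPn/negP => /h.
  by apply/esym/negPn/negP => /h'.
rewrite (key (fun u => homog u (sym P u) f m) S S') //.
- by apply: eq_bigr => u _; rewrite /homog E.
- by move=> u /nS h; rewrite /homog h mul0r.
- by move=> u /nS' h; rewrite /homog E h mul0r.
Qed.

Definition linop P := forall (a : C) f g,
  P (fun m => a * f m + g m) = fun m => a * P f m + P g m.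

Lemma LW_lin P : LaurentWeyl P -> linop P.
Proof.
move=> /LaurentWeylP[L ->] a f g; apply/funext => m; rewrite !opofE.
by rewrite mulr_sumr -big_split /=; apply: eq_bigr => t _; ring.
Qed.

End Symbols.

(** * Faces, E_tau and Zariski closures *)

Section Farkas.
Variable d : nat.
Implicit Types (v b : 'cV[int]_d) (l : 'rV[int]_d).

Fixpoint natcone (vs : seq 'cV[int]_d) b : Prop :=
  if vs is v :: vs' then exists c : nat, natcone vs' (b - c%:Z *: v) else b = 0.

Definition pair l v : int := (l *m v) 0 0.

Lemma pairDr l v b : pair l (v + b) = pair l v + pair l b.
Proof. by rewrite /pair mulmxDr mxE. Qed.
Lemma pairZr l (a : int) v : pair l (a *: v) = a * pair l v.
Proof. by rewrite /pair -scalemxAr mxE. Qed.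
Lemma pairNr l v : pair l (- v) = - pair l v.
Proof. by rewrite /pair mulmxN mxE. Qed.
Lemma pairDl l l' v : pair (l + l') v = pair l v + pair l' v.
Proof. by rewrite /pair mulmxDl mxE. Qed.
Lemma pairZl l (a : int) v : pair (a *: l) v = a * pair l v.
Proof. by rewrite /pair -scalemxAl mxE. Qed.

(** Each vector a w + l(w) v has l(w) nonnegative, so undoing the projection costs only a natural
    multiple of v. *)
Lemma natcone_shear (a : nat) v l vs x :
  (forall w, w \in vs -> 0 <= pair l w) ->
  natcone [seq a%:Z *: w + pair l w *: v | w <- vs] x ->
  exists t : nat, natcone vs (x - t%:Z *: v).
Proof.
elim: vs x => [|w vs IH] x /= H.
  by move=> ->; exists 0%N; rewrite scale0r subr0.
case=> c /IH[|t ht]; first by move=> w' h; apply: H; rewrite inE h orbT.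
have := H w (mem_head _ _); case E : (pair l w) => [e|//] _.
exists (c * e + t)%N, (c * a)%N; move: ht; rewrite E.
rewrite !PoszD !PoszM scalerDr !scalerA scalerDl.
have -> // : x - ((c%:Z * a%:Z) *: w + (c%:Z * e%:Z) *: v) - t%:Z *: v =
  x - ((c%:Z * e%:Z) *: v + t%:Z *: v) - (c%:Z * a%:Z) *: w.
by rewrite !opprD !addrA; apply/matrixP => i j; rewrite !mxE; ring.
Qed.

(** Induction on the number of generators, with the scaling by [N] replacing division. If a
    functional l separating b from the other generators is negative on v, all vectors are projected
    along v into the kernel of l by x -> a x + l(x) v with a = -l(v), and the answer to the
    projected problem is pulled back. *)
Lemma farkas vs b :
  (exists N : nat, (0 < N)%N /\ natcone vs (N%:Z *: b)) \/
  (exists l, (forall v, v \in vs -> 0 <= pair l v) /\ pair l b < 0).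
Proof.
elim: {vs}(size vs) {-2}vs (erefl (size vs)) b => [|n IH] [|v vs] //= => [_|[szvs]] b.
  have [->|b0] := eqVneq b 0; first by left; exists 1%N; rewrite scaler0.
  right; have [i bi] : exists i, b i 0 != 0.
    apply: contrapT => H; move/eqP: b0; apply; apply/matrixP => i j; rewrite ord1 mxE.
    by apply: contrapT => /eqP ?; apply: H; exists i.
  exists (- b i 0 *: delta_mx 0 i); split=> //.
  rewrite pairZl /pair -rowE mxE mulNr oppr_lt0 -expr2 lt_neqAle sqr_ge0 andbT.
  by rewrite eq_sym expf_neq0.
case: (IH vs szvs b) => [[N [N0 h]]|[l [lvs lb]]].
  by left; exists N; split=> //; exists 0%N; rewrite scale0r subr0.
have [lv|lv] := leP 0 (pair l v).
  by right; exists l; split=> // w; rewrite inE => /orP[/eqP ->|/lvs].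
have [a [a0 Ea]] : exists a : nat, (0 < a)%N /\ pair l v = - a%:Z.
  by exists `|pair l v|%N; split; lia.
have [e Ee] : exists e : nat, pair l b = - e%:Z by exists `|pair l b|%N; lia.
set vs' := [seq a%:Z *: w + pair l w *: v | w <- vs].
have sz' : size vs' = n by rewrite size_map.
case: (IH vs' sz' (a%:Z *: b + pair l b *: v)) => [[N [N0 h]]|[l' [l'vs l'b]]].
  left; exists (N * a)%N; split; first by rewrite muln_gt0 N0.
  have [t ht] := natcone_shear lvs h; exists (N * e + t)%N; move: ht.
  rewrite Ee; set x := _ - _; set y := _ - _; suff -> : x = y by [].
  by apply/matrixP => i j; rewrite !mxE !PoszD !PoszM; ring.
(* The pullback of l' along the projection; it vanishes on v. *)
right; exists (a%:Z *: l' + pair l' v *: l).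
have E w : pair (a%:Z *: l' + pair l' v *: l) w = pair l' (a%:Z *: w + pair l w *: v).
  by rewrite pairDl pairDr !pairZl !pairZr; ring.
split=> [w|]; last by rewrite E.
rewrite inE => /orP[/eqP ->|wvs]; rewrite E.
  by rewrite Ea pairDr !pairZr mulNr subrr.
by apply: l'vs; apply: map_f.
Qed.

Lemma natcone_cat vs1 vs2 b : natcone (vs1 ++ vs2) b ->
  exists b', natcone vs1 b' /\ natcone vs2 (b - b').
Proof.
elim: vs1 b => [|v vs IH] b /=; first by exists 0; rewrite subr0.
case=> c /IH[b' [h1 h2]]; exists (b' + c%:Z *: v); split.
  by exists c; rewrite addrK.
by move: h2; rewrite opprD addrA addrAC.
Qed.

Lemma natcone_map n (s : seq 'I_n) (g : 'I_n -> 'cV[int]_d) b :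
  natcone (map g s) b -> exists c : 'I_n -> nat,
    (forall j, j \notin s -> c j = 0%N) /\ b = \sum_j (c j)%:Z *: g j.
Proof.
elim: s b => [|i s IH] b /=.
  by move=> ->; exists (fun=> 0%N); split=> //; rewrite big1 // => j _; rewrite scale0r.
case=> a /IH[c [c0 E]]; exists (fun j => (c j + (j == i) * a)%N); split.
  by move=> j; rewrite inE negb_or => /andP[/negPf -> /c0 ->].
under eq_bigr do rewrite PoszD scalerDl.
rewrite big_split /= -E (bigD1 i) //= eqxx mul1n big1 ?addr0 ?subrK // => j /negPf ->.
by rewrite mul0n scale0r.
Qed.

(* [l] cuts out the smallest face containing the columns in [F]: by Farkas, a
   column on that face has its negative in NA - N(columns in F). *)
Lemma smallest_face n (A : 'M[int]_(d, n)) (F : {set 'I_n}) : exists l,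
  [/\ forall k, 0 <= pair l (col k A), forall k, k \in F -> pair l (col k A) = 0
    & forall k, pair l (col k A) = 0 -> exists c e : 'I_n -> nat,
       (forall j, j \notin F -> e j = 0%N) /\
       col k A + \sum_j (c j)%:Z *: col j A = \sum_j (e j)%:Z *: col j A].
Proof.
have /choice[L HL] : forall k, exists l,
  [/\ forall j, 0 <= pair l (col j A), forall j, j \in F -> pair l (col j A) = 0
    & pair l (col k A) = 0 -> exists c e : 'I_n -> nat,
       (forall j, j \notin F -> e j = 0%N) /\
       col k A + \sum_j (c j)%:Z *: col j A = \sum_j (e j)%:Z *: col j A].
  (* Farkas for -a_k against A and -F: a solution is the required relation, while a separating
     functional vanishes on F and is positive on a_k. *)
  move=> k; case: (farkas ([seq col j A | j <- enum 'I_n] ++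
    [seq - col j A | j <- enum F]) (- col k A)) => [[N [N0]]|[l [lv lb]]].
    move=> /natcone_cat[b [/natcone_map[c [_ Ec]] /natcone_map[e [e0 Ee]]]].
    exists 0; split; try by move=> *; rewrite /pair mul0mx mxE.
    move=> _; exists (fun j => (c j + (j == k) * N.-1)%N), e; split.
      by move=> j; rewrite -mem_enum; apply: e0.
    have -> : \sum_j (e j)%:Z *: col j A = - (N%:Z *: - col k A - b).
      by rewrite Ee -sumrN; apply: eq_bigr => j _; rewrite scalerN opprK.
    under eq_bigr do rewrite PoszD scalerDl.
    rewrite big_split /= -Ec (bigD1 k) //= eqxx mul1n big1 ?addr0; last first.
      by move=> j /negPf ->; rewrite mul0n scale0r.
    case: N N0 {Ee} => // N _; rewrite -(add1n N) PoszD /=.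
    by apply/matrixP => i j; rewrite !mxE; ring.
  have lpos j : 0 <= pair l (col j A).
    apply: lv; rewrite mem_cat; apply/orP; left.
    by apply: (map_f (fun j => col j A)); rewrite mem_enum.
  exists l; split=> //.
    move=> j jF; apply/eqP; rewrite eq_le lpos andbT -oppr_ge0 -pairNr.
    apply: lv; rewrite mem_cat; apply/orP; right.
    by apply: (map_f (fun j => - col j A)); rewrite mem_enum.
  by move=> l0; move: lb; rewrite pairNr l0 ltxx.
have sumE v : pair (\sum_k L k) v = \sum_k pair (L k) v.
  by rewrite /pair mulmx_suml summxE.
(* A sum of nonnegative terms vanishes only if each term does, so the sum inherits the property of
   every [L k]. *)
exists (\sum_k L k); split=> [k|k kF|k].
- by rewrite sumE sumr_ge0 // => j _; case: (HL j).
- by rewrite sumE big1 // => j _; case: (HL j) => _ /(_ k kF).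
- rewrite sumE => /psumr_eq0P H; case: (HL k) => _ _; apply; apply: H => // j _.
  by case: (HL j).
Qed.

End Farkas.

(* The condition for t^u p(s) to be in D(R_A). *)
Definition opideal (C : numFieldType) d n (A : 'M[int]_(d, n)) (u : 'cV[int]_d)
    (p : 'cV[C]_d -> C) :=
  polyfun p /\ forall m, inNA A m -> ~ inNA A (m + u) -> p (zc C m) = 0.

(** * Non-vanishing symbols and the sets E_tau *)

Section ZariskiClosure.
Variables (R : realType) (d n : nat) (A : 'M[int]_(d, n)).
Local Notation C := (complex R).
Implicit Types (al lam : 'cV[C]_d) (u m : 'cV[int]_d).

Definition comb (c : 'I_n -> C) : 'cV[C]_d := \sum_j c j *: colC R A j.

Lemma combD c c' : comb (fun j => c j + c' j) = comb c + comb c'.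
Proof. by rewrite /comb -big_split; apply: eq_bigr => j _; rewrite scalerDl. Qed.

Lemma combB c c' : comb (fun j => c j - c' j) = comb c - comb c'.
Proof. by rewrite /comb -sumrB; apply: eq_bigr => j _; rewrite scalerBl. Qed.

Lemma zc_sum (F : 'I_n -> 'cV[int]_d) : zc C (\sum_j F j) = \sum_j zc C (F j).
Proof. by apply: (big_morph _ (@zcD C d) (@zc0 C d)). Qed.

Lemma comb_int (z : 'I_n -> int) :
  comb (fun j => (z j)%:~R) = zc C (\sum_j z j *: col j A).
Proof.
rewrite zc_sum; apply: eq_bigr => j _.
by apply/matrixP => a b; rewrite !mxE intrM.
Qed.

Lemma comb_nat (c : 'I_n -> nat) :
  comb (fun j => (c j)%:R) = zc C (\sum_j (c j)%:Z *: col j A).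
Proof. exact: (comb_int (fun j => (c j)%:Z)). Qed.

(** The inclusion of E_tau(al) in E_tau(be) for all faces; each of the two polynomials p and q
    accounts for one inclusion. *)
Definition Ele al be := forall tau, isFace A tau ->
  forall lam, inCspan A tau lam -> Defs.inE A tau al lam -> Defs.inE A tau be lam.

Lemma simA_Ele al be : simA A al be <-> Ele al be /\ Ele be al.
Proof.
split=> [H|[H1 H2] tau ft lam hl]; last by split; [apply: H1|apply: H2].
by split=> tau /H h lam /h[].
Qed.

(** A class of E_tau(al) missing from E_tau(al + u) yields a translate x0 + N(A cap tau) inside NA
    whose shift by u avoids NA. Then p vanishes on it, hence by density on x0 + C(A cap tau), which
    contains al. *)
Lemma nonvanishing_Ele al u p : opideal A u p -> p al != 0 -> Ele al (al + zc C u).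
Proof.
move=> [pp p0] pal tau ft lam hlam [lam' [hC [hZ [c [z [z0 Ecz]]]]]].
exists lam'; do 2!split=> //; apply: contrapT => nNAZ; move/eqP: pal; apply.
have [g [g0 Eg]] := hC.
pose v j : 'cV[C]_d := if pselect (tau (colR R A j)) then colC R A j else 0.
(* Adding |z_j| makes the coefficients of [x0] natural; the excess is taken back inside C(A cap
   tau). *)
pose e j := `|z j|%N.
pose x0 := comb (fun j => ((c j)%:Z + (z j + (e j)%:Z))%:~R).
have combv (b : 'I_n -> C) : (forall j, ~ tau (colR R A j) -> b j = 0) ->
    \sum_j b j *: v j = comb b.
  move=> b0; apply: eq_bigr => j _; rewrite /v; case: pselect => // h.
  by rewrite b0 // scaler0 scale0r.
have -> : al = x0 + \sum_j (g j - (e j)%:Z%:~R) *: v j.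
  rewrite combv; last by move=> j h; rewrite /e g0 // z0 // subr0.
  rewrite -combD -[LHS](subrK lam') Ecz Eg -combD.
  apply: eq_bigr => j _; congr (_ *: _); rewrite -[(c j)%:R]/((c j)%:Z%:~R).
  by rewrite !intrD; ring.
apply: polyfun_vanish => // q.
pose q' j : nat := if pselect (tau (colR R A j)) then q j else 0.
have -> : \sum_j (q j)%:R *: v j = comb (fun j => (q' j)%:R).
  apply: eq_bigr => j _; rewrite /v /q'; case: pselect => // h.
  by rewrite scaler0 scale0r.
pose b j := (c j + absz (z j + (e j)%:Z)%R + q' j)%N.
have -> : x0 + comb (fun j => (q' j)%:R) = zc C (\sum_j (b j)%:Z *: col j A).
  rewrite -comb_nat -combD; apply: eq_bigr => j _; congr (_ *: _).
  rewrite -[(q' j)%:R]/((q' j)%:Z%:~R) -[(b j)%:R]/((b j)%:Z%:~R) -intrD; congr (_%:~R).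
  by rewrite /b /e; lia.
apply: p0; first by exists b.
case=> b' Eb'; apply: nNAZ; exists b', (fun j => - ((e j)%:Z + (q' j)%:Z)).
split=> [j h|]; first by rewrite /e z0 // /q'; case: pselect.
have E1 : comb (fun j => (b' j)%:R) = comb (fun j => (b j)%:R) + zc C u.
  by rewrite !comb_nat -Eb' zcD.
rewrite addrAC Ecz -/(comb _) -/(comb _) [RHS]combD E1 addrAC -combD; congr (_ + _).
apply: eq_bigr => j _; congr (_ *: _).
rewrite -[(b j)%:R]/((b j)%:Z%:~R) -[(c j)%:R]/((c j)%:Z%:~R) -!intrD; congr (_%:~R).
by rewrite /b /e; lia.
Qed.

(** If y is not in the span, some column of the cokernel matrix is a linear form that vanishes on
    the span and not at y. *)
Lemma span_or_separated (F : {set 'I_n}) (y : 'cV[C]_d) :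
  (exists c, (forall j, j \notin F -> c j = 0) /\ y = comb c) \/
  (exists p, [/\ polyfun p, p y != 0
    & forall c, (forall j, j \notin F -> c j = 0) -> p (comb c) = 0]).
Proof.
pose M : 'M[C]_(n, d) := \matrix_(j, i) (if j \in F then (A i j)%:~R else 0).
have combE c : (forall j, j \notin F -> c j = 0) -> comb c = (\row_j c j *m M)^T.
  move=> c0; apply/matrixP => i k; rewrite ord1 !mxE summxE; apply: eq_bigr => j _.
  by rewrite !mxE; case: ifP => // /negbT/c0 ->; rewrite !mul0r.
have [/submxP[D ED]|nsub] := boolP (y^T <= M)%MS.
  left; exists (fun j => if j \in F then D 0 j else 0); split=> [j /negPf -> //|].
  rewrite combE; last by move=> j /negPf ->.
  rewrite -[y]trmxK ED; congr trmx; apply/matrixP => i k; rewrite !mxE.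
  by apply: eq_bigr => j _; rewrite !mxE ord1; case: ifP => //; rewrite !mulr0.
right; pose N := cokermx M.
have [k yk] : exists k, (y^T *m N) 0 k != 0.
  apply: contrapT => H; move: nsub; rewrite submxE => /eqP; apply.
  apply/matrixP => i k; rewrite ord1 [RHS]mxE; apply: contrapT => /eqP ?.
  by apply: H; exists k.
exists (fun x => (x^T *m N) 0 k); split=> [||c c0]; last 1 first.
- by rewrite combE // trmxK -mulmxA mulmx_coker mulmx0 mxE.
- rewrite (_ : (fun x => _) = fun x : 'cV[C]_d => \sum_i x i 0 * N i k).
    apply: polyfun_sum => i; exact: polyfun_mul (polyfun_coord _) (polyfun_cst _ _).
  by apply/funext => x; rewrite mxE; apply: eq_bigr => i _; rewrite mxE.
- exact: yk.
Qed.

Definition natcomb (x : 'I_n -> nat) : 'cV[int]_d := \sum_j (x j)%:Z *: col j A.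

Lemma natcombD x y : natcomb (fun j => (x j + y j)%N) = natcomb x + natcomb y.
Proof.
by rewrite /natcomb -big_split; apply: eq_bigr => j _; rewrite PoszD scalerDl.
Qed.

Lemma pair_colR l j : ((map_mx (fun z : int => z%:~R) l : 'rV[R]_d) *m colR R A j) 0 0
  = (pair l (col j A))%:~R.
Proof.
rewrite /pair !mxE rmorph_sum; apply: eq_bigr => i _.
by rewrite !mxE rmorphM.
Qed.

(* A full translated orthant w + N^F avoiding NA - u contributes the affine
   space Aw + C(A cap tau) to the Zariski closure, tau being the smallest face
   containing F; the E_tau condition says that it does not contain al. *)
Lemma orthant_avoids_span al u (F : {set 'I_n}) (w : 'I_n -> nat) :
  Ele al (al + zc C u) ->
  (forall x : 'I_n -> nat, (forall j, j \notin F -> x j = 0%N) ->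
     ~ inNA A (natcomb (fun j => (w j + x j)%N) + u)) ->
  forall c, (forall j, j \notin F -> c j = 0) -> al <> zc C (natcomb w) + comb c.
Proof.
move=> HE Hx c c0 Eal.
have [l [l_ge0 lF lface]] := smallest_face A F.
pose lR : 'rV[R]_d := map_mx (fun z : int => z%:~R) l.
pose tau (x : 'cV[R]_d) := inCone A x /\ (lR *m x) 0 0 = 0.
have ftau : isFace A tau.
  exists lR; split=> // x [r [r0 ->]]; rewrite mulmx_sumr summxE sumr_ge0 // => j _.
  by rewrite -scalemxAr mxE pair_colR mulr_ge0 // ler0z.
have tauP j : tau (colR R A j) <-> pair l (col j A) = 0.
  split=> [[_]|l0].
    by rewrite pair_colR => /eqP; rewrite intr_eq0 => /eqP.
  split; last by rewrite pair_colR l0.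
  exists (fun i => (i == j)%:R); split=> [i|]; first exact: ler0n.
  by rewrite (bigD1 j) //= eqxx scale1r big1 ?addr0 // => i /negPf ->; rewrite scale0r.
have cspan : inCspan A tau (comb c).
  exists c; split=> // j ntau; apply: c0; apply/negP => jF; apply: ntau.
  exact/tauP/lF.
(* The class of [comb c] lies in E_tau(al) because of w; its membership in E_tau(al + u) is what
   produces a point of the orthant in NA - u. *)
have [] := HE tau ftau (comb c) cspan.
  exists (comb c); do 2!split=> //.
    exists (fun=> 0); split=> //; rewrite subrr big1 // => j _.
    by rewrite scale0r.
  exists w, (fun=> 0); split=> //; rewrite Eal addrK -comb_nat.
  by apply: eq_bigr => j _; rewrite addr0.
move=> lam' [_ [[z' [z'0 Ez']] [a [z [z0 Ez]]]]].
(* By the choice of the smallest face, an integral multiple of a face column becomes a natural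
   combination after adding some [e] supported on F. Off the face the multiple is zero. *)
have /choice[e He] : forall k, exists e : 'I_n -> nat, (forall j, j \notin F -> e j = 0%N) /\
    exists c' : 'I_n -> nat, (z k + z' k) *: col k A + natcomb e = natcomb c'.
  move=> k; have [tk|ntk] := pselect (tau (colR R A k)); last first.
    exists (fun=> 0%N); split=> //; exists (fun=> 0%N).
    by rewrite z0 // z'0 // addr0 scale0r add0r.
  have [c1 [e1 [e10 E1]]] := lface k (iffLR (tauP k) tk).
  pose N := absz (z k + z' k)%R.
  exists (fun j => N * e1 j)%N; split=> [j /e10 ->|]; first by rewrite muln0.
  exists (fun j => N * c1 j + (j == k) * absz (z k + z' k + N%:Z)%R)%N.
  rewrite natcombD.
  have scl (y : 'I_n -> nat) : natcomb (fun j => N * y j)%N = N%:Z *: natcomb y.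
    by rewrite /natcomb scaler_sumr; apply: eq_bigr => j _; rewrite scalerA.
  have dl (b : nat) : natcomb (fun j => (j == k) * b)%N = b%:Z *: col k A.
    rewrite /natcomb (bigD1 k) //= eqxx mul1n big1 ?addr0 // => j /negPf ->.
    by rewrite scale0r.
  rewrite !scl dl /natcomb -E1 scalerDr addrA -scalerDl addrC; congr (_ + _ *: _).
  by rewrite /N; lia.
have [e0 /choice[c' Hc']] : (forall k j, j \notin F -> e k j = 0%N) /\
    forall k, exists c' : 'I_n -> nat, (z k + z' k) *: col k A + natcomb (e k) = natcomb c'.
  by split=> k; case: (He k).
apply: (Hx (fun j => \sum_k e k j)%N).
  by move=> j jF; rewrite big1 // => k _; apply: e0.
exists (fun j => (a j + \sum_k c' k j)%N).
have swap (f : 'I_n -> 'I_n -> nat) : natcomb (fun j => \sum_k f k j)%N = \sum_k natcomb (f k).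
  rewrite /natcomb exchange_big; apply: eq_bigr => j _.
  by rewrite -scaler_suml; congr (_ *: _); apply: (big_morph Posz PoszD).
rewrite -[RHS]/(natcomb _) !natcombD !swap -(eq_bigr _ (fun k _ => Hc' k)).
rewrite big_split /= [RHS]addrA [LHS]addrAC; congr (_ + _); apply: (@zc_inj C).
rewrite !zcD -(comb_int (fun j => z j + z' j)) -(comb_nat a) -combD.
have -> : zc C (natcomb w) + zc C u = (al + zc C u - lam') + (lam' - comb c).
  by rewrite addrA subrK Eal addrAC addrK.
rewrite Ez Ez' -/(comb _) -/(comb _) -combD; apply: eq_bigr => j _.
by rewrite intrD addrA.
Qed.

(** Induction on the size of F, for the orthant w + N^F. If the shift of one point x0 by u lies in
    NA, so do the shifts of all points above x0, and the rest lies in finitely many slices x_i = c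
    with c < x0_i: p is the product over these smaller orthants. If no shift lies in NA, the closure
    of the orthant misses al, and an affine form vanishing on it suffices. *)
Lemma Ele_nonvanishing al u : Ele al (al + zc C u) ->
  exists p, opideal A u p /\ p al != 0.
Proof.
move=> HE.
suff H N (F : {set 'I_n}) (w : 'I_n -> nat) : (#|F| < N)%N -> exists p,
    [/\ polyfun p, p al != 0 & forall x : 'I_n -> nat, (forall j, j \notin F -> x j = w j) ->
      ~ inNA A (natcomb x + u) -> p (zc C (natcomb x)) = 0].
  have [p [pp p1 p0]] := H #|[set: 'I_n]|.+1 setT (fun=> 0%N) (ltnSn _).
  exists p; do 2!split=> //; move=> m [x ->] nx; apply: p0 => // j.
  by rewrite inE.
elim: N F w => // N IH F w; rewrite ltnS => FN.
pose D (x : 'I_n -> nat) := inNA A (natcomb x + u).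
have [[x0 [x0F Dx0]]|nD] := pselect (exists x0 : 'I_n -> nat,
    (forall j, j \notin F -> x0 j = w j) /\ D x0).
  have /choice[p Hp] : forall ic : 'I_n * nat, exists p, [/\ polyfun p, p al != 0
    & ic.1 \in F -> forall x : 'I_n -> nat, (forall j, j \notin F -> x j = w j) ->
      x ic.1 = ic.2 -> ~ D x -> p (zc C (natcomb x)) = 0].
    move=> [i c] /=; have [iF|] := boolP (i \in F); last first.
      by exists (fun=> 1); split=> //; [apply: polyfun_cst|apply: oner_neq0].
    have [|p [pp p1 p0]] := IH (F :\ i) (fun j => if j == i then c else w j).
      by apply: leq_trans FN; rewrite [X in (_ < X)%N](cardsD1 i) iF.
    exists p; split=> // _ x xF xi nDx; apply: p0 => // j.
    by rewrite !inE negb_and negbK => /orP[/eqP ->|jF]; [rewrite eqxx|case: eqP => [->|_]; auto].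
  exists (fun y => \prod_(i in F) \prod_(c < x0 i) p (i, val c) y); split.
  - by apply: polyfun_prod => i; apply: polyfun_prod => c; case: (Hp (i, val c)).
  - apply/prodf_neq0 => i iF; apply/prodf_neq0 => c _.
    by case: (Hp (i, val c)).
  - move=> x xF nDx.
    have [i [iF xi]] : exists i, i \in F /\ (x i < x0 i)%N.
      apply: contrapT => H; apply: nDx.
      have le j : (x0 j <= x j)%N.
        have [jF|jF] := boolP (j \in F); last by rewrite xF // x0F.
        by rewrite leqNgt; apply/negP => lt; apply: H; exists j.
      have [y Ey] := Dx0; exists (fun j => (y j + (x j - x0 j))%N).
      rewrite -[RHS]/(natcomb _) natcombD -[natcomb y]Ey addrAC -natcombD.
      by congr (natcomb _ + _); apply/funext => j; rewrite subnKC.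
    rewrite (bigD1 i) //= (bigD1 (Ordinal xi)) //=.
    by case: (Hp (i, x i)) => _ _ /(_ iF x xF erefl nDx) ->; rewrite !mul0r.
(* The coordinates in F are free, so the orthant may be based at 0 in these directions. *)
pose w' j := if j \in F then 0%N else w j.
have [[c [c0 Ec]]|[p [pp p1 p0]]] := span_or_separated F (al - zc C (natcomb w')).
  have Hx (x : 'I_n -> nat) : (forall j, j \notin F -> x j = 0%N) ->
      ~ inNA A (natcomb (fun j => (w' j + x j)%N) + u).
    move=> x0; apply: contra_not nD => Dx; exists (fun j => (w' j + x j)%N).
    by split=> // j jF; rewrite /w' (negPf jF) x0 // addn0.
  by case: (orthant_avoids_span HE Hx c0); rewrite -Ec addrC subrK.
exists (fun y => p (y - zc C (natcomb w'))); split=> //.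
  exact: polyfun_shift.
move=> x xF _; pose y j := if j \in F then x j else 0%N.
have -> : natcomb x = natcomb y + natcomb w'.
  rewrite -natcombD; congr natcomb; apply/funext => j; rewrite /y /w'.
  by case: ifP => [_|/negbT/xF ->]; rewrite ?addn0.
rewrite zcD addrK -comb_nat; apply: p0 => j jF.
by rewrite /y (negPf jF).
Qed.

Lemma simA_connected (A_gen : forall m : 'cV[int]_d, exists c : 'cV[int]_n, m = A *m c) al be :
  simA A al be <-> exists u p q, [/\ al = be + zc C u,
    opideal A u p /\ opideal A (- u) q & p be != 0 /\ q al != 0].
Proof.
rewrite simA_Ele; split=> [[H1 H2]|[u [p [q [E [hp hq] [p0 q0]]]]]]; last first.
  split; last by rewrite E; apply: nonvanishing_Ele hp p0.
  have E' : be = al + zc C (- u) by rewrite E zcN addrK.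
  by rewrite [X in Ele _ X]E'; apply: nonvanishing_Ele hq q0.
suff [u Eu] : exists u, al = be + zc C u.
  have [p [hp p0]] : exists p, opideal A u p /\ p be != 0.
    by apply: Ele_nonvanishing; rewrite -Eu.
  have [q [hq q0]] : exists q, opideal A (- u) q /\ q al != 0.
    by apply: Ele_nonvanishing; rewrite zcN [X in Ele _ (X - _)]Eu addrK.
  by exists u, p, q.
(* The zero functional exhibits the whole cone as a face. There the complex span is C^d, and
   transporting the class of be itself shows that al - be is integral. *)
pose cone := inCone (R := R) A.
have fcone : isFace A cone.
  exists (0 : 'rV[R]_d); split=> x; first by rewrite mul0mx mxE.
  by split=> [h|[]]; rewrite ?mul0mx ?mxE.
have all_span (x : 'cV[C]_d) : exists c, x = comb c.
  have /choice[c Hc] : forall i : 'I_d, exists c : 'I_n -> int, zc C (delta_mx i 0) = comb (fun j => (c j)%:~R).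
    move=> i; have [c Ec] := A_gen (delta_mx i 0); exists (fun j => c j 0).
    rewrite comb_int Ec; congr zc; apply/matrixP => a b; rewrite ord1 !mxE summxE.
    by apply: eq_bigr => j _; rewrite !mxE mulrC.
  exists (fun j => \sum_i x i 0 * (c i j)%:~R).
  transitivity (\sum_i x i 0 *: zc C (delta_mx i 0)).
    apply/matrixP => a b; rewrite ord1 summxE (bigD1 a) //= !mxE !eqxx mulr1.
    by rewrite big1 ?addr0 // => i /negPf ia; rewrite !mxE eq_sym ia mulr0.
  under eq_bigr do rewrite Hc /comb scaler_sumr.
  rewrite exchange_big; apply: eq_bigr => j _; rewrite scaler_suml.
  by apply: eq_bigr => i _; rewrite scalerA.
have cspan x : inCspan A cone x.
  have [c Ec] := all_span x; exists c; split=> // j []; exists (fun i => (i == j)%:R).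
  split=> [i|]; first exact: ler0n.
  by rewrite (bigD1 j) //= eqxx scale1r big1 ?addr0 // => i /negPf ->; rewrite scale0r.
have [|lam [_ [[z [_ Ez]] [c [z' [_ Ec]]]]]] := H2 _ fcone be (cspan be).
  exists be; do 2!split=> //; first by exists (fun=> 0); split=> //; rewrite subrr big1 // => j _; rewrite scale0r.
  exists (fun=> 0%N), (fun=> 0); split=> //; rewrite subrr big1 // => j _.
  by rewrite addr0 scale0r.
exists (\sum_j ((c j)%:Z + z' j + z j) *: col j A).
have E : al = (al - lam) + (lam - be) + be by rewrite addrA subrK subrK.
rewrite -comb_int [LHS]E Ec Ez [RHS]addrC.
congr (_ + _); rewrite -/(comb _) -/(comb _) -combD; apply: eq_bigr => j _.
by rewrite !intrD.
Qed.

End ZariskiClosure.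

(** * Ideals and cyclic modules *)

(* Left and right modules are treated together: [opmul true] is composition and
   [opmul false] is composition in the opposite ring. *)
Section TwoSided.
Variables (C : numFieldType) (k : nat) (b : bool).
Implicit Types (P Q X Y : Op C k) (S I J N G : Op C k -> Prop).

Definition opmul P Q := if b then opcomp P Q else opcomp Q P.

Definition IsIdeal S N : Prop :=
  (forall P, N P -> S P) /\ N (@opzero C k) /\
  (forall P Q, N P -> N Q -> N (opadd P Q)) /\
  (forall X P, S X -> N P -> N (opmul X P)).

Definition Gen S G Q : Prop :=
  exists s : seq (Op C k * Op C k), (forall t, List.In t s -> S t.1 /\ G t.2) /\
    Q = opsum (map (fun t => opmul t.1 t.2) s).

Definition ModIso S I J : Prop :=
  exists phi : Op C k -> Op C k,
    (forall P, S P -> S (phi P)) /\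
    (forall P Q, S P -> S Q -> (I (opsub P Q) <-> J (opsub (phi P) (phi Q)))) /\
    (forall Q, S Q -> exists P, S P /\ J (opsub (phi P) Q)) /\
    (forall P Q, S P -> S Q -> J (opsub (phi (opadd P Q)) (opadd (phi P) (phi Q)))) /\
    (forall X P, S X -> S P -> J (opsub (phi (opmul X P)) (opmul X (phi P)))).

Definition MaxOver S I N : Prop :=
  IsIdeal S N /\ (forall P, I P -> N P) /\ ~ N (@opid C k) /\
  (forall N', IsIdeal S N' -> (forall P, N P -> N' P) -> ~ N' (@opid C k) ->
     forall P, N' P -> N P).

Definition subring S : Prop :=
  [/\ forall P, S P -> LaurentWeyl P, forall c, S (opscal c),
      forall P Q, S P -> S Q -> S (opadd P Q) &
      forall P Q, S P -> S Q -> S (opcomp P Q)].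

Lemma opmulA P Q X : opmul P (opmul Q X) = opmul (opmul P Q) X.
Proof. by rewrite /opmul; case: b. Qed.

Lemma opmul1 P : opmul P (@opid C k) = P.
Proof. by rewrite /opmul; case: b. Qed.

Lemma opmul1l P : opmul (@opid C k) P = P.
Proof. by rewrite /opmul; case: b. Qed.

(** [Op] contains arbitrary maps on series, so composition distributes over sums in its right
    argument only for linear ones. This is the source of the [LaurentWeyl] assumptions in the laws
    for [opmul]. *)
Lemma LW_opadd_app P f g : LaurentWeyl P ->
  P (fun m => f m + g m) = fun m => P f m + P g m.
Proof.
move=> /LW_lin /(_ 1 f g) E; transitivity (P (fun m => 1 * f m + g m)).
  by congr P; apply/funext => m; rewrite mul1r.
by rewrite E; apply/funext => m; rewrite mul1r.
Qed.

Lemma LW_opzero_app P : LaurentWeyl P -> P (fun=> 0) = fun=> 0.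
Proof.
move=> lP; apply/funext => m; have := congr1 (fun g => g m) (LW_opadd_app (fun=> 0) (fun=> 0) lP).
rewrite /=; have -> : (fun=> 0 + 0) = (fun=> 0 : C) :> Ser C k by apply/funext => ?; rewrite addr0.
by move/eqP; rewrite -subr_eq subrr => /eqP <-.
Qed.

Lemma LW_opscal_app P c f : LaurentWeyl P -> P (fun m => c * f m) = fun m => c * P f m.
Proof.
move=> lP; have := LW_lin lP c f (fun=> 0); rewrite LW_opzero_app //.
under eq_fun do rewrite addr0; move=> ->.
by apply/funext => m; rewrite addr0.
Qed.

Lemma opmulDr P Q X : LaurentWeyl P -> opmul P (opadd Q X) = opadd (opmul P Q) (opmul P X).
Proof.
move=> lP; rewrite /opmul; case: b => //.
by apply/funext => f; rewrite /opcomp /opadd LW_opadd_app.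
Qed.

Lemma opmulDl P Q X : LaurentWeyl X -> opmul (opadd P Q) X = opadd (opmul P X) (opmul Q X).
Proof.
move=> lP; rewrite /opmul; case: b => //.
by apply/funext => f; rewrite /opcomp /opadd LW_opadd_app.
Qed.

Lemma opmul_scal c P : LaurentWeyl P -> opmul (opscal c) P = opcomp (opscal c) P.
Proof.
move=> lP; rewrite /opmul; case: b => //.
by apply/funext => f; rewrite /opcomp /opscal LW_opscal_app.
Qed.

Lemma opmul_scalr c P : LaurentWeyl P -> opmul P (opscal c) = opcomp (opscal c) P.
Proof.
move=> lP; rewrite /opmul; case: b => //.
by apply/funext => f; rewrite /opcomp /opscal LW_opscal_app.
Qed.

Lemma opmul0 P : LaurentWeyl P -> opmul P (@opzero C k) = @opzero C k.
Proof.
by move=> lP; rewrite /opmul; case: b => //; apply/funext => f; apply: LW_opzero_app.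
Qed.

Lemma opmul0l P : LaurentWeyl P -> opmul (@opzero C k) P = @opzero C k.
Proof.
by move=> lP; rewrite /opmul; case: b => //; apply/funext => f; apply: LW_opzero_app.
Qed.

Lemma opmulBr P Q X : LaurentWeyl P -> LaurentWeyl X ->
  opmul P (opsub Q X) = opsub (opmul P Q) (opmul P X).
Proof.
move=> lP lX; rewrite !opsubE opmulDr // -opmul_scal // opmulA opmul_scalr //.
by rewrite -[in LHS]opmul_scal // -opmulA opmul_scal // /opmul; case: b => //; apply: LW_comp.
Qed.

Lemma opmulBl P Q X : LaurentWeyl X -> LaurentWeyl Q ->
  opmul (opsub P Q) X = opsub (opmul P X) (opmul Q X).
Proof.
move=> lX lQ; rewrite !opsubE opmulDl // -opmul_scal // -opmulA opmul_scal //.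
by rewrite /opmul; case: b; apply: LW_comp.
Qed.

Lemma opsubrr P : opsub P P = @opzero C k.
Proof. by apply/funext => f; apply/funext => m; rewrite /opsub subrr. Qed.

Lemma opsubr0 P : opsub P (@opzero C k) = P.
Proof. by apply/funext => f; apply/funext => m; rewrite /opsub subr0. Qed.

Lemma opscal1 : opscal 1 = @opid C k.
Proof. by apply/funext => f; apply/funext => m; rewrite /opscal mul1r. Qed.

Lemma opscal0 : opscal 0 = @opzero C k.
Proof. by apply/funext => f; apply/funext => m; rewrite /opscal mul0r. Qed.

Section Ideals.
Variable S : Op C k -> Prop.
Hypothesis sS : subring S.

Lemma sub_LW P : S P -> LaurentWeyl P. Proof. by case: sS => h _ _ _; apply: h. Qed.
Lemma sub_scal c : S (opscal c). Proof. by case: sS. Qed.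
Lemma sub_id : S (@opid C k). Proof. by rewrite -opscal1; apply: sub_scal. Qed.
Lemma sub_zero : S (@opzero C k). Proof. by rewrite -opscal0; apply: sub_scal. Qed.
Lemma sub_mul P Q : S P -> S Q -> S (opmul P Q).
Proof. by case: sS => _ _ _ h; rewrite /opmul; case: b => p q; apply: h. Qed.
Lemma sub_add P Q : S P -> S Q -> S (opadd P Q).
Proof. by case: sS => _ _ h _; apply: h. Qed.
Lemma sub_sub P Q : S P -> S Q -> S (opsub P Q).
Proof.
move=> p q; rewrite opsubE; apply: sub_add => //.
by case: sS => _ _ _ h; apply: h => //; apply: sub_scal.
Qed.

Lemma sub_opsum (T : Type) (s : seq T) (F : T -> Op C k) :
  (forall t, List.In t s -> S (F t)) -> S (opsum [seq F t | t <- s]).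
Proof.
elim: s => [_|t s IH H] /=; first exact: sub_zero.
by apply: sub_add; [apply: H; left | apply: IH => t' h; apply: H; right].
Qed.

Section OneIdeal.
Variable N : Op C k -> Prop.
Hypothesis iN : IsIdeal S N.

Lemma ideal_sub P : N P -> S P. Proof. by case: iN => h _; apply: h. Qed.
Lemma ideal0 : N (@opzero C k). Proof. by case: iN => _ []. Qed.
Lemma ideal_add P Q : N P -> N Q -> N (opadd P Q).
Proof. by case: iN => _ [_ [h _]]; apply: h. Qed.
Lemma ideal_mul P Q : S P -> N Q -> N (opmul P Q).
Proof. by case: iN => _ [_ [_ h]]; apply: h. Qed.
Lemma ideal_scal c P : N P -> N (opcomp (opscal c) P).
Proof.
move=> nP; rewrite -opmul_scal; last exact/sub_LW/ideal_sub.
by apply: ideal_mul => //; apply: sub_scal.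
Qed.
Lemma ideal_opsub P Q : N P -> N Q -> N (opsub P Q).
Proof. by move=> p q; rewrite opsubE; apply/ideal_add/ideal_scal. Qed.

Lemma ideal_opsum (T : Type) (s : seq T) (F : T -> Op C k) :
  (forall t, List.In t s -> N (F t)) -> N (opsum [seq F t | t <- s]).
Proof.
elim: s => [_|t s IH H] /=; first exact: ideal0.
by apply: ideal_add; [apply: H; left | apply: IH => t' h; apply: H; right].
Qed.

Lemma eqm_trans Q P X : N (opsub P Q) -> N (opsub Q X) -> N (opsub P X).
Proof.
move=> h1 h2; have -> : opsub P X = opadd (opsub P Q) (opsub Q X).
  by apply/funext => f; apply/funext => m; rewrite /opsub /opadd; ring.
exact: ideal_add.
Qed.

Lemma eqm_sym P Q : N (opsub P Q) -> N (opsub Q P).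
Proof.
move=> h; have -> : opsub Q P = opsub (@opzero C k) (opsub P Q).
  by apply/funext => f; apply/funext => m; rewrite /opsub /opzero; ring.
exact/ideal_opsub/h/ideal0.
Qed.

Lemma eqm_in P Q : N (opsub P Q) -> N Q -> N P.
Proof. by move=> h1 h2; rewrite -[P]opsubr0; apply: eqm_trans h1 _; rewrite opsubr0. Qed.

Lemma eqm_mul X P Q : S X -> S P -> S Q -> N (opsub P Q) -> N (opsub (opmul X P) (opmul X Q)).
Proof. by move=> sX sP sQ h; rewrite -opmulBr; [apply: ideal_mul|exact: sub_LW..]. Qed.

End OneIdeal.

(** A map out of a cyclic module is multiplication by the image of 1. Here u and v are the images of
    1 under the isomorphism and its inverse, mutually inverse modulo the ideals. *)
Lemma ModIso_iff I J : IsIdeal S I -> IsIdeal S J ->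
  ModIso S I J <-> exists u v, [/\ S u, S v,
    forall X, I X -> J (opmul X u), forall Y, J Y -> I (opmul Y v) &
    I (opsub (opmul u v) (@opid C k)) /\ J (opsub (opmul v u) (@opid C k))].
Proof.
move=> iI iJ; split.
  case=> phi [phiS [phiI [phisurj [_ philin]]]].
  pose u := phi (@opid C k); have Su : S u by apply/phiS/sub_id.
  have phiE X : S X -> J (opsub (phi X) (opmul X u)).
    by move=> sX; have := philin X (@opid C k) sX sub_id; rewrite opmul1.
  have phiE' X : S X -> J (opsub (opmul X u) (phi X)).
    by move=> sX; apply: (eqm_sym iJ); apply: phiE.
  have phiJ X : S X -> J (phi X) <-> I X.
    move=> sX; have := phiI X (@opzero C k) sX sub_zero; rewrite opsubr0 => E.
    have h0 : J (phi (@opzero C k)).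
      have := phiE _ sub_zero; rewrite opmul0l ?opsubr0 //; exact: sub_LW.
    split=> [h|/E h]; last exact: (eqm_in iJ h).
    by apply/E; apply: (ideal_opsub iJ).
  have [v [Sv hv]] := phisurj _ sub_id.
  have vu : J (opsub (opmul v u) (@opid C k)).
    by apply: (eqm_trans iJ) hv; apply: phiE'.
  exists u, v; split=> //.
  - move=> X IX; have sX := ideal_sub iI IX.
    by apply: (eqm_in iJ (phiE' _ sX)); apply/phiJ.
  - move=> Y JY; have sY := ideal_sub iJ JY.
    have sYv := sub_mul sY Sv; apply/phiJ => //; apply: (eqm_in iJ (phiE _ sYv)).
    rewrite -opmulA; apply: (eqm_in iJ _ JY).
    rewrite -[X in opsub _ X]opmul1; apply: eqm_mul => //; [exact: sub_mul|exact: sub_id].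
  - split=> //; have suv := sub_mul Su Sv; apply/(phiI _ _ suv sub_id).
    apply: (eqm_trans iJ (phiE _ suv)); rewrite -opmulA -[X in opsub _ X](opmul1 u).
    by apply: eqm_mul => //; [exact: sub_mul|exact: sub_id].
case=> u [v [Su Sv hI hJ [uv vu]]]; exists (fun X => opmul X u).
have L P : S P -> LaurentWeyl P by apply: sub_LW.
split; first by move=> P sP; apply: sub_mul.
split.
  move=> P Q sP sQ; split=> [/hI|h]; first by rewrite opmulBl; auto.
  move: (h); rewrite -opmulBl; auto => /hJ; rewrite -opmulA.
  have sPQ := sub_sub sP sQ; apply: (eqm_in iI); apply: (eqm_sym iI).
  rewrite -[X in opsub _ X]opmul1; apply: eqm_mul => //; [exact: sub_mul|exact: sub_id].
split.
  move=> Q sQ; exists (opmul Q v); split; first exact: sub_mul.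
  rewrite -opmulA -[X in opsub _ X]opmul1; apply: eqm_mul => //; [exact: sub_mul|exact: sub_id].
split=> [P Q sP sQ|X P sX sP]; last by rewrite opmulA opsubrr; apply: ideal0 iJ.
by rewrite opmulDl ?opsubrr; [apply: ideal0 iJ|apply: L].
Qed.

Lemma Gen_ideal G : (forall g, G g -> S g) -> IsIdeal S (Gen S G).
Proof.
move=> GS; split.
  move=> _ [s [hs ->]]; apply: sub_opsum => t /hs[h1 h2].
  exact/sub_mul/GS.
split; first by exists [::].
split.
  move=> _ _ [s [hs ->]] [s' [hs' ->]]; exists (s ++ s'); split.
    by move=> t /List.in_app_iff[/hs|/hs'].
  by rewrite map_cat opsum_cat.
move=> X _ sX [s [hs ->]]; exists [seq (opmul X t.1, t.2) | t <- s]; split.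
  move=> t; rewrite List.in_map_iff => -[t' [<- /hs[h1 h2]]]; split=> //.
  exact: sub_mul.
elim: s hs => [|t s IH] hs /=; first by rewrite opmul0 //; apply: sub_LW.
rewrite opmulDr ?opmulA ?IH //; last exact: sub_LW.
by move=> t' h; apply: hs; right.
Qed.

Lemma Gen_mem G X g : S X -> G g -> Gen S G (opmul X g).
Proof.
move=> sX Gg; exists [:: (X, g)]; split=> [t [<-|]|] //=.
by apply/funext => f; apply/funext => m; rewrite /opadd addr0.
Qed.

Lemma Gen_sub G N : IsIdeal S N -> (forall g, G g -> N g) -> forall P, Gen S G P -> N P.
Proof.
move=> iN GN _ [s [hs ->]]; apply: (ideal_opsum iN) => t /hs[h1 h2].
by apply: (ideal_mul iN) => //; apply: GN.
Qed.

End Ideals.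
End TwoSided.

(** * Weight modules *)

Section WeightModules.
Variables (C : numFieldType) (k : nat) (b : bool) (S : Op C k -> Prop).
Hypothesis sS : subring S.
Hypothesis S_poly : forall p, polyfun p -> S (homog 0 p).
Hypothesis S_graded : forall P u, S P -> S (homog u (sym P u)).
Implicit Types (u v w : 'cV[int]_k) (al be x : 'cV[C]_k) (p q f : 'cV[C]_k -> C).
Implicit Types (P Q X Y : Op C k) (N I J : Op C k -> Prop).

Local Notation mul := (opmul b).
Local Notation ideal := (IsIdeal b S).

(* In the opposite ring p(s) t^(-u) plays the role of t^u p(s): with this
   convention the product formula [hm_mul] is the same on both sides. *)
Definition hm u p : Op C k :=
  if b then homog u p else homog (- u) (fun x => p (x - zc C u)).

(** Arranged so that [hm u (cmp P u)] is the homogeneous component of P of degree u, or of degree -u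
    in the opposite ring. *)
Definition cmp P u : 'cV[C]_k -> C :=
  if b then sym P u else fun x => sym P (- u) (x + zc C u).

Definition wgens al (g : Op C k) := exists i, g = homog 0 (fun x => x i 0 - al i 0).

Lemma hm0 p : hm 0 p = homog 0 p.
Proof.
rewrite /hm; case: b => //; rewrite oppr0; congr homog.
by apply/funext => x; rewrite zc0 subr0.
Qed.

Lemma hm_mul u v p q : mul (hm u p) (hm v q) = hm (u + v) (fun x => p (x + zc C v) * q x).
Proof.
rewrite /hm /opmul; case: b; rewrite homog_comp //.
have -> : - v + - u = - (u + v) by rewrite opprD addrC.
congr homog; apply/funext => x; rewrite zcN zcD mulrC opprD.
by congr (p _ * q _); rewrite !addrA ?subrK.
Qed.

Lemma hm_linear (c : C) u p q :
  opadd (hm u p) (opcomp (opscal c) (hm u q)) = hm u (fun x => p x + c * q x).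
Proof.
apply/funext => f; apply/funext => m; rewrite /hm /opadd /opcomp /opscal /homog.
by case: b; ring.
Qed.

Lemma hm_opsum (T : Type) (s : seq T) u (F : T -> 'cV[C]_k -> C) :
  opsum [seq hm u (F t) | t <- s] = hm u (fun x => \sum_(t <- s) F t x).
Proof.
apply/funext => f; apply/funext => m; rewrite opsumE /hm /homog.
by case: b; rewrite mulr_suml.
Qed.

Lemma hm_cmp P u : hm u (cmp P u) = homog (if b then u else - u) (sym P (if b then u else - u)).
Proof.
rewrite /hm /cmp; case: b => //; congr homog; apply/funext => x.
by rewrite subrK.
Qed.

Lemma polyfun_cmp P u : polyfun (cmp P u).
Proof. by rewrite /cmp; case: b; [|apply: polyfun_shift]; apply: polyfun_act. Qed.

Lemma S_hm_cmp P u : S P -> S (hm u (cmp P u)).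
Proof. by move=> sP; rewrite hm_cmp; apply: S_graded. Qed.

Lemma S_hm0 p : polyfun p -> S (hm 0 p).
Proof. by rewrite hm0; apply: S_poly. Qed.

Lemma S_hm_mul u p f : S (hm u p) -> polyfun f -> S (hm u (fun x => p x * f x)).
Proof.
move=> sp pf; have := sub_mul b sS sp (S_hm0 pf); rewrite hm_mul addr0.
by under eq_fun do rewrite zc0 addr0.
Qed.

Lemma cmp_decomposition P : S P -> exists s : seq 'cV[int]_k,
  [/\ uniq s, forall u, u \notin s -> cmp P u = (fun=> 0) &
      P = opsum [seq hm u (cmp P u) | u <- s]].
Proof.
move=> /(sub_LW sS)/LW_support[s [us s0 E _]]; pose e u := if b then u else - u.
have eK : involutive e by rewrite /e; case: b => u; rewrite ?opprK.
exists (map e s); split.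
- by rewrite map_inj_uniq //; apply: inv_inj.
- move=> u; rewrite -{1}[u]eK (mem_map (inv_inj eK)) => nu; apply/funext => x.
  by move: nu (s0 (e u)); rewrite /e /cmp; case: b => nu ->.
- rewrite {1}E -map_comp; congr opsum; apply: eq_map => u /=.
  by rewrite hm_cmp -/(e _) eK.
Qed.

Lemma wgens_S al g : wgens al g -> S g.
Proof.
case=> i ->; apply: S_poly; exact: polyfun_sub (polyfun_coord _) (polyfun_cst _ _).
Qed.

Definition M al := Gen b S (wgens al).

Lemma M_is_ideal al : ideal (M al).
Proof. by apply: Gen_ideal => // g; apply: wgens_S. Qed.

Lemma M_wgens al g : wgens al g -> M al g.
Proof.
by move=> Gg; rewrite -[g](opmul1l b); apply: Gen_mem => //; apply: sub_id sS.
Qed.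

(** Only the component of P opposite to u reaches degree 0. For u = 0 and p = s_i - al_i the value
    is 0, so the degree-0 symbol at al descends to S/M(al); for general u it yields the products
    q(al) p(be). *)
Lemma sym_mul_hm P u p al : LaurentWeyl P -> polyfun p ->
  sym (mul P (hm u p)) 0 al = cmp P (- u) (al + zc C u) * p al.
Proof.
move=> lP pp; rewrite /sym /hm /opmul /cmp; case: b.
  rewrite act_comp ?act_homog //; last exact: LW_homog.
  by rewrite /sym; congr (act _ _ _ * _); apply/funext => v; rewrite addr_eq0.
have pp' : polyfun (fun x => p (x - zc C u)) by apply: polyfun_shift.
rewrite act_comp //; last exact: LW_homog.
have -> : al + zc C u + zc C (- u) = al by rewrite zcN addrK.
rewrite opprK mulrC -act_scale; congr act.
apply/funext => v; rewrite act_homog // addrC subr_eq0 mulrC.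
by case: eqP => [->|_]; rewrite ?addrK // !mulr0.
Qed.

Lemma M_sym al P : M al P -> sym P 0 al = 0.
Proof.
case=> s [hs ->]; rewrite /sym act_opsum; last first.
  by move=> t /hs[h1 /wgens_S h2]; apply: (sub_LW sS); apply: sub_mul.
elim: s hs => [|t s IH] hs; first by rewrite big_nil.
rewrite big_cons IH; last by move=> t' h; apply: hs; right.
have [|h1 [i ->]] := hs t; first by left.
rewrite -[act _ _ _]/(sym _ 0 al) -hm0 sym_mul_hm ?subrr ?mulr0 ?addr0 //.
  exact: sub_LW h1.
exact: polyfun_sub (polyfun_coord _) (polyfun_cst _ _).
Qed.

Lemma M_proper al : ~ M al (@opid C k).
Proof.
move=> /M_sym; rewrite /sym act_id eqxx => /eqP.
by rewrite oner_eq0.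
Qed.

Section OverM.
Variables (al : 'cV[C]_k) (N : Op C k -> Prop).
Hypothesis iN : ideal N.
Hypothesis N_gens : forall g, wgens al g -> N g.

(** Moving f(s) across t^u turns it into f(s + u), congruent to f(al + u) by [polyfun_taylor1]; thus
    the class of [hm u q] has weight al + u. *)
Lemma poly_weight u f q : S (hm u q) -> polyfun f ->
  N (opsub (mul (hm 0 f) (hm u q)) (opcomp (opscal (f (al + zc C u))) (hm u q))).
Proof.
move=> sq pf; have [g [pg Eg]] := polyfun_taylor1 (al + zc C u) pf.
have -> : opsub (mul (hm 0 f) (hm u q)) (opcomp (opscal (f (al + zc C u))) (hm u q)) =
  opsum [seq mul (hm u (fun x => q x * g i (x + zc C u))) (hm 0 (fun x => x i 0 - al i 0))
        | i <- enum 'I_k].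
  transitivity (hm u (fun x => \sum_(i <- enum 'I_k) q x * g i (x + zc C u) * (x i 0 - al i 0))).
    rewrite hm_mul add0r opsubE.
    rewrite -[opcomp (opscal (-1)) _]/(opcomp (opcomp (opscal (-1)) (opscal (f (al + zc C u)))) (hm u q)).
    have -> : opcomp (opscal (-1)) (opscal (f (al + zc C u))) = opscal (- f (al + zc C u)) :> Op C k.
      by apply/funext => h; apply/funext => m; rewrite /opcomp /opscal; ring.
    rewrite hm_linear; congr hm; apply/funext => x.
    rewrite -mulrDl Eg big_enum mulr_suml; apply: eq_bigr => i _.
    by rewrite !mxE; ring.
  rewrite -hm_opsum; congr opsum; apply: eq_map => i; rewrite hm_mul addr0.
  by congr hm; apply/funext => x; rewrite zc0 addr0.
apply: (ideal_opsum iN) => i _; apply: (ideal_mul iN).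
  by apply: S_hm_mul => //; apply: polyfun_shift.
by apply: N_gens; exists i; rewrite hm0.
Qed.

Lemma poly_scalar f : polyfun f -> N (opsub (hm 0 f) (opscal (f al))).
Proof.
move=> pf; have s1 : S (hm 0 (fun=> 1)) by apply/S_hm0/polyfun_cst.
have := poly_weight s1 pf; rewrite hm_mul zc0 !addr0 [hm 0 (fun=> 1)]hm0 -opid_homog.
by under eq_fun do rewrite addr0 mulr1.
Qed.

(** P has finitely many degrees, so a polynomial equal to 1 at x and 0 at the other weights of P
    projects to weight x. As al + u determines u, at most one component survives. *)
Lemma weight_projection P x : S P -> exists f,
  [/\ polyfun f, f x = 1,
    forall u, al + zc C u = x -> N (opsub (mul (hm 0 f) P) (hm u (cmp P u))) &
    (forall u, al + zc C u <> x) -> N (mul (hm 0 f) P)].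
Proof.
move=> sP; have [s [us s0 EP]] := cmp_decomposition sP.
pose pts := [seq al + zc C u | u <- s & al + zc C u != x].
have [f [pf f1 f0]] : exists f, [/\ polyfun f, f x = 1 & forall y, y \in pts -> f y = 0].
  apply: polyfun_separate; apply/mapP => -[u]; rewrite mem_filter => /andP[/eqP + _] E.
  by rewrite -E.
have fE u : u \in s -> al + zc C u != x -> f (al + zc C u) = 0.
  by move=> us' ux; apply: f0; apply: map_f; rewrite mem_filter ux.
exists f; split=> //.
  pose G := opsum [seq opcomp (opscal (f (al + zc C u))) (hm u (cmp P u)) | u <- s].
  have approx : N (opsub (mul (hm 0 f) P) G).
    have -> : opsub (mul (hm 0 f) P) G = opsum [seq opsub (mul (hm 0 f) (hm u (cmp P u)))
        (opcomp (opscal (f (al + zc C u))) (hm u (cmp P u))) | u <- s].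
      rewrite {1}EP /G; have : forall u, u \in s -> LaurentWeyl (hm u (cmp P u)).
        by move=> u _; apply/(sub_LW sS)/S_hm_cmp.
      have lf : LaurentWeyl (hm 0 f) by apply/(sub_LW sS)/S_hm0.
      elim: (s) => [|u s' IH] hl /=; first by rewrite opmul0 // opsubrr.
      rewrite opmulDr // -IH; last by move=> v vs; apply: hl; rewrite inE vs orbT.
      by apply/funext => h; apply/funext => m; rewrite /opsub /opadd; ring.
    by apply: (ideal_opsum iN) => u _; apply: poly_weight pf; apply: S_hm_cmp.
  move=> u Eu; suff -> : hm u (cmp P u) = G by [].
  apply/funext => h; apply/funext => m; rewrite /G opsumE.
  have [ins|nins] := boolP (u \in s).
    rewrite (big_rem u) //= /opcomp /opscal Eu f1 mul1r big_seq big1 ?addr0 // => v.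
    rewrite mem_rem_uniq // inE => /andP[vu vs]; rewrite fE ?mul0r //.
    apply: contra vu => /eqP; rewrite -Eu => /addrI/zc_inj ->; exact: eqxx.
  rewrite s0 //; transitivity (0 : C).
    by rewrite /hm /homog; case: b; rewrite mul0r.
  rewrite big_seq big1 // => v vs; rewrite /opcomp /opscal fE ?mul0r //.
  by apply: contraNneq nins; rewrite -Eu => /addrI/zc_inj <-.
move=> nx; rewrite EP; have lf : LaurentWeyl (hm 0 f) by apply/(sub_LW sS)/S_hm0.
have N0 u : u \in s -> N (mul (hm 0 f) (hm u (cmp P u))).
  move=> us'; have := poly_weight (S_hm_cmp u sP) pf.
  rewrite fE //; last exact/eqP/nx.
  by rewrite opscal0 -[opcomp _ _]/(@opzero C k) opsubr0.
elim: (s) N0 => [|u s' IH] N0 /=; first by rewrite opmul0 //; apply: ideal0 iN.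
rewrite opmulDr //; apply: (ideal_add iN); first by apply: N0; rewrite mem_head.
by apply: IH => v vs; apply: N0; rewrite inE vs orbT.
Qed.

(** The projection of P to weight al is the scalar [sym P 0 al] modulo N, and a proper ideal
    contains no nonzero scalar. *)
Lemma proper_degree0 P : ~ N (@opid C k) -> N P -> sym P 0 al = 0.
Proof.
move=> n1 NP; apply: contrapT => /eqP c0; apply: n1.
have sP := ideal_sub iN NP.
have [f [pf _ h _]] := weight_projection al sP.
have N0 : N (hm 0 (cmp P 0)).
  have := h 0; rewrite zc0 addr0 => /(_ erefl) /(eqm_sym sS iN) h'.
  by apply: (eqm_in iN h'); apply: (ideal_mul iN) NP; apply: S_hm0.
have E : cmp P 0 al = sym P 0 al by rewrite /cmp; case: b; rewrite ?oppr0 ?zc0 ?addr0.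
have Nc : N (opscal (sym P 0 al)).
  rewrite -E; apply: (eqm_in iN _ N0); apply: (eqm_sym sS iN).
  exact/poly_scalar/polyfun_cmp.
have := ideal_scal sS iN (sym P 0 al)^-1 Nc.
suff -> : opcomp (opscal (sym P 0 al)^-1) (opscal (sym P 0 al)) = @opid C k by [].
by apply/funext => g; apply/funext => m; rewrite /opcomp /opscal mulKf.
Qed.

End OverM.

(** The kernel of S -> L(al), described as the operators none of whose multiples has a nonzero
    component along the generator of weight al. *)
Definition K al P := S P /\ forall Y, S Y -> sym (mul Y P) 0 al = 0.

Lemma K_is_ideal al : ideal (K al).
Proof.
have L P : S P -> LaurentWeyl P by apply: sub_LW.
have LM P Q : S P -> S Q -> LaurentWeyl (mul P Q) by move=> *; apply: L; apply: sub_mul.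
split; first by move=> P [].
split.
  split; first exact: sub_zero sS.
  by move=> Y sY; rewrite opmul0 ?/sym ?act0 //; apply: L.
split.
  move=> P Q [sP hP] [sQ hQ]; split; first exact: sub_add.
  move=> Y sY; rewrite opmulDr; last exact: L.
  by rewrite /sym act_add; auto; rewrite -!/(sym _ 0 al) hP // hQ // addr0.
move=> X P sX [sP hP]; split; first exact: sub_mul.
by move=> Y sY; rewrite opmulA hP //; apply: sub_mul.
Qed.

Lemma K_proper al : ~ K al (@opid C k).
Proof.
case=> _ /(_ _ (sub_id sS)) /eqP; rewrite opmul1 /sym act_id eqxx.
by rewrite oner_eq0.
Qed.

Lemma K_M al P : M al P -> K al P.
Proof.
move=> MP; split; first exact: (ideal_sub (@M_is_ideal al) MP).
by move=> Y sY; apply: M_sym; apply: (ideal_mul (@M_is_ideal al)).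
Qed.

Lemma proper_sub_K al N : ideal N -> (forall P, M al P -> N P) ->
  ~ N (@opid C k) -> forall P, N P -> K al P.
Proof.
move=> iN MN n1 P NP; split; first exact: (ideal_sub iN NP).
move=> Y sY; apply: (proper_degree0 iN) n1 _; first by move=> g /M_wgens/MN.
exact: (ideal_mul iN).
Qed.

Lemma MaxOver_K al : MaxOver b S (M al) (K al).
Proof.
split; first exact: K_is_ideal; split; first exact: K_M; split; first exact: K_proper.
move=> N iN KN n1; apply: proper_sub_K => // P /K_M; exact: KN.
Qed.

Lemma MaxOver_eq al N : MaxOver b S (M al) N -> forall P, N P <-> K al P.
Proof.
move=> [iN [MN [n1 maxN]]] P; split; first exact: proper_sub_K.
apply: maxN; [exact: K_is_ideal| |exact: K_proper].
exact: proper_sub_K.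
Qed.

(** * Isomorphisms of weight modules *)

Definition weight_connected al be := exists u p q,
  [/\ al = be + zc C u, polyfun p /\ polyfun q, S (hm u p) /\ S (hm (- u) q)
    & p be != 0 /\ q al != 0].

(** Stated for quotients of M(al) and M(be) so as to cover M and L at once. The image U of 1 has
    weight al in S/J; J being proper, al - be is then some integral u, and U may be replaced by its
    component for u. In degree 0 at be, the relation VU = 1 reads q(al) p(be) = 1. *)
Lemma ModIso_connected al be I J : ideal I -> ideal J ->
  (forall P, M al P -> I P) -> (forall P, M be P -> J P) -> ~ J (@opid C k) ->
  ModIso b S I J -> weight_connected al be.
Proof.
move=> iI iJ MI MJ n1 /(ModIso_iff sS iI iJ)[U [V [SU SV hI hJ [_ VU]]]].
have gI g : wgens al g -> I g by move=> /M_wgens/MI.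
have gJ g : wgens be g -> J g by move=> /M_wgens/MJ.
have [f [pf f1 h1 h2]] := weight_projection iJ gJ al SU.
have fU : J (opsub (mul (hm 0 f) U) U).
  have := hI _ (poly_scalar iI gI pf); rewrite f1 opscal1.
  by rewrite opmulBl ?opmul1l //; [apply: (sub_LW sS)|apply: LW_id].
have [[u Eu]|nu] := pselect (exists u, be + zc C u = al); last first.
  case: n1; apply: (eqm_in iJ (eqm_sym sS iJ VU)).
  apply: (ideal_mul iJ) => //; apply: (eqm_in iJ (eqm_sym sS iJ fU)).
  by apply: h2 => u Eu; apply: nu; exists u.
pose p := cmp U u; have pp : polyfun p by apply: polyfun_cmp.
have Sp : S (hm u p) by apply: S_hm_cmp.
have Z : J (opsub (mul V (hm u p)) (@opid C k)).
  apply: (eqm_trans iJ _ VU); apply: (eqm_mul sS iJ) => //.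
  by apply: (eqm_trans iJ _ fU); apply: (eqm_sym sS iJ); apply: h1.
have /eqP := proper_degree0 iJ gJ n1 Z.
have LV := sub_LW sS SV.
rewrite /sym act_sub; [|by apply: (sub_LW sS); apply: sub_mul|exact: LW_id].
rewrite act_id eqxx -/(sym _ 0 be) sym_mul_hm // subr_eq0 => /eqP E1.
exists u, p, (cmp V (- u)); split=> //.
- by split=> //; apply: polyfun_cmp.
- by split=> //; apply: S_hm_cmp.
- have : cmp V (- u) al * p be != 0 by rewrite -Eu E1 oner_eq0.
  by rewrite mulf_eq0 negb_or => /andP[].
Qed.

(** After rescaling to p(be) q(al) = 1, the two products of t^u p(s) and t^(-u) q(s) are polynomials
    in s with value 1 at al and at be respectively, hence congruent to 1. *)
Lemma connected_units al be : weight_connected al be -> exists U V,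
  [/\ S U, S V, forall X, M al X -> M be (mul X U), forall Y, M be Y -> M al (mul Y V) &
    M al (opsub (mul U V) (@opid C k)) /\ M be (opsub (mul V U) (@opid C k))].
Proof.
move=> [u [p [q [Eal [pp pq] [Sp Sq] [p0 q0]]]]].
pose c := (p be * q al)^-1; pose p' x := p x * c.
have pp' : polyfun p' by apply: polyfun_mul => //; apply: polyfun_cst.
have Sp' : S (hm u p') by apply: S_hm_mul => //; apply: polyfun_cst.
have p'q : p' be * q al = 1.
  by rewrite /p' mulrAC mulfV // mulf_neq0.
have shift al' be' v r : al' = be' + zc C v -> polyfun r -> S (hm v r) ->
    forall X, M al' X -> M be' (mul X (hm v r)).
  move=> E pr Sr _ [s [hs ->]].
  have -> : mul (opsum [seq mul t.1 t.2 | t <- s]) (hm v r) =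
            opsum [seq mul t.1 (mul t.2 (hm v r)) | t <- s].
    have lr := sub_LW sS Sr.
    elim: (s) => [|t s' IH] /=; first by rewrite opmul0l.
    by rewrite opmulDl // IH opmulA.
  apply: (ideal_opsum (@M_is_ideal be')) => t /hs[h1 [i ->]].
  apply: (ideal_mul (@M_is_ideal be')) => //.
  have -> : mul (homog 0 (fun x => x i 0 - al' i 0)) (hm v r) =
            mul (hm v r) (hm 0 (fun x => x i 0 - be' i 0)).
    rewrite -hm0 !hm_mul addr0 add0r; congr hm; apply/funext => x.
    by rewrite zc0 addr0 E !mxE; ring.
  by apply: (ideal_mul (@M_is_ideal be')) => //; rewrite hm0; apply: M_wgens; exists i.
have unit al' f : polyfun f -> f al' = 1 -> M al' (opsub (hm 0 f) (@opid C k)).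
  move=> pf f1; rewrite -opscal1 -f1; apply: (poly_scalar (@M_is_ideal al')) => //.
  exact: M_wgens.
exists (hm u p'), (hm (- u) q); split=> //.
- exact: shift.
- by apply: shift => //; rewrite Eal zcN addrK.
- split; rewrite hm_mul ?subrr ?addNr; apply: unit.
  + by apply: polyfun_mul => //; apply: polyfun_shift.
  + by rewrite Eal zcN addrK -Eal.
  + by apply: polyfun_mul => //; apply: polyfun_shift.
  + by rewrite -Eal mulrC.
Qed.

Lemma ModIso_M al be : ModIso b S (M al) (M be) <-> weight_connected al be.
Proof.
split; last by move/connected_units => h; apply/(ModIso_iff sS (@M_is_ideal al) (@M_is_ideal be)).
exact: (ModIso_connected (@M_is_ideal al) (@M_is_ideal be) _ _ (@M_proper be)).
Qed.

(** Maximality does the work: the Y with YV in K(al) form a proper ideal over M(be), hence lie in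
    K(be), and XU is such a Y because XUV is congruent to X. *)
Lemma K_shift al be U V : S U -> S V ->
  (forall Y, M be Y -> M al (mul Y V)) ->
  M al (opsub (mul U V) (@opid C k)) -> M be (opsub (mul V U) (@opid C k)) ->
  forall X, K al X -> K be (mul X U).
Proof.
move=> SU SV hV uv vu X KX.
pose I Y := S Y /\ K al (mul Y V).
have iK := @K_is_ideal al; have sX := ideal_sub iK KX.
have iI : ideal I.
  split; first by move=> P [].
  split; first by split; [exact: sub_zero sS|rewrite opmul0l; [exact: ideal0 iK|exact: sub_LW SV]].
  split.
    move=> P Q [sP hP] [sQ hQ]; split; first exact: sub_add.
    rewrite opmulDl; last exact: (sub_LW sS SV). exact: (ideal_add iK).
  move=> Z P sZ [sP hP]; split; first exact: sub_mul.
  by rewrite -opmulA; apply: (ideal_mul iK).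
apply: (proper_sub_K iI) => [P MP|[_]|].
- by split; [exact: (ideal_sub (@M_is_ideal be) MP)|apply/K_M/hV].
- rewrite opmul1l => KV; apply: (@K_proper al).
  apply: (eqm_in iK (eqm_sym sS iK (K_M uv))).
  exact: (ideal_mul iK SU KV).
- split; first exact: sub_mul.
  rewrite -opmulA; apply: (eqm_in iK _ KX); rewrite -[X in opsub _ X](opmul1 b).
  apply: (eqm_mul sS iK) => //; [exact: sub_mul|exact: sub_id sS|exact: K_M].
Qed.

(** By [MaxOver_eq] the only maximal ideal over M(al) is K(al), so the quantification over N and N'
    concerns a single pair. *)
Lemma ModIso_Max al be :
  (forall N N', MaxOver b S (M al) N -> MaxOver b S (M be) N' -> ModIso b S N N') <->
  weight_connected al be.
Proof.
split=> [H|h N N' maxN maxN'].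
  apply: (ModIso_connected (@K_is_ideal al) (@K_is_ideal be) (@K_M al) (@K_M be) (@K_proper be)).
  by apply: H; apply: MaxOver_K.
have [iN iN'] : ideal N /\ ideal N' by case: maxN maxN' => ? _ [].
have EN := MaxOver_eq maxN; have EN' := MaxOver_eq maxN'.
have [U [V [SU SV hU hV [uv vu]]]] := connected_units h.
apply/(ModIso_iff sS iN iN'); exists U, V; split=> //.
- by move=> X /EN KX; apply/EN'; apply: (K_shift SU SV hV uv vu KX).
- by move=> X /EN' KX; apply/EN; apply: (K_shift SV SU hU vu uv KX).
- by split; [apply/EN/K_M|apply/EN'/K_M].
Qed.

End WeightModules.

(** * Operators preserving a span of monomials *)

Section StableOperators.
Variables (C : numFieldType) (k : nat) (M : 'cV[int]_k -> Prop).
Implicit Types (P Q : Op C k).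

(* P maps the span of the t^m, m in M, into itself. *)
Definition stab P := LaurentWeyl P /\ forall m, M m -> forall F,
  (forall v, M (m + v) -> F v = 0) -> act P F (zc C m) = 0.

Lemma stab_homog u p : polyfun p ->
  stab (homog u p) <-> forall m, M m -> ~ M (m + u) -> p (zc C m) = 0.
Proof.
move=> pp; split=> [[_ H] m Mm nM|H].
  have := H m Mm (fun v => (v == u)%:R); rewrite act_homog // eqxx mul1r; apply.
  by move=> v Mv; case: eqP => // vu; case: nM; rewrite -vu.
split; first exact: LW_homog.
move=> m Mm F F0; rewrite act_homog //.
by have [/F0 ->|/(H m Mm) ->] := pselect (M (m + u)); rewrite ?mul0r ?mulr0.
Qed.

Lemma stab_subring : subring stab.
Proof.
split=> [P []//|c|P Q [lP hP] [lQ hQ]|P Q [lP hP] [lQ hQ]].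
- rewrite opscal_homog; apply/stab_homog; first exact: polyfun_cst.
  by move=> m Mm; rewrite addr0.
- split=> [|m Mm F F0]; first exact: LW_add.
  by rewrite act_add // hP // hQ // addr0.
- split=> [|m Mm F F0]; first exact: LW_comp.
  rewrite act_comp //; apply: hQ => // v Mv; rewrite -zcD; apply: hP => // u Mu.
  by apply: F0; rewrite [u + v]addrC addrA.
Qed.

Lemma stab_poly p : polyfun p -> stab (homog 0 p).
Proof. by move=> pp; apply/stab_homog => // m Mm; rewrite addr0. Qed.

Lemma stab_graded P u : stab P -> stab (homog u (sym P u)).
Proof.
move=> [lP hP]; apply/stab_homog; first exact: polyfun_act.
move=> m Mm nM; apply: hP => // v Mv; case: eqP => // vu.
by case: nM; rewrite -vu.
Qed.

Lemma stab_sym P : LaurentWeyl P ->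
  (forall u m, M m -> ~ M (m + u) -> sym P u (zc C m) = 0) -> stab P.
Proof.
move=> lP H; have [s [_ _ _ E]] := LW_support lP; split=> // m Mm F F0.
rewrite E big1 // => u _.
by have [/F0 ->|/(H u m Mm) ->] := pselect (M (m + u)); rewrite ?mul0r ?mulr0.
Qed.

Lemma stab_support P f m : stab P -> (forall m', ~ M m' -> f m' = 0) ->
  ~ M m -> P f m = 0.
Proof.
move=> [lP hP] f0 nm; have [s ->] := LW_supp_apply lP.
rewrite big1 // => u _.
have [Mu|/f0 ->] := pselect (M (m - u)); last by rewrite mulr0.
rewrite [sym _ _ _]hP ?mul0r // => v; case: eqP => // ->.
by rewrite subrK.
Qed.

End StableOperators.

(** * D(R_A) and its homogeneous operators *)

Section ToricOperators.
Variables (R : realType) (d n : nat) (A : 'M[int]_(d, n)).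
Local Notation C := (complex R).

(** One way it suffices to test P on monomials, the series [delta m]; the other way finite supports
    are preserved because P has finitely many degrees. *)
Lemma DRA_stab : DRA (R := R) A = stab (inNA A).
Proof.
apply/funext => P; apply/propext; split=> [[lP hP]|sP].
  apply: stab_sym => // u m Mm nM.
  have [_ H] : inRA A (P (delta C m)).
    apply: hP; split=> [|m']; last by rewrite /delta; case: (m' =P m) => [->|_] // /eqP.
    by exists [:: m] => m'; rewrite inE /delta; case: (m' =P m) => // _; rewrite eqxx.
  apply: contrapT => /eqP h; apply: nM; apply: H.
  by rewrite act_delta // addrC addKr.
have lP : LaurentWeyl P by case: sP.
split=> // f [[s hs] fNA]; split; last first.
  move=> m; apply: contraNP => nm; apply/eqP; apply: (stab_support sP) nm => m' nm'.
  by apply: contrapT => /eqP /fNA.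
have [S ES] := LW_supp_apply lP.
exists [seq x + u | x <- s, u <- S] => m; rewrite ES => h.
have [u uS fu] : exists2 u, u \in S & f (m - u) != 0.
  apply: contrapT => H; move/eqP: h; apply; rewrite big_seq big1 // => u uS.
  by apply: contrapT => h; apply: H; exists u => //; apply: contra_not_neq h => ->; rewrite mulr0.
by apply/allpairsP; exists (m - u, u); rewrite /= hs // subrK.
Qed.

Lemma s_gens_wgens (al : 'cV[C]_d) : s_gens al = wgens al.
Proof.
have E i : opsub (@s_op R d i) (opscal (al i 0)) = homog 0 (fun x => x i 0 - al i 0).
  apply/funext => f; apply/funext => m.
  rewrite /opsub /s_op /opcomp /tmul /tder /opscal /homog !mxE !eqxx subrK !subr0.
  by rewrite mulrBl [m - _ + _]subrK.
by apply/funext => g; apply/propext; split=> -[i ->]; exists i; rewrite E.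
Qed.

Lemma connected_DRA b (al be : 'cV[C]_d) :
  weight_connected b (DRA A) al be <-> exists u p q, [/\ al = be + zc C u,
    opideal A u p /\ opideal A (- u) q & p be != 0 /\ q al != 0].
Proof.
rewrite DRA_stab; case: b.
  split=> -[u [p [q [E]]]].
    move=> [pp pq] [Sp Sq] h; exists u, p, q; split=> //.
    by split; split=> //; apply/stab_homog.
  move=> [[pp hp] [pq hq]] h; exists u, p, q; split=> //.
  by split; apply/stab_homog.
(* In the opposite ring [hm u] has degree -u, so the two polynomials exchange their roles, up to
   shifts of the argument. *)
split=> -[u [p [q [E]]]].
  move=> [pp pq] [Sp Sq] [p0 q0].
  have pp' := polyfun_shift (- zc C u) pp.
  have pq' := polyfun_shift (- zc C (- u)) pq.
  exists u, (fun x => q (x - zc C (- u))), (fun x => p (x - zc C u)); split=> //.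
    split; split=> //; last by move/(stab_homog _ _ pp'): Sp.
    by move/(stab_homog _ _ pq'): Sq; rewrite opprK.
  by rewrite E zcN opprK addrK -E.
move=> [[pp hp] [pq hq]] [p0 q0].
have pp' := polyfun_shift (zc C (- u)) pp.
have pq' := polyfun_shift (zc C u) pq.
exists u, (fun x => q (x + zc C u)), (fun x => p (x + zc C (- u))); split=> //.
  have sh (r : 'cV[C]_d -> C) v : (fun x => r (x - v + v)) = r.
    by apply/funext => x; rewrite subrK.
  split; rewrite /hm sh ?opprK; first exact/stab_homog.
  exact/stab_homog.
by rewrite E zcN addrK -E.
Qed.

End ToricOperators.

(** * The Weyl algebra *)

Section WeylAlgebra.
Variables (C : numFieldType) (n : nat).
Implicit Types (P Q : Op C n) (w : {ffun 'I_n -> nat}).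

Definition natpos (m : 'cV[int]_n) : Prop := forall i, 0 <= m i 0.

Lemma natpos_natvec w : natpos (natvec w).
Proof. by move=> i; rewrite mxE. Qed.

Lemma natposP m : natpos m -> exists w, m = natvec w.
Proof.
move=> mp; exists [ffun i => absz (m i 0)%R]; apply/matrixP => i j.
by rewrite ord1 mxE ffunE gez0_abs.
Qed.

Lemma Weyl_mono (c : C) u (w : 'I_n -> nat) : natpos u -> Weyl (mono c u w).
Proof. exact: LWwith_mono. Qed.

Lemma LWwith_id (cond : 'cV[int]_n -> ('I_n -> nat) -> Prop) :
  cond 0 (fun=> 0%N) -> LWwith cond (@opid C n).
Proof.
move=> h; have <- : mono 1 0 (fun=> 0%N) = @opid C n; last exact: LWwith_mono.
apply/funext => f; apply/funext => m; rewrite mono_finfun monoE /homog /fall big1.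
  rewrite !mul1r; congr f; rewrite -[RHS]subr0; congr (_ - _).
  by apply/matrixP => i j; rewrite !mxE ffunE.
by move=> i _; rewrite ffunE /fallfact big_ord0.
Qed.

Lemma polyfun_cfall (c : C) w : polyfun (fun x => c * fall w x).
Proof. exact: polyfun_mul (polyfun_cst _ _) (polyfun_fall _). Qed.

Lemma Weyl_list P : Weyl P -> exists s : seq (C * ('cV[int]_n * {ffun 'I_n -> nat})),
  (forall t, t \in s -> natpos t.2.1) /\ P = opsum [seq mono t.1 t.2.1 t.2.2
     | t : C * ('cV[int]_n * {ffun 'I_n -> nat}) <- s].
Proof.
case=> s [hs ->]; exists [seq (t.1.1, (t.1.2, finfun t.2)) | t <- s]; split; last first.
  rewrite -map_comp; congr opsum; apply: eq_map => t /=.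
  by rewrite mono_finfun.
elim: s hs => //= t s IH hs t'; rewrite inE => /orP[/eqP -> /=|].
  by apply: hs; left.
by apply: IH => r h; apply: hs; right.
Qed.

Lemma Weyl_opsum (T : Type) (s : seq T) (F : T -> Op C n) :
  (forall t, List.In t s -> Weyl (F t)) -> Weyl (opsum [seq F t | t <- s]).
Proof.
move=> H; apply: LWwith_opsum => P; rewrite List.in_map_iff => -[t [<- h]].
exact: H.
Qed.

Lemma Weyl_LW P : Weyl P -> LaurentWeyl P.
Proof. by case=> s [_ E]; exists s. Qed.

(** In degree u the symbol of a stabilizing operator vanishes at every w in N^n for which w + u
    leaves N^n. Its expansion thus uses only [s]_w with w + u in N^n, and t^u [s]_w = t^(u+w) d^w is
    a Weyl monomial. *)
Lemma Weyl_stab : @Weyl C n = stab natpos.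
Proof.
apply/funext => P; apply/propext; split=> [[s [hs ->]]|sP].
  apply: sub_opsum; first exact: stab_subring.
  move=> t /hs tpos.
  rewrite mono_finfun monoE; apply/stab_homog; first exact: polyfun_cfall.
  move=> m /natposP[a ->] nm; rewrite zc_natvec.
  have [->|/fall_ncol_neq0 le] := eqVneq (fall (finfun t.2) (ncol C a)) 0.
    by rewrite mulr0.
  case: nm => i; have := tpos i; have := le i; rewrite !mxE !ffunE.
  by move: (t.1.2 i 0) (t.2 i) (a i) => x y z; lia.
have [s [_ _ -> _]] := LW_support (proj1 sP).
apply: Weyl_opsum => u _.
have := stab_graded u sP; move/(stab_homog _ _ (polyfun_act P _)) => H.
have [w w' le Dw i|w nD|r [hr Er]] := fall_span_upset (D := fun w => natpos (natvec w + u))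
    (polyfun_act P (fun v => (v == u)%:R)).
- by have := Dw i; have := le i; rewrite !mxE; lia.
- by rewrite -zc_natvec; apply: H => //; apply: natpos_natvec.
rewrite /sym Er.
have -> : homog u (fun x => \sum_(t <- r) t.1 * fall t.2 x) =
  opsum [seq mono t.1 (u + natvec t.2) t.2 | t : C * {ffun 'I_n -> nat} <- r].
  apply/funext => f; apply/funext => m; rewrite opsumE /homog mulr_suml.
  by apply: eq_bigr => t _; rewrite monoE /homog addrK.
elim: r hr {Er} => [_|t r IH hr] /=; first exact: LWwith_0.
apply: LWwith_add; last by apply: IH => t' h; apply: hr; rewrite inE h orbT.
by apply: Weyl_mono; rewrite addrC; apply: hr; apply: mem_head.
Qed.

Lemma Weyl_subring : subring (@Weyl C n).
Proof. rewrite Weyl_stab; exact: stab_subring. Qed.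

Lemma Weyl_poly (p : 'cV[C]_n -> C) : polyfun p -> Weyl (homog 0 p).
Proof. by move=> pp; rewrite Weyl_stab; apply: stab_poly. Qed.

(** Since d_i^b kills x_i^a when b > a, and multiplication only raises exponents, natural exponents
    stay natural; the other coordinates of x are arbitrary complex numbers. *)
Lemma Weyl_good P F (x : 'cV[C]_n) : Weyl P ->
  (forall v : 'cV[int]_n, (forall i (a : nat), x i 0 = a%:R -> exists b : nat, x i 0 + (v i 0)%:~R = b%:R) ->
     F v = 0) -> act P F x = 0.
Proof.
move=> wP F0; have [s [hs ->]] := Weyl_list wP.
rewrite act_opsum; last by move=> t _; apply: LWwith_mono.
rewrite big_seq big1 // => t ts; rewrite monoE act_homog; last exact: polyfun_cfall.
have [->|fx] := eqVneq (fall t.2.2 x) 0; first by rewrite !mulr0.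
rewrite F0 ?mul0r // => i a xi; move: fx; rewrite /fall (bigD1 i) //= mulf_eq0 negb_or.
rewrite xi fallfact_nat pnatr_eq0 => /andP[fa _].
have le : (t.2.2 i <= a)%N by rewrite leqNgt; apply: contra fa => /ffact_small ->.
have := hs t ts i; case E : (t.2.1 i 0) => [e|//] _.
exists (a - t.2.2 i + e)%N; rewrite !mxE E -[a%:R]/(a%:Z%:~R) -intrD.
rewrite -[RHS]/((a - t.2.2 i + e)%N%:Z%:~R); congr (_%:~R).
by move: (t.2.2 i) le => z le; lia.
Qed.

Lemma IdSum_ideal b I J : IsIdeal b (@Weyl C n) I -> IsIdeal b (@Weyl C n) J ->
  IsIdeal b (@Weyl C n) (IdSum I J).
Proof.
move=> iI iJ; have sW := Weyl_subring.
split.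
  move=> _ [P [Q [IP [JQ ->]]]]; apply: (sub_add sW).
    exact: (ideal_sub iI).
  exact: (ideal_sub iJ).
split.
  exists (@opzero C n), (@opzero C n); split; first exact: ideal0 iI.
  split; first exact: ideal0 iJ.
  by apply/funext => f; apply/funext => m; rewrite /opadd addr0.
split.
  move=> _ _ [P [Q [IP [JQ ->]]]] [P' [Q' [IP' [JQ' ->]]]].
  exists (opadd P P'), (opadd Q Q'); split; first exact: (ideal_add iI).
  split; first exact: (ideal_add iJ).
  by apply/funext => f; apply/funext => m; rewrite /opadd; ring.
move=> X _ WX [P [Q [IP [JQ ->]]]]; exists (opmul b X P), (opmul b X Q).
split; first exact: (ideal_mul iI).
split; first exact: (ideal_mul iJ).
by rewrite opmulDr //; apply: Weyl_LW.
Qed.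

End WeylAlgebra.

(** * The map C[x] -> C[NA] *)

Section Pushforward.
Variables (R : realType) (d n : nat) (A : 'M[int]_(d, n)).
Local Notation C := (complex R).
Implicit Types (P Q U V X : Op C n) (x : 'cV[C]_n) (e : 'cV[int]_d).
Implicit Types (p q : 'cV[C]_d -> C).

Definition cA : 'M[C]_(d, n) := map_mx (fun z : int => z%:~R) A.

Lemma cA_zc v : cA *m zc C v = zc C (A *m v).
Proof.
apply/matrixP => i j; rewrite !mxE rmorph_sum; apply: eq_bigr => l _.
by rewrite !mxE rmorphM.
Qed.

(* U induces the operator t^e p(s) on C[NA] = C[x] / I_A(x). *)
Definition lifts U e p := Weyl U /\ forall (G : 'cV[int]_d -> C) x,
  act U (fun v => G (A *m v)) x = G e * p (cA *m x).

(** The functionals x^v -> G(Av) are those that vanish on I_A(x), so the condition says that P maps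
    C[x] into I_A(x). For Weyl operators [killed_IA] turns it into membership in I_A(x) D(R). *)
Definition killed P := forall (G : 'cV[int]_d -> C) x,
  act P (fun v => G (A *m v)) x = 0.

Lemma lifts_comp U V e e' p q : lifts U e p -> lifts V e' q ->
  lifts (opcomp U V) (e + e') (fun y => p (y + zc C e') * q y).
Proof.
move=> [WU hU] [WV hV]; split.
  by case: (Weyl_subring C n) => _ _ _; apply.
move=> G x; rewrite act_comp; try exact: Weyl_LW.
transitivity (act V (fun v => (fun c => G (e + c) * p (cA *m x + zc C c)) (A *m v)) x).
  congr act; apply/funext => v; rewrite -cA_zc -mulmxDr.
  by rewrite -(hU (fun c => G (c + A *m v))); congr act; apply/funext => u; rewrite mulmxDr.
by rewrite (hV (fun c => G (e + c) * p (cA *m x + zc C c))) mulrA.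
Qed.

Lemma killed_compr U P e p : lifts U e p -> LaurentWeyl P -> killed P -> killed (opcomp U P).
Proof.
move=> [WU hU] lP kP G x; rewrite act_comp //; last exact: Weyl_LW.
rewrite -[RHS](kP (fun c => G (e + c) * p (cA *m x + zc C c)) x).
congr act; apply/funext => v; rewrite -cA_zc -mulmxDr.
by rewrite -(hU (fun c => G (c + A *m v))); congr act; apply/funext => u; rewrite mulmxDr.
Qed.

Lemma killed_opsum (T : Type) (s : seq T) (F : T -> Op C n) :
  (forall t, List.In t s -> LaurentWeyl (F t) /\ killed (F t)) ->
  killed (opsum [seq F t | t <- s]).
Proof.
move=> H G x; rewrite act_opsum; last by move=> t /H[].
elim: s H => [|t s IH] H; first by rewrite big_nil.
rewrite big_cons IH; last by move=> t' h; apply: H; right.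
by case: (H t); [left|move=> _ ->; rewrite addr0].
Qed.

Lemma lifts_eq_killed U V e p : lifts U e p -> lifts V e p -> killed (opsub U V).
Proof.
move=> [WU hU] [WV hV] G x; rewrite act_sub; try exact: Weyl_LW.
by rewrite hU hV subrr.
Qed.

Lemma lifts_poly p : polyfun p -> lifts (homog 0 (fun x => p (cA *m x))) 0 p.
Proof.
move=> pp; have pp' : polyfun (fun x => p (cA *m x)) by apply: polyfun_mulmx.
by split=> [|G x]; [apply: Weyl_poly | rewrite act_homog // mulmx0].
Qed.

Lemma euler_gensE (al : 'cV[C]_d) i : opsub (euler A i) (opscal (al i 0)) =
  homog 0 (fun x => (cA *m x) i 0 - al i 0).
Proof.
apply/funext => f; apply/funext => m; rewrite /opsub /opscal /homog subr0 mulrBl.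
congr (_ - _); rewrite /euler opsumE big_enum mxE mulr_suml.
apply: eq_bigr => j _; rewrite /opcomp /opscal /tmul /tder !mxE !eqxx subrK.
by rewrite [m - _ + _]subrK mulrA.
Qed.

Lemma lifts_euler (al : 'cV[C]_d) i :
  lifts (opsub (euler A i) (opscal (al i 0))) 0 (fun y => y i 0 - al i 0).
Proof.
rewrite euler_gensE.
exact: (lifts_poly (polyfun_sub (polyfun_coord i) (polyfun_cst _ (al i 0)))).
Qed.

(** p(Ax) is expanded in falling factorials [x]_w with Aw + e in NA; such a term lifts to x^c d^w
    for any c in N^n with Ac = Aw + e. *)
Lemma lift_exists e p : opideal A e p -> exists U, lifts U e p.
Proof.
move=> [pp p0].
have natvecE w : A *m natvec w = \sum_j (w j)%:Z *: col j A.
  apply/matrixP => i j; rewrite ord1 !mxE summxE; apply: eq_bigr => l _.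
  by rewrite !mxE mulrC.
have natfE (c : 'I_n -> nat) : A *m natvec c = \sum_j (c j)%:Z *: col j A.
  apply/matrixP => i j; rewrite ord1 !mxE summxE; apply: eq_bigr => l _.
  by rewrite !mxE mulrC.
pose D (w : {ffun 'I_n -> nat}) := inNA A (A *m natvec w + e).
have [||s [hs Es]] := fall_span_upset (D := D) (polyfun_mulmx cA pp).
- move=> w w' le [c Ec]; exists (fun j => (c j + (w' j - w j))%N).
  rewrite -natfE; have -> : natvec (fun j => (c j + (w' j - w j))%N) =
      natvec c + (natvec w' - natvec w).
    by apply/matrixP => i j; rewrite !mxE; have := le i; lia.
  by rewrite mulmxDr (natfE c) -Ec mulmxBr; apply/matrixP => i j; rewrite !mxE; ring.
- move=> w nD; rewrite -zc_natvec cA_zc; apply: p0 => //.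
  by exists w.
have /choice[r Hr] : forall w : {ffun 'I_n -> nat}, exists c : {ffun 'I_n -> nat},
    D w -> A *m natvec w + e = A *m natvec c.
  move=> w; have [[c Ec]|] := pselect (D w); last by exists w.
  exists (finfun c) => _; rewrite Ec -natfE; congr (_ *m _).
  by apply/matrixP => i j; rewrite !mxE ffunE.
exists (opsum [seq mono t.1 (natvec (r t.2)) t.2 | t : C * {ffun 'I_n -> nat} <- s]); split.
  by apply: Weyl_opsum => t _; apply: Weyl_mono; apply: natpos_natvec.
move=> G x; rewrite act_opsum; last by move=> t _; apply: LWwith_mono.
rewrite -[p (cA *m x)]/((fun y => p (cA *m y)) x) Es mulr_sumr big_seq [RHS]big_seq.
apply: eq_bigr => t ts; rewrite monoE act_homog; last exact: polyfun_cfall.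
by rewrite mulmxBr -Hr ?addrK 1?addrC ?addKr //; apply: hs.
Qed.

Lemma tmul_homog (u : 'cV[int]_n) : @tmul C n u = homog u (fun=> 1).
Proof. by apply/funext => f; apply/funext => m; rewrite /homog mul1r. Qed.

Lemma tmul_Weyl (w : 'I_n -> nat) : Weyl (@tmul C n (natvec w)).
Proof.
rewrite tmul_homog Weyl_stab; apply/stab_homog; first exact: polyfun_cst.
by move=> m mp [] i; rewrite !mxE addr_ge0.
Qed.

Definition IA_x_gens (g : Op C n) := exists u v : 'I_n -> nat,
  sameA A u v /\ g = opsub (tmul (natvec u)) (tmul (natvec v)).

Lemma IA_x_gens_killed g : IA_x_gens g -> Weyl g /\ killed g.
Proof.
move=> [u [v [E ->]]]; split; first by apply: (sub_sub (Weyl_subring _ _)); apply: tmul_Weyl.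
move=> G x; rewrite act_sub; try exact/Weyl_LW/tmul_Weyl.
by rewrite !tmul_homog !act_homog ?E ?subrr //; apply: polyfun_cst.
Qed.

Lemma PolyX_list P : PolyX P -> exists s : seq (C * 'cV[int]_n),
  (forall t, List.In t s -> natpos t.2) /\ P = opsum [seq homog t.2 (fun=> t.1) | t <- s].
Proof.
case=> s [hs ->]; exists [seq (t.1.1, t.1.2) | t <- s]; split.
  by move=> t; rewrite List.in_map_iff => -[t' [<- /hs[]]].
rewrite -map_comp; elim: s hs => //= t s IH hs; congr opadd; last first.
  by apply: IH => t' h; apply: hs; right.
have [_ v0] := hs t (or_introl erefl).
rewrite mono_finfun monoE; have -> : natvec (finfun t.2) = 0 :> 'cV[int]_n.
  by apply/matrixP => i j; rewrite !mxE ffunE v0.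
rewrite subr0; congr homog; apply/funext => x; rewrite /fall big1 ?mulr1 // => i _.
by rewrite ffunE v0 /fallfact big_ord0.
Qed.

Lemma PolyX_lifted P : PolyX P -> Weyl P /\ forall g, Weyl g -> killed g -> killed (opcomp P g).
Proof.
move=> /PolyX_list[s [hs ->]].
have Wh t : List.In t s -> Weyl (homog t.2 (fun=> t.1)).
  move=> /hs tp; rewrite Weyl_stab; apply/stab_homog; first exact: polyfun_cst.
  by move=> m mp [] i; rewrite !mxE addr_ge0 ?tp.
split; first exact: Weyl_opsum.
move=> g Wg kg.
have -> : opcomp (opsum [seq homog t.2 (fun=> t.1) | t <- s]) g =
   opsum [seq opcomp (homog t.2 (fun=> t.1)) g | t <- s].
  by apply/funext => f; apply/funext => m; rewrite /opcomp !opsumE.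
apply: killed_opsum => t ts; split; first by apply: LW_comp; [apply: LW_homog; apply: polyfun_cst|apply: Weyl_LW].
apply: (killed_compr (e := A *m t.2) (p := fun=> t.1)) => //; last exact: Weyl_LW.
by split=> [|G x]; [apply: Wh | rewrite act_homog //; apply: polyfun_cst].
Qed.

Lemma IA_x_killed P : IA_x A P -> Weyl P /\ killed P.
Proof.
move=> [s [hs ->]]; split.
  apply: Weyl_opsum => t /hs[/PolyX_lifted[W1 _] /IA_x_gens_killed[W2 _]].
  exact: (sub_mul true (Weyl_subring _ _)).
apply: killed_opsum => t /hs[/PolyX_lifted[W1 K1] /IA_x_gens_killed[W2 K2]]; split; last exact: K1.
by apply: LW_comp; apply: Weyl_LW.
Qed.

(* Each x^u d^w is rewritten as x^r(Au) d^w modulo I_A(x), r being a section of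
   N^n -> NA; the remaining coefficients vanish by triangularity. *)
Lemma killed_IA P : Weyl P -> killed P -> RightGen (@Weyl C n) (IA_x A) P.
Proof.
move=> /Weyl_list[s [hs EP]] kP.
have /choice[r Hr] : forall e : 'cV[int]_d, exists c : 'I_n -> nat,
    (exists c' : 'I_n -> nat, e = A *m natvec c') -> e = A *m natvec c.
  move=> e; have [[c Ec]|nc] := pselect (exists c' : 'I_n -> nat, e = A *m natvec c').
    by exists c.
  by exists (fun=> 0%N).
have lmono (t : C * ('cV[int]_n * {ffun 'I_n -> nat})) : LaurentWeyl (mono t.1 t.2.1 t.2.2).
  exact: LWwith_mono.
have coef0 (key : 'cV[int]_d * {ffun 'I_n -> nat}) :
    \sum_(t <- s | (A *m t.2.1, t.2.2) == key) t.1 = 0.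
  (* A term x^u d^w with Au = e shifts A-degrees by e - Aw; testing P with the indicator of [e0]
     isolates the terms of this shift. *)
  case: key => e w; pose e0 := e - A *m natvec w.
  pose s' := [seq (t.1, t.2.2) | t : C * ('cV[int]_n * {ffun 'I_n -> nat}) <- s & A *m (t.2.1 - natvec t.2.2) == e0].
  have H0 w' : True -> \sum_(t <- s') t.1 * fall t.2 (ncol C w') = 0.
    move=> _; rewrite big_map big_filter -[RHS](kP (fun c => (c == e0)%:R) (ncol C w')) EP.
    rewrite act_opsum // big_mkcond; apply: eq_bigr => t _ /=.
    rewrite monoE act_homog; last exact: polyfun_cfall.
    by case: ifP => _; rewrite ?mul1r ?mul0r.
  rewrite -[RHS](fall_triangular (D := fun=> True) (fun _ _ _ _ => I) H0 (w := w) I).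
  rewrite /s' big_map big_filter_cond; apply: eq_bigl => t /=.
  rewrite xpair_eqE andbC [RHS]andbC; case: (t.2.2 =P w) => [->|] //=.
  by rewrite mulmxBr /e0 (inj_eq (addIr _)).
have Q0 : opsum [seq mono t.1 (natvec (r (A *m t.2.1))) t.2.2
     | t : C * ('cV[int]_n * {ffun 'I_n -> nat}) <- s] = @opzero C n.
  apply/funext => f; apply/funext => m; rewrite opsumE.
  pose F (key : 'cV[int]_d * {ffun 'I_n -> nat}) := mono 1 (natvec (r key.1)) key.2 f m.
  have := @sum_keyed0 C _ [seq (t.1, (A *m t.2.1, t.2.2)) | t : C * ('cV[int]_n * {ffun 'I_n -> nat}) <- s] F predT.
  rewrite big_map => H; rewrite -[RHS]H; last by move=> key _; right; rewrite big_map; apply: coef0.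
  by apply: eq_bigr => t _; rewrite /F /mono /opcomp /opscal mul1r.
exists [seq (mono t.1 0 t.2.2, opsub (tmul t.2.1) (tmul (natvec (r (A *m t.2.1)))))
     | t : C * ('cV[int]_n * {ffun 'I_n -> nat}) <- s]; split; last first.
  rewrite EP; apply/funext => f; apply/funext => m.
  have := congr1 (fun P => P f m) Q0; rewrite /= opsumE => E.
  rewrite -[LHS]subr0 -[X in _ - X]E -map_comp !opsumE -sumrB; apply: eq_bigr => t _.
  by rewrite /= /mono /opcomp /opsub /opscal /tmul !subr0.
have hs' t : List.In t s -> natpos t.2.1.
  elim: (s) hs => //= t' s' IH h [<-|ts]; first by apply: h; rewrite mem_head.
  by apply: IH => // t'' ht; apply: h; rewrite inE ht orbT.
move=> t; rewrite List.in_map_iff => -[t' [<- /hs' tp]] /=; split.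
  by apply: Weyl_mono => i; rewrite mxE.
have [w Ew] := natposP tp.
exists [:: (@opid C n, opsub (tmul t'.2.1) (tmul (natvec (r (A *m t'.2.1)))))].
split; last by apply/funext => f; apply/funext => m; rewrite /opsum /= /opadd addr0.
move=> _ [<-|[]] /=; split.
  by apply: LWwith_id; split=> [i|] //; rewrite mxE.
exists w, (r (A *m t'.2.1)); split; last by rewrite -Ew.
by rewrite /sameA -Ew; apply: Hr; exists w; rewrite Ew.
Qed.

End Pushforward.

(** * Hypergeometric modules *)

Section HypergeometricRight.
Variables (R : realType) (d n : nat) (A : 'M[int]_(d, n)).
Local Notation C := (complex R).
Local Notation W := (@Weyl C n).
Local Notation cA := (cA R A).
Implicit Types (P Q U V X : Op C n) (x : 'cV[C]_n) (al be : 'cV[C]_d).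

Lemma euler_gens_Weyl al g : euler_gens A al g -> W g.
Proof. by case=> i ->; case: (lifts_euler A al i). Qed.

Lemma RHA_is_ideal al : IsIdeal false W (RHA_ideal A al).
Proof.
apply: IdSum_ideal; apply: (Gen_ideal false (Weyl_subring _ _)) => g.
  exact: euler_gens_Weyl.
by case/IA_x_killed.
Qed.

Lemma RHA_euler al g : euler_gens A al g -> RHA_ideal A al g.
Proof.
move=> hg; exists g, (@opzero C n); split.
  by rewrite -[g](opmul1l false); apply: Gen_mem => //; apply: (sub_id (Weyl_subring _ _)).
split; first by exists [::].
by apply/funext => f; apply/funext => m; rewrite /opadd addr0.
Qed.

Lemma RHA_killed al P : W P -> killed A P -> RHA_ideal A al P.
Proof.
move=> wP kP; exists (@opzero C n), P; split; first by exists [::].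
split; first exact: killed_IA.
by apply/funext => f; apply/funext => m; rewrite /opadd add0r.
Qed.

Lemma RHA_sub al N : IsIdeal false W N -> (forall g, euler_gens A al g -> N g) ->
  (forall P, W P -> killed A P -> N P) -> forall P, RHA_ideal A al P -> N P.
Proof.
move=> iN N1 N2 _ [P [Q [GP [GQ ->]]]]; apply: (ideal_add iN).
  exact: (Gen_sub iN N1 GP).
by apply: (Gen_sub iN _ GQ) => g /IA_x_killed[]; apply: N2.
Qed.

(** (E_i - be_i) U and U (E_i - al_i) induce the same operator on C[NA], so their difference is
    killed. *)
Lemma lift_RHA al be U u p : lifts A U u p -> be = al + zc C u ->
  forall X, RHA_ideal A al X -> RHA_ideal A be (opcomp U X).
Proof.
move=> lU E X HX.
have sW := Weyl_subring C n; have WU : W U by case: lU.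
have iB := RHA_is_ideal be.
suff [_ //] : W X /\ RHA_ideal A be (opcomp U X).
apply: (RHA_sub (N := fun X => W X /\ RHA_ideal A be (opcomp U X))) HX.
- have LU := Weyl_LW WU.
  split; first by move=> P [].
  split.
    split; first exact: sub_zero sW.
    by rewrite -[opcomp _ _]/(opmul true U _) opmul0 //; apply: ideal0 iB.
  split.
    move=> P Q [WP hP] [WQ hQ]; split; first exact: sub_add sW _ _ _ _.
    rewrite -[opcomp U _]/(opmul true U _) opmulDr //.
    exact: (ideal_add iB).
  move=> Y P WY [WP hP]; split; first exact: (sub_mul false sW).
  exact: (ideal_mul iB WY hP).
- move=> g hg; have Wg := euler_gens_Weyl hg; split=> //.
  case: hg => i Eg; have lg := lifts_euler A al i; rewrite -Eg in lg.
  pose h := opsub (euler A i) (opscal (be i 0)); have lh := lifts_euler A be i.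
  have Hh : RHA_ideal A be (opcomp h U).
    by apply: (ideal_mul iB WU); apply: RHA_euler; exists i.
  apply: (eqm_in iB _ Hh); apply: RHA_killed.
    apply: (sub_sub sW); [exact: (sub_mul true sW WU Wg)|].
    by apply: (sub_mul true sW _ WU); case: lh.
  have l1 := lifts_comp lU lg; have l2 := lifts_comp lh lU.
  apply: lifts_eq_killed l1 _; move: l2; rewrite add0r addr0.
  congr lifts; apply/funext => y; rewrite zc0 addr0 E !mxE mulrC; congr (_ * _).
  by ring.
- move=> P WP kP; split=> //; apply: RHA_killed.
    exact: (sub_mul true sW WU WP).
  exact: (killed_compr lU (Weyl_LW WP) kP).
Qed.

(** By [polyfun_taylor1], f(s) - 1 is a combination of the s_i - al_i; the lifts of both sides agree
    up to a killed operator. *)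
Lemma lift0_RHA al U f : lifts A U 0 f -> polyfun f -> f al = 1 ->
  RHA_ideal A al (opsub U (@opid C n)).
Proof.
move=> lU pf f1; have sW := Weyl_subring C n; have iB := RHA_is_ideal al.
have [g [pg Eg]] := polyfun_taylor1 al pf.
pose h i := opsub (euler A i) (opscal (al i 0)).
pose G i := homog 0 (fun x => g i (cA *m x)) : Op C n.
have lG i : lifts A (G i) 0 (g i) by apply: lifts_poly.
have lh i : lifts A (h i) 0 (fun y => y i 0 - al i 0) by apply: lifts_euler.
pose S := opsum [seq opcomp (h i) (G i) | i <- enum 'I_d].
have WhG i : W (opcomp (h i) (G i)).
  by case: (lh i) => wh _; case: (lG i) => wG _; apply: (sub_mul true sW wh wG).
have HS : RHA_ideal A al S.
  apply: (ideal_opsum iB) => i _; case: (lG i) => WG _.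
  by apply: (ideal_mul iB WG); apply: RHA_euler; exists i.
have WU : W U by case: lU.
apply: (eqm_in iB _ HS); apply: RHA_killed.
  apply: (sub_sub sW); first by apply: (sub_sub sW) => //; apply: sub_id sW.
  by apply: (sub_opsum sW) => i _.
have WS : W S by apply: (sub_opsum sW) => i _.
move=> F x; rewrite act_sub; [|apply: LW_sub; [exact: Weyl_LW|exact: LW_id]|exact: Weyl_LW].
rewrite act_sub; [|exact: Weyl_LW|exact: LW_id].
rewrite act_id mulmx0; case: lU => _ ->.
rewrite act_opsum; last by move=> i _; apply: Weyl_LW.
apply/eqP; rewrite subr_eq0; apply/eqP.
transitivity (F 0 * (f (cA *m x) - f al)); first by rewrite f1 mulrBr mulr1.
rewrite Eg big_enum mulr_sumr; apply: eq_bigr => i _.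
have [_ ->] := lifts_comp (lh i) (lG i).
by rewrite addr0 zc0 addr0 [X in _ = _ * X]mulrC.
Qed.

Lemma connected_RightModIso al be :
  (exists u p q, [/\ al = be + zc C u,
    opideal A u p /\ opideal A (- u) q & p be != 0 /\ q al != 0]) ->
  ModIso false W (RHA_ideal A al) (RHA_ideal A be).
Proof.
move=> [u [p [q [E [hp hq] [p0 q0]]]]].
have sW := Weyl_subring C n.
apply/(ModIso_iff sW (RHA_is_ideal al) (RHA_is_ideal be)).
pose c := (p be * q al)^-1; pose p' y := p y * c.
have hp' : opideal A u p'.
  case: hp => pp hp; split; first by apply: polyfun_mul => //; apply: polyfun_cst.
  by move=> m h1 h2; rewrite /p' hp // mul0r.
have p'q : p' be * q al = 1 by rewrite /p' mulrAC mulfV // mulf_neq0.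
have [U lU] := lift_exists hq; have [V lV] := lift_exists hp'.
have E' : be = al + zc C (- u) by rewrite E zcN addrK.
have [pp' pq] : polyfun p' /\ polyfun q by case: hp' => ? _; case: hq.
exists U, V; split; [by case: lU|by case: lV| | |split].
- exact: (lift_RHA lU E').
- exact: (lift_RHA lV E).
- have := lifts_comp lV lU; rewrite subrr => l; apply: lift0_RHA l _ _.
    by apply: polyfun_mul => //; apply: polyfun_shift.
  by rewrite -E'.
- have := lifts_comp lU lV; rewrite addNr => l; apply: lift0_RHA l _ _.
    by apply: polyfun_mul => //; apply: polyfun_shift.
  by rewrite -E mulrC.
Qed.

(** * E_tau as an isomorphism invariant of the right modules *)

Definition euler_fiber al x (v : 'cV[int]_n) : C := (cA *m (x + zc C v) == al)%:R.

(* The functional picking the monomials of A-degree al kills P x^y for every P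
   in the ideal, since the generators preserve A-degree up to I_A(x). *)
Lemma RHA_act al P : RHA_ideal A al P -> forall x, act P (euler_fiber al x) x = 0.
Proof.
have sW := Weyl_subring C n.
move=> HP; suff [_ //] : W P /\ forall x, act P (euler_fiber al x) x = 0.
apply: (RHA_sub (N := fun P => W P /\ forall x, act P (euler_fiber al x) x = 0)) HP.
- split; first by move=> ? [].
  split; first by split=> [|x]; [exact: sub_zero sW|rewrite act0].
  split.
    move=> Q Q' [WQ hQ] [WQ' hQ']; split=> [|x]; first exact: sub_add sW _ _ _ _.
    by rewrite act_add ?hQ ?hQ' ?addr0 //; apply: Weyl_LW.
  move=> X Q WX [WQ hQ]; split=> [|x]; first exact: (sub_mul false sW).
  rewrite act_comp; try exact: Weyl_LW.
  rewrite -[RHS](act_F0 X x); congr act; apply/funext => v.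
  rewrite -[RHS](hQ (x + zc C v)); congr act; apply/funext => u.
  by rewrite /euler_fiber zcD [zc C u + _]addrC addrA.
- move=> g hg; split=> [|x]; first exact: euler_gens_Weyl hg.
  case: hg => i ->; rewrite euler_gensE act_homog.
    rewrite /euler_fiber zc0 addr0; case: eqP => [->|]; last by rewrite mul0r.
    by rewrite subrr mulr0.
  exact: (polyfun_mulmx cA (polyfun_sub (polyfun_coord i) (polyfun_cst _ (al i 0)))).
- move=> Q WQ kQ; split=> // x; rewrite -[RHS](kQ (fun c => (cA *m x + zc C c == al)%:R) x).
  by congr act; apply/funext => v; rewrite /euler_fiber mulmxDr cA_zc.
Qed.

(** VU takes the exponent x back to A-degree al with total coefficient 1. As V (E_i - be_i) lies in
    the ideal for al, V contributes nothing from exponents y with Ay different from be; so U must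
    reach an exponent over be, and it does so keeping natural coordinates natural. *)
Lemma degree_transport al be U V x : W U -> W V ->
  RHA_ideal A al (opsub (opcomp V U) (@opid C n)) ->
  (forall g, euler_gens A be g -> RHA_ideal A al (opcomp V g)) ->
  cA *m x = al -> exists v : 'cV[int]_n, cA *m (x + zc C v) = be /\
    forall i (a : nat), x i 0 = a%:R -> exists b : nat, x i 0 + (v i 0)%:~R = b%:R.
Proof.
move=> WU WV HVU HV Ex; apply: contrapT => nv.
have lU := Weyl_LW WU; have lV := Weyl_LW WV.
have := RHA_act HVU x; rewrite act_sub; [|exact: LW_comp|exact: LW_id].
rewrite act_id /euler_fiber zc0 addr0 Ex eqxx act_comp //.
rewrite [act U _ x](_ : _ = 0); first by move/eqP; rewrite sub0r oppr_eq0 oner_eq0.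
apply: (Weyl_good WU) => v gv; set y := x + zc C v.
(* E_i - be_i multiplies the monomial with exponent y by a nonzero scalar, which can be
   cancelled. *)
have [i yi] : exists i, (cA *m y) i 0 - be i 0 != 0.
  apply: contrapT => H; apply: nv; exists v; split=> //.
  apply/matrixP => i j; rewrite ord1; apply/eqP; rewrite -subr_eq0; apply/negPn/negP => h.
  by apply: H; exists i.
pose g := opsub (euler A i) (opscal (be i 0)).
have := RHA_act (HV g (ex_intro _ i erefl)) y.
have pg : polyfun (fun z => (cA *m z) i 0 - be i 0).
  exact: (polyfun_mulmx cA (polyfun_sub (polyfun_coord i) (polyfun_cst _ (be i 0)))).
rewrite act_comp //; last by rewrite /g euler_gensE; apply: LW_homog.
rewrite /g euler_gensE act_homog // zc0 addr0 => /eqP.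
rewrite mulf_eq0 (negPf yi) orbF => /eqP h; rewrite -[RHS]h; congr act.
by apply/funext => u; rewrite /euler_fiber addr0 /y zcD [zc C u + _]addrC addrA.
Qed.

Lemma degree_transport_Ele al be U V : W U -> W V ->
  RHA_ideal A al (opsub (opcomp V U) (@opid C n)) ->
  (forall g, euler_gens A be g -> RHA_ideal A al (opcomp V g)) -> Ele A al be.
Proof.
move=> WU WV HVU HV tau _ lam _ [lam' [hC [hZ [c [z [z0 Ecz]]]]]].
exists lam'; do 2!split=> //.
have [g [g0 Eg]] := hC.
(* A preimage of al in C^n whose coordinates off tau are natural. They remain so after transport,
   which keeps be - lam' in NA + Z(A cap tau). *)
pose x : 'cV[C]_n := \col_j (g j + (c j)%:R + (z j)%:~R).
have cAE (y : 'I_n -> C) : cA *m (\col_j y j) = comb A y.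
  apply/matrixP => i j; rewrite ord1 !mxE summxE; apply: eq_bigr => l _.
  by rewrite !mxE mulrC.
have Ex : cA *m x = al.
  rewrite cAE -[al](subrK lam') Ecz Eg addrC -/(comb A _) -/(comb A _) -combD.
  by apply: eq_bigr => j _; rewrite addrA.
have [v [Ev gv]] := degree_transport WU WV HVU HV Ex.
have /choice[e He] : forall j, exists e : nat, ~ tau (colR R A j) -> (c j)%:Z + v j 0 = e%:Z.
  move=> j; have [t|nt] := pselect (tau (colR R A j)); first by exists 0%N.
  have xj : x j 0 = (c j)%:R by rewrite mxE g0 // z0 // add0r addr0.
  have [b Eb] := gv j _ xj; exists b => _; apply/eqP; rewrite -(eqr_int C) intrD.
  by rewrite -[(c j)%:Z%:~R]/((c j)%:R) -xj Eb.
exists (fun j => if pselect (tau (colR R A j)) then c j else e j),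
       (fun j => if pselect (tau (colR R A j)) then z j + v j 0 else 0).
split=> [j nt|]; first by case: pselect.
have Exv : x + zc C v = \col_j (g j + (c j)%:R + (z j)%:~R + (v j 0)%:~R).
  by apply/matrixP => i j; rewrite ord1 !mxE.
rewrite -Ev Exv cAE Eg -/(comb A _) -combB; apply: eq_bigr => j _; congr (_ *: _).
case: pselect => [t|nt] /=; first by rewrite intrD; ring.
rewrite addr0 z0 // -[(e j)%:R]/((e j)%:Z%:~R) -He // intrD -[(c j)%:Z%:~R]/((c j)%:R).
by rewrite g0 //; ring.
Qed.

Lemma RightModIso_simA al be :
  ModIso false W (RHA_ideal A al) (RHA_ideal A be) -> simA A al be.
Proof.
have sW := Weyl_subring C n.
move=> /(ModIso_iff sW (RHA_is_ideal al) (RHA_is_ideal be)).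
move=> [U [V [WU WV hU hV [uv vu]]]]; apply/simA_Ele; split.
  apply: (degree_transport_Ele WU WV) => // g hg.
  exact/hV/RHA_euler.
apply: (degree_transport_Ele WV WU) => // g hg.
exact/hU/RHA_euler.
Qed.

End HypergeometricRight.

(** * The anti-automorphism of the Weyl algebra *)

Section Transposition.
Variables (C : numFieldType) (n : nat).
Implicit Types (P Q : Op C n) (f g : Ser C n) (m u v : 'cV[int]_n).
Local Notation W := (@Weyl C n).

Definition mfact m : C := \prod_i ((absz (m i 0))`!)%:R.

(** The coefficient of t^m in the transpose of P applied to g, namely the pairing of P t^m with
    g. *)
Definition coact P g m : C := act P (fun v => g (m + v)) (zc C m).

(* x^u d^v and x^v d^u are adjoint for <x^m, x^m'> = m! [m = m']. *)
Definition adjoint P Q := forall f, (forall m, ~ natpos m -> f m = 0) ->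
  forall m, natpos m -> mfact m * Q f m = coact P (fun m' => mfact m' * f m') m.

Lemma act_eq P F F' m : W P -> natpos m ->
  (forall v, natpos (m + v) -> F v = F' v) -> act P F (zc C m) = act P F' (zc C m).
Proof.
rewrite Weyl_stab => -[lP hP] mp E; apply/eqP; rewrite -subr_eq0; apply/eqP.
rewrite -[RHS](hP m mp (fun v => F v - F' v)); last by move=> v /E ->; rewrite subrr.
by rewrite /act /lact -sumrB; apply: eq_bigr => t _; rewrite mulrBl.
Qed.

Lemma adjoint_add P P' Q Q' : W P -> W P' -> adjoint P Q -> adjoint P' Q' ->
  adjoint (opadd P P') (opadd Q Q').
Proof.
move=> WP WP' h h' f f0 m mp; rewrite /coact act_add; try exact: Weyl_LW.
by rewrite /opadd mulrDr h // h'.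
Qed.

Lemma adjoint0 : adjoint (@opzero C n) (@opzero C n).
Proof. by move=> f f0 m mp; rewrite /coact act0 mulr0. Qed.

Lemma adjoint_comp P P' Q Q' : W P -> W P' -> W Q ->
  adjoint P Q -> adjoint P' Q' -> adjoint (opcomp P P') (opcomp Q' Q).
Proof.
move=> WP WP' WQ h h' f f0 m mp; rewrite -[opcomp Q' Q f]/(Q' (Q f)) h' //; last first.
  by move=> m' nm'; rewrite Weyl_stab in WQ; apply: (stab_support WQ).
rewrite /coact act_comp; try exact: Weyl_LW.
apply: act_eq => // v mv; rewrite h // /coact zcD; congr act.
by apply/funext => u; rewrite [u + v]addrC addrA.
Qed.

Lemma mfact_neq0 m : mfact m != 0.
Proof. by apply/prodf_neq0 => i _; rewrite pnatr_eq0 -lt0n fact_gt0. Qed.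

(** The factorials are nonzero, so the action on polynomials is determined by P, and a Weyl operator
    is determined by that action. *)
Lemma adjoint_unique P Q Q' : W Q -> W Q' -> adjoint P Q -> adjoint P Q' -> Q = Q'.
Proof.
move=> WQ WQ' h h'; apply: LW_eq; try exact: Weyl_LW.
move=> u x; have [lQ lQ'] := (Weyl_LW WQ, Weyl_LW WQ').
suff -> : sym Q u = sym Q' u by [].
apply: polyfun_eq; try exact: polyfun_act.
move=> w; rewrite -zc_natvec.
have E : u = natvec w + u - natvec w by rewrite addrC addKr.
rewrite E -!act_delta // .
have d0 m : ~ natpos m -> delta C (natvec w) m = 0.
  by rewrite /delta; case: eqP => // -> []; apply: natpos_natvec.
have [mp|nmp] := pselect (natpos (natvec w + u)).
  by apply: (mulfI (mfact_neq0 (natvec w + u))); rewrite h // h'.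
rewrite Weyl_stab in WQ WQ'.
by rewrite !(stab_support _ d0 nmp).
Qed.

(** Both sides equal a! e! / r! with r = a - t = e - s, and both vanish when t > a. *)
Lemma ffact_swap (a e s t : nat) : (e + t = a + s)%N ->
  (a`! * e ^_ s = a ^_ t * e`!)%N.
Proof.
move=> E; case: (leqP t a) => ta; last first.
  rewrite [e ^_ s]ffact_small; last by lia.
  by rewrite [a ^_ t]ffact_small // muln0.
have se : (s <= e)%N by lia.
rewrite -(ffact_fact ta) -(ffact_fact se).
have -> : (a - t = e - s)%N by lia.
by rewrite mulnAC mulnA.
Qed.

Lemma adjoint_mono (c : C) (u w : {ffun 'I_n -> nat}) :
  adjoint (mono c (natvec u) w) (mono c (natvec w) u).
Proof.
move=> f f0 m /natposP[a ->]; rewrite /coact !monoE act_homog; last exact: polyfun_cfall.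
rewrite /homog zc_natvec.
have Em : natvec a - (natvec w - natvec u) = natvec a + (natvec u - natvec w) :> 'cV[int]_n.
  by rewrite opprB.
rewrite Em; set m' := natvec a + _.
have [/natposP[e Ee]|nm'] := pselect (natpos m'); last by rewrite f0 // !mulr0 mul0r.
rewrite Ee zc_natvec !fall_ncol /mfact -!natr_prod.
have key : ((\prod_(i < n) (absz (natvec a i 0)%R)`!) * \prod_i (e i ^_ u i) =
    (\prod_i (a i ^_ w i)) * \prod_(i < n) (absz (natvec e i 0)%R)`!)%N.
  rewrite -!big_split; apply: eq_bigr => i _ /=; rewrite !mxE !absz_nat.
  apply: ffact_swap; have := congr1 (fun z : 'cV[int]_n => z i 0) Ee; rewrite !mxE.
  by move: (a i) (u i) (w i) (e i) => x y z t; lia.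
have /= := congr1 (fun N => c * N%:R * f (natvec e)) key; rewrite !natrM => E.
transitivity (c * ((\prod_(i < n) (absz (natvec a i 0)%R)`!)%:R * (\prod_i (e i ^_ u i))%:R) * f (natvec e)).
  by ring.
by rewrite E; ring.
Qed.

Definition transposed P Q := [/\ W P, W Q, adjoint P Q & adjoint Q P].

Lemma transposed_sym P Q : transposed P Q -> transposed Q P.
Proof. by case. Qed.

Lemma transposed_unique P Q Q' : transposed P Q -> transposed P Q' -> Q = Q'.
Proof. by move=> [_ WQ h _] [_ WQ' h' _]; apply: adjoint_unique h h'. Qed.

Lemma transposed_comp P P' Q Q' : transposed P Q -> transposed P' Q' ->
  transposed (opcomp P P') (opcomp Q' Q).
Proof.
have sW := Weyl_subring C n.
move=> [WP WQ h k] [WP' WQ' h' k']; split.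
- exact: (sub_mul true sW WP WP').
- exact: (sub_mul true sW WQ' WQ).
- exact: adjoint_comp.
- exact: adjoint_comp.
Qed.

Lemma transposed_add P P' Q Q' : transposed P Q -> transposed P' Q' ->
  transposed (opadd P P') (opadd Q Q').
Proof.
have sW := Weyl_subring C n.
move=> [WP WQ h k] [WP' WQ' h' k'].
by split; [exact: sub_add sW _ _ _ _|exact: sub_add sW _ _ _ _|exact: adjoint_add|exact: adjoint_add].
Qed.

Lemma transposed0 : transposed (@opzero C n) (@opzero C n).
Proof. by split; [exact: LWwith_0|exact: LWwith_0|exact: adjoint0|exact: adjoint0]. Qed.

Lemma transposed_mono (c : C) (u w : {ffun 'I_n -> nat}) :
  transposed (mono c (natvec u) w) (mono c (natvec w) u).
Proof.
by split; [apply/Weyl_mono/natpos_natvec|apply/Weyl_mono/natpos_natvec|apply: adjoint_mono|apply: adjoint_mono].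
Qed.

Lemma transposed_opsum (T : Type) (s : seq T) (F G : T -> Op C n) :
  (forall t, List.In t s -> transposed (F t) (G t)) ->
  transposed (opsum [seq F t | t <- s]) (opsum [seq G t | t <- s]).
Proof.
elim: s => [_|t s IH H] /=; first exact: transposed0.
by apply: transposed_add; [apply: H; left|apply: IH => t' h; apply: H; right].
Qed.

Lemma transposed_exists P : W P -> exists Q, transposed P Q.
Proof.
move=> /Weyl_list[s [hs ->]].
have /choice[r Hr] : forall u, exists w : {ffun 'I_n -> nat}, natpos u -> u = natvec w.
  move=> u; have [/natposP[w Ew]|nu] := pselect (natpos u); first by exists w.
  by exists [ffun=> 0%N].
exists (opsum [seq mono t.1 (natvec t.2.2) (r t.2.1)
   | t : C * ('cV[int]_n * {ffun 'I_n -> nat}) <- s]).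
apply: transposed_opsum => t ts.
have /Hr E : natpos t.2.1.
  by apply: hs; elim: (s) ts => //= t' s' IH [->|/IH]; rewrite inE ?eqxx // => ->; rewrite orbT.
by rewrite [X in mono _ X](E); apply: transposed_mono.
Qed.

Lemma tmul_mono (u : {ffun 'I_n -> nat}) : @tmul C n (natvec u) = mono 1 (natvec u) [ffun=> 0%N].
Proof.
apply/funext => f; apply/funext => m; rewrite monoE /homog /fall big1 => [|i _]; last first.
  by rewrite ffunE /fallfact big_ord0.
rewrite !mul1r /tmul; congr (f (_ - _)).
by apply/matrixP => i j; rewrite !mxE ffunE subr0.
Qed.

Lemma tderpow_mono (u : {ffun 'I_n -> nat}) :
  @tderpow C n u = mono 1 (natvec [ffun=> 0%N]) u.
Proof.
apply/funext => f; apply/funext => m; rewrite /mono /opcomp /opscal /tmul mul1r.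
by congr tderpow; rewrite -[LHS]subr0; congr (_ - _); apply/matrixP => i j; rewrite !mxE ffunE.
Qed.

Lemma transposed_tder (u : {ffun 'I_n -> nat}) : transposed (tderpow u) (tmul (natvec u)).
Proof. by rewrite tmul_mono tderpow_mono; apply: transposed_mono. Qed.

Lemma transposed_scal (c : C) : transposed (opscal c) (opscal c).
Proof.
have -> : @opscal C n c = mono c (natvec [ffun=> 0%N]) [ffun=> 0%N].
  apply/funext => f; apply/funext => m; rewrite monoE /homog subrr subr0.
  by rewrite /fall big1 ?mulr1 // => i _; rewrite ffunE /fallfact big_ord0.
exact: transposed_mono.
Qed.

Lemma transposed_id : transposed (@opid C n) (@opid C n).
Proof. by rewrite -opscal1; apply: transposed_scal. Qed.

Lemma transposed_sub P P' Q Q' : transposed P Q -> transposed P' Q' ->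
  transposed (opsub P P') (opsub Q Q').
Proof.
move=> h h'; have lQ' : LaurentWeyl Q' by case: h' => _ /Weyl_LW.
rewrite !opsubE -[opcomp _ Q'](opmul_scal false) //.
by apply: transposed_add => //; apply: transposed_comp h' => //; apply: transposed_scal.
Qed.

(** Transposition reverses products and thus exchanges left and right ideals; since the transpose is
    unique, quantifying over all Q is the same as choosing one. *)
Lemma transposed_ideal b (I : Op C n -> Prop) : IsIdeal b W I ->
  IsIdeal (~~ b) W (fun P => W P /\ forall Q, transposed P Q -> I Q).
Proof.
have sW := Weyl_subring C n.
move=> iI; split; first by move=> P [].
split.
  split; first exact: LWwith_0.
  by move=> Q /(transposed_unique transposed0) <-; apply: ideal0 iI.
split.
  move=> P P' [WP h] [WP' h']; split; first exact: sub_add sW _ _ _ _.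
  have [[Q hQ] [Q' hQ']] := (transposed_exists WP, transposed_exists WP').
  move=> _ /(transposed_unique (transposed_add hQ hQ')) <-.
  by apply: (ideal_add iI); [apply: h|apply: h'].
move=> X P WX [WP h]; split; first exact: (sub_mul _ sW WX WP).
have [[Q hQ] [Y hY]] := (transposed_exists WP, transposed_exists WX).
have WY : W Y by case: hY.
have := ideal_mul iI WY (h _ hQ); rewrite /opmul; case: b {iI} => /= IQ Z.
  by move=> /(transposed_unique (transposed_comp hQ hY)) <-.
by move=> /(transposed_unique (transposed_comp hY hQ)) <-.
Qed.

(** Multiplication by U on one side becomes multiplication by its transpose on the other. *)
Lemma ModIso_transposed b (I J I' J' : Op C n -> Prop) :
  IsIdeal b W I -> IsIdeal b W J -> IsIdeal (~~ b) W I' -> IsIdeal (~~ b) W J' ->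
  (forall P Q, transposed P Q -> I P <-> I' Q) ->
  (forall P Q, transposed P Q -> J P <-> J' Q) ->
  ModIso b W I J -> ModIso (~~ b) W I' J'.
Proof.
have sW := Weyl_subring C n.
move=> iI iJ iI' iJ' EI EJ /(ModIso_iff sW iI iJ)[U [V [WU WV hU hV [uv vu]]]].
have [[U' tU] [V' tV]] := (transposed_exists WU, transposed_exists WV).
have tmulb P P' Q Q' : transposed P Q -> transposed P' Q' ->
    transposed (opmul b P P') (opmul (~~ b) Q Q').
  by move=> h h'; rewrite /opmul; case: b {iI iJ iI' iJ' hU hV uv vu}; apply: transposed_comp.
apply/(ModIso_iff sW iI' iJ'); exists U', V'; split; try by [case: tU|case: tV].
- move=> X HX; have [Y tY] := transposed_exists (ideal_sub iI' HX).
  have tY' := transposed_sym tY.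
  by apply/(EJ _ _ (tmulb _ _ _ _ tY' tU)); apply: hU; apply/(EI _ _ tY').
- move=> X HX; have [Y tY] := transposed_exists (ideal_sub iJ' HX).
  have tY' := transposed_sym tY.
  by apply/(EI _ _ (tmulb _ _ _ _ tY' tV)); apply: hV; apply/(EJ _ _ tY').
- split.
    by apply/(EI _ _ (transposed_sub (tmulb _ _ _ _ tU tV) transposed_id)).
  by apply/(EJ _ _ (transposed_sub (tmulb _ _ _ _ tV tU) transposed_id)).
Qed.

End Transposition.

(** * Left hypergeometric modules by transposition *)

Section HypergeometricLeft.
Variables (R : realType) (d n : nat) (A : 'M[int]_(d, n)).
Local Notation C := (complex R).
Local Notation W := (@Weyl C n).
Implicit Types (P Q : Op C n) (al be : 'cV[C]_d).

(** Each x_j d_j is its own transpose, so the Euler generators are the same on both sides. *)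
Lemma transposed_euler al i : let g := opsub (euler A i) (opscal (al i 0)) in
  transposed (g : Op C n) g.
Proof.
apply: transposed_sub; last exact: transposed_scal.
pose e j : {ffun 'I_n -> nat} := [ffun l => (l == j) : nat].
have -> : euler A i = opsum [seq mono (A i j)%:~R (natvec (e j)) (e j) | j <- enum 'I_n] :> Op C n.
  rewrite /euler; congr opsum; apply: eq_map => j; rewrite /mono; congr opcomp.
  have Ej : natvec (e j) = delta_mx j 0.
    by apply/matrixP => a b; rewrite ord1 !mxE ffunE eqxx andbT; case: (a == j).
  apply/funext => f; apply/funext => m; rewrite /opcomp Ej /tmul tderpowE Ej /tder zcD.
  congr (_ * _); rewrite /fall (bigD1 j) //= big1 ?mulr1 => [|l /negPf lj].
    by rewrite ffunE eqxx /fallfact big_ord_recl big_ord0 mulr1 subr0 !mxE !eqxx intrD.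
  by rewrite ffunE lj /fallfact big_ord0.
by apply: transposed_opsum => j _; apply: transposed_mono.
Qed.

Lemma tderpow_finfun (u : 'I_n -> nat) : @tderpow C n u = tderpow (finfun u).
Proof. by congr tderpow; apply/funext => i; rewrite ffunE. Qed.

Lemma natvec_finfun (u : 'I_n -> nat) : natvec u = natvec (finfun u) :> 'cV[int]_n.
Proof. by apply/matrixP => i j; rewrite !mxE ffunE. Qed.

Lemma transposed_IA_gens u v :
  transposed (opsub (@tderpow C n u) (tderpow v)) (opsub (tmul (natvec u)) (tmul (natvec v))).
Proof.
rewrite (tderpow_finfun u) (tderpow_finfun v) (natvec_finfun u) (natvec_finfun v).
by apply: transposed_sub; apply: transposed_tder.
Qed.

Lemma PolyD_Weyl P : PolyD P -> W P.
Proof.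
case=> s [hs ->]; apply: Weyl_opsum => t /hs E; apply: Weyl_mono => i.
by rewrite E mxE.
Qed.

Lemma IA_del_Weyl P : IA_del A P -> W P.
Proof.
have sW := Weyl_subring C n.
move=> [s [hs ->]]; apply: Weyl_opsum => t /hs[/PolyD_Weyl W1 [u [v [_ E]]]].
apply: (sub_mul true sW W1); rewrite E.
by case: (transposed_IA_gens u v).
Qed.

Lemma HA_is_ideal al : IsIdeal true W (HA_ideal A al).
Proof.
apply: IdSum_ideal; apply: (Gen_ideal true (Weyl_subring _ _)) => g.
  exact: euler_gens_Weyl.
exact: IA_del_Weyl.
Qed.

Lemma HA_euler al g : euler_gens A al g -> HA_ideal A al g.
Proof.
move=> hg; exists g, (@opzero C n); split.
  by rewrite -[g](opmul1l true); apply: Gen_mem => //; apply: (sub_id (Weyl_subring _ _)).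
split; first by exists [::].
by apply/funext => f; apply/funext => m; rewrite /opadd addr0.
Qed.

Lemma HA_IA_gens al u v : sameA A u v -> HA_ideal A al (opsub (tderpow u) (tderpow v)).
Proof.
move=> E; exists (@opzero C n), (opsub (tderpow u) (tderpow v)).
split; first by exists [::].
split; last by apply/funext => f; apply/funext => m; rewrite /opadd add0r.
set g := opsub _ _.
rewrite -[g](opmul1l true); apply: Gen_mem; first exact: sub_id (Weyl_subring _ _).
exists [:: (@opid C n, g)]; split=> [_ [<-|[]]|] /=; last first.
  by apply/funext => f; apply/funext => m; rewrite /opadd addr0.
split; last by exists u, v.
exact: LWwith_id.
Qed.

Lemma HA_RHA al P Q : transposed P Q -> HA_ideal A al P -> RHA_ideal A al Q.
Proof.
have sW := Weyl_subring C n.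
move=> tPQ HP; suff [_ H] : W P /\ forall Q, transposed P Q -> RHA_ideal A al Q by apply: H.
have iN := transposed_ideal (RHA_is_ideal A al).
move: HP => {tPQ} [P1 [P2 [H1 [H2 ->]]]]; apply: (ideal_add iN).
  apply: (Gen_sub iN _ H1) => g hg; split; first exact: euler_gens_Weyl hg.
  case: hg => i -> Q' /(transposed_unique (transposed_euler al i)) <-.
  by apply: RHA_euler; exists i.
apply: (Gen_sub iN _ H2) => _ [s [hs ->]]; apply: (ideal_opsum iN) => t /hs[h1 [u [v [E Et]]]].
apply: (ideal_mul iN (PolyD_Weyl h1)); rewrite Et; split.
  by case: (transposed_IA_gens u v).
move=> Q' /(transposed_unique (transposed_IA_gens u v)) <-.
have [//|W1 K1] := IA_x_gens_killed (R := R) (A := A) (g := opsub (tmul (natvec u)) (tmul (natvec v))).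
  by exists u, v.
exact: RHA_killed.
Qed.

(** I_A(x) is written with coefficients to the left of its generators, while a right ideal needs the
    generators leftmost; commutativity of C[x] allows the exchange. *)
Lemma PolyX_comm P u : PolyX P -> opcomp P (@tmul C n u) = opcomp (tmul u) P.
Proof.
move=> /PolyX_list[s [_ ->]]; apply/funext => f; apply/funext => m.
rewrite /opcomp /tmul !opsumE; apply: eq_bigr => t _.
by rewrite /homog addrAC.
Qed.

Lemma RHA_HA al P Q : transposed P Q -> RHA_ideal A al P -> HA_ideal A al Q.
Proof.
have sW := Weyl_subring C n.
move=> tPQ HP; suff [_ H] : W P /\ forall Q, transposed P Q -> HA_ideal A al Q by apply: H.
have iN := transposed_ideal (HA_is_ideal al).
move: HP => {tPQ} [P1 [P2 [H1 [H2 ->]]]]; apply: (ideal_add iN).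
  apply: (Gen_sub iN _ H1) => g hg; split; first exact: euler_gens_Weyl hg.
  case: hg => i -> Q' /(transposed_unique (transposed_euler al i)) <-.
  by apply: HA_euler; exists i.
apply: (Gen_sub iN _ H2) => _ [s [hs ->]]; apply: (ideal_opsum iN) => t /hs[h1 [u [v [E Et]]]].
have [W1 _] := PolyX_lifted A h1.
have -> : opcomp t.1 t.2 = opmul false t.1 t.2.
  rewrite Et /opmul -[LHS]/(opmul true _ _) opmulBr; try exact: Weyl_LW.
    by rewrite /opmul !PolyX_comm.
  exact/Weyl_LW/tmul_Weyl.
apply: (ideal_mul iN W1); rewrite Et; split.
  by case: (transposed_IA_gens u v).
move=> Q' /(transposed_unique (transposed_sym (transposed_IA_gens u v))) <-.
exact: HA_IA_gens.
Qed.

Lemma LeftModIso_HA al be : ModIso true W (HA_ideal A al) (HA_ideal A be) <->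
  ModIso false W (RHA_ideal A al) (RHA_ideal A be).
Proof.
have E g P Q : transposed P Q -> HA_ideal A g P <-> RHA_ideal A g Q.
  by move=> t; split; [apply: HA_RHA|apply: RHA_HA; apply: transposed_sym].
split.
  apply: (@ModIso_transposed _ _ true); try exact: HA_is_ideal; try exact: RHA_is_ideal.
    exact: E.
  exact: E.
apply: (@ModIso_transposed _ _ false); try exact: HA_is_ideal; try exact: RHA_is_ideal.
  by move=> P Q /transposed_sym t; apply: iff_sym; apply: E.
by move=> P Q /transposed_sym t; apply: iff_sym; apply: E.
Qed.

End HypergeometricLeft.

Theorem theorem5p10 (R : realType) (d n : nat) (A : 'M[int]_(d, n))
  (A_inj : injective (fun j : 'I_n => col j A))
  (A_gen : forall m : 'cV[int]_d, exists c : 'cV[int]_n, m = A *m c)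
  (al be : 'cV[complex R]_d) :
  let DRA := DRA A in
  (simA A al be <-> LeftModIso (@Weyl _ n) (HA_ideal A al) (HA_ideal A be)) /\
  (simA A al be <-> RightModIso (@Weyl _ n) (RHA_ideal A al) (RHA_ideal A be)) /\
  (simA A al be <-> LeftModIso DRA (M_ideal A al) (M_ideal A be)) /\
  (simA A al be <-> RightModIso DRA (RM_ideal A al) (RM_ideal A be)) /\
  (simA A al be <->
     forall N N', MaxLeftOver DRA (M_ideal A al) N ->
                  MaxLeftOver DRA (M_ideal A be) N' -> LeftModIso DRA N N') /\
  (simA A al be <->
     forall N N', MaxRightOver DRA (RM_ideal A al) N ->
                  MaxRightOver DRA (RM_ideal A be) N' -> RightModIso DRA N N').
Proof.
move=> D.
have E := simA_connected A_gen al be.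
have right_iff : simA A al be <-> ModIso false (@Weyl _ n) (RHA_ideal A al) (RHA_ideal A be).
  by split=> [/E|]; [apply: connected_RightModIso|apply: RightModIso_simA].
have [sD pD gD] : [/\ subring D, forall p, polyfun p -> D (homog 0 p)
    & forall P u, D P -> D (homog u (sym P u))].
  rewrite /D DRA_stab; split; [exact: stab_subring|exact: stab_poly|].
  by move=> P u; apply: stab_graded.
(* For either side of multiplication, connectedness reduces to the same condition on p and q, which
   handles the statements on M and L together. *)
have Eb b : simA A al be <-> weight_connected b D al be by rewrite E connected_DRA.
have MI b := ModIso_M b sD pD gD al be; have MM b := ModIso_Max b sD pD gD al be.
split; first exact: iff_trans right_iff (iff_sym (LeftModIso_HA A al be)).
split; first exact: right_iff.
rewrite /M_ideal /RM_ideal !s_gens_wgens.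
split; first exact: iff_trans (Eb true) (iff_sym (MI true)).
split; first exact: iff_trans (Eb false) (iff_sym (MI false)).
split; first exact: iff_trans (Eb true) (iff_sym (MM true)).
exact: iff_trans (Eb false) (iff_sym (MM false)).
Qed.
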